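(* Let $\mathscr{X}_n$ be the variety of complete quadrics in $\mathbb{P}^{n-1}$ and $b(\mathscr{X}_n)$ the number of orbits of the upper triangular Borel subgroup $B\subset\mathrm{SL}_n(\mathbb{C})$ on it; let $\mathscr{X}_e$ be the equivariant wonderful embedding of $\mathrm{SL}_n$ and $b(\mathscr{X}_e)$ the number of $B\times B$-orbits on it; let $F_n$ be the $n$-th Fibonacci number. Then for all sufficiently large $n$, $$F_n\,n!<b(\mathscr{X}_n)<2^{n-1}n!<b(\mathscr{X}_e).$$
   Context: $\mathscr{X}_n$ is the closure of the image of $[A]\mapsto([\Lambda^1 A],\dots,[\Lambda^{n-1}A])\in\prod_{i=1}^{n-1}\mathbb{P}(\Lambda^i(\mathrm{Sym}_n))$, $A$ ranging over invertible symmetric complex $n\times n$ matrices, with $\mathrm{SL}_n$ acting via $g\cdot A=(g^\top)^{-1}Ag^{-1}$. $\mathscr{X}_e$ is the De Concini–Procesi wonderful compactification of $(\mathrm{SL}_n\times\mathrm{SL}_n)/H$, $H$ the normalizer of the diagonal, with $\mathrm{SL}_n\times\mathrm{SL}_n$ acting by left and right multiplication. Fibonacci numbers are normalized so that $F_n\sim\frac{1}{\sqrt5}\left(\frac{1+\sqrt5}{2}\right)^n$. *)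

(* Defs.v *)
From HB Require Import structures.
From mathcomp Require Import all_boot all_order all_algebra.
From mathcomp Require Import boolp classical_sets functions cardinality reals.
From mathcomp Require Import complex mpoly.

Set Implicit Arguments.
Unset Strict Implicit.
Unset Printing Implicit Defensive.

Import Order.TTheory GRing.Theory Num.Theory.

Local Open Scope classical_set_scope.
Local Open Scope ring_scope.

Fixpoint fib (n : nat) : nat :=
  if n is n1.+1 then if n1 is n2.+1 then (fib n1 + fib n2)%N else 1%N else 0%N.

(* The k-subsets of 'I_n, encoded as strictly increasing maps 'I_k -> 'I_n; they
   index the standard basis of the k-th exterior power of F^n. *)
Definition strict_incr (n k : nat) (f : {ffun 'I_k -> 'I_n}) : bool :=
  [forall a : 'I_k, forall b : 'I_k, (a < b)%N ==> (f a < f b)%N].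

Definition ksub (n k : nat) : finType := {f : {ffun 'I_k -> 'I_n} | strict_incr f}.

Definition ext_dim (n k : nat) : nat := #|{: ksub n k}|.

Definition ksub_of_ord (n k : nat) (a : 'I_(ext_dim n k)) : ksub n k :=
  enum_val a.

Section ExteriorPower.
Variable F : fieldType.

(* Lambda^k A, i.e. the matrix of all k x k minors of A. *)
Definition ext_pow (n k : nat) (A : 'M[F]_n) : 'M[F]_(ext_dim n k) :=
  \matrix_(a, b) \det (mxsub (val (ksub_of_ord a)) (val (ksub_of_ord b)) A).

End ExteriorPower.

(* A point of the product over i of the P('M[F]_(m i)) is a family of lines,
   i.e. of one-dimensional subspaces. *)
Section MultiProjective.
Variables (F : fieldType) (I : finType) (m : I -> nat).

Definition lines : Type := forall i : I, {vspace 'M[F]_(m i)}.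

Definition multiproj : set lines := [set x | forall i, \dim (x i) = 1%N].

Definition coord : finType := {i : I & ('I_(m i) * 'I_(m i))%type}.

Definition coords (v : forall i, 'M[F]_(m i)) (c : 'I_#|{: coord}|) : F :=
  v (tag (enum_val c)) (tagged (enum_val c)).1 (tagged (enum_val c)).2.

Definition multihomogeneous (p : {mpoly F[#|{: coord}|]}) : Prop :=
  exists d : I -> nat, forall mon, mon \in msupp p ->
    forall i, (\sum_(c < #|{: coord}| | tag (enum_val c) == i) mon c)%N = d i.

Definition vanishes_at (p : {mpoly F[#|{: coord}|]}) (x : lines) : Prop :=
  forall v : forall i, 'M[F]_(m i),
    (forall i, x i = <[v i]>%VS) -> p.@[coords v] = 0.

Definition zariski_closure (S : set lines) : set lines :=
  [set x | multiproj x /\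
     forall p, multihomogeneous p ->
       (forall y, S y -> vanishes_at p y) -> vanishes_at p x].

End MultiProjective.

Section Orbits.
Variables (G X : Type).

Definition orbit_of (B : set G) (act : G -> X -> X) (x : X) : set X :=
  [set act b x | b in B].

(* The set of B-orbits on Y (for Y stable under B) has exactly N elements; in
   particular it is finite. *)
Definition orbit_count (B : set G) (act : G -> X -> X) (Y : set X) (N : nat) :
  Prop := ([set orbit_of B act x | x in Y] #= `I_N)%card.

End Orbits.

Section Varieties.
Variables (F : fieldType) (n : nat).

Definition SL : set 'M[F]_n := [set g | \det g = 1].

(* [is_trig_mx] means lower triangular, hence the transpose. *)
Definition borel : set 'M[F]_n := [set g | SL g /\ is_trig_mx g^T].

(* The index k : 'I_n.-1 stands for the exterior power of degree k.+1, so that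
   the degrees are 1, ..., n - 1. *)
Definition flines : Type := lines F (fun k : 'I_n.-1 => ext_dim n k.+1).

Definition ext_lines (A : 'M[F]_n) : flines := fun k => <[ext_pow k.+1 A]>%VS.

(* The map induced on each factor by A |-> P *m A *m Q. *)
Definition lr_act (P Q : 'M[F]_n) (x : flines) : flines :=
  fun k => ((linfun (mulmxr (ext_pow k.+1 Q)) \o linfun (mulmx (ext_pow k.+1 P)))
              @: x k)%VS.

Definition complete_quadrics : set flines :=
  zariski_closure [set ext_lines A | A in [set A | A \in unitmx /\ A^T = A]].

(* g . A = (g^T)^-1 A g^-1 *)
Definition quadric_act (g : 'M[F]_n) : flines -> flines :=
  lr_act (invmx g^T) (invmx g).

Definition group_embedding (g : 'M[F]_n * 'M[F]_n) : flines :=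
  ext_lines (g.1 *m invmx g.2).

(* The wonderful compactification of (SL_n x SL_n) / H, as the closure of the
   orbit map of the point ([Lambda^k id])_k in the product of the projective
   spaces of End(Lambda^k F^n), 1 <= k <= n - 1.  These Lambda^k F^n are the
   fundamental representations of SL_n; the Segre embedding identifies this with
   the closure of the orbit of [id] for the regular weight which is the sum of
   the fundamental weights.  Lemma [group_embedding_fiber] below checks that the
   orbit is (SL_n x SL_n) / H. *)
Definition wonderful_group : set flines :=
  zariski_closure [set group_embedding g | g in SL `*` SL].

(* (g, h) . A = g A h^-1 *)
Definition group_act (g : 'M[F]_n * 'M[F]_n) : flines -> flines :=
  lr_act g.1 (invmx g.2).

(* H : the normalizer of the diagonal of SL_n x SL_n. *)
Definition diag_normalizer : set ('M[F]_n * 'M[F]_n) :=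
  [set g | [/\ SL g.1, SL g.2 &
    [set (g.1 *m x *m invmx g.1, g.2 *m x *m invmx g.2) | x in SL] =
    [set (x, x) | x in SL]]].

End Varieties.

Section GroupEmbedding.
Variables (F : fieldType) (n : nat).
Implicit Types (g h A B : 'M[F]_n).

Lemma ext_powZ k (c : F) A : ext_pow k (c *: A) = c ^+ k *: ext_pow k A.
Proof.
apply/matrixP => a b; rewrite !mxE -detZ; congr (\det _).
by apply/matrixP => i j; rewrite !mxE.
Qed.

Lemma ext_pow1_inj A B : ext_pow 1 A = ext_pow 1 B -> A = B.
Proof.
move=> eAB; apply/matrixP => i j.
have st (l : 'I_n) : strict_incr [ffun _ : 'I_1 => l].
  by apply/forallP => a; apply/forallP => b; rewrite !ord1.
pose s (l : 'I_n) : ksub n 1 := exist (fun f => is_true (strict_incr f)) _ (st l).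
move/matrixP/(_ (enum_rank (s i)) (enum_rank (s j))): eAB.
by rewrite !mxE /ksub_of_ord !enum_rankK !det_mx11 !mxE /= !ffunE.
Qed.

Lemma SL_unit g : SL g -> g \in unitmx.
Proof. by move=> dg; rewrite unitmxE dg unitr1. Qed.

Lemma SL_mul g h : SL g -> SL h -> SL (g *m h).
Proof. by rewrite /SL /= det_mulmx => -> ->; rewrite mulr1. Qed.

Lemma SL_inv g : SL g -> SL (invmx g).
Proof. by rewrite /SL /= det_inv => ->; rewrite invr1. Qed.

Lemma transvection_SL (i j : 'I_n) : i != j -> SL (1%:M + delta_mx i j : 'M[F]_n).
Proof.
move=> ij; wlog lt_ji : i j ij / (j < i)%N => [hw|].
  case: (ltngtP j i) => [ltji|ltij|eij]; first exact: hw.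
  - have := hw j i; rewrite eq_sym => /(_ ij ltij); rewrite /SL /= => dji.
    by rewrite -det_tr linearD /= trmx1 trmx_delta.
  - by case/negP: ij; apply/eqP/val_inj.
rewrite /SL /= det_trig.
  rewrite big1 // => l _; rewrite !mxE eqxx.
  case: eqP => [->|_] /=; last by rewrite addr0.
  by rewrite (negPf ij) addr0.
apply/is_trig_mxP => a b ab; rewrite !mxE.
have -> : (a == b) = false by apply/negbTE; rewrite neq_ltn ab.
case: eqP => [ea|_] /=; last by rewrite addr0.
case: eqP => [eb|_]; last by rewrite addr0.
by move: ab; rewrite ea eb ltnNge ltnW.
Qed.

Lemma commute_SL_scalar A : (forall x, SL x -> A *m x = x *m A) ->
  exists c, A = c%:M.
Proof.
move=> comA.
have cd i j : i != j -> A *m delta_mx i j = delta_mx i j *m A.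
  move=> ij; have := comA _ (transvection_SL ij).
  by rewrite mulmxDr mulmxDl mulmx1 mul1mx => /addrI.
have entry i j (p q : 'I_n) : i != j ->
    A p i * (q == j)%:R = (p == i)%:R * A j q.
  move=> ij; have /matrixP/(_ p q) := cd i j ij.
  rewrite !mxE (bigD1 i) //= big1 ?addr0; last first.
    by move=> l li; rewrite mxE (negPf li) mulr0.
  rewrite (bigD1 j) //= big1 ?addr0; last first.
    by move=> l lj; rewrite mxE (negPf lj) andbF mul0r.
  by rewrite !mxE eqxx /= eqxx andbT.
have off p i : p != i -> A p i = 0.
  move=> pi; have := entry i p p p; rewrite eq_sym => /(_ pi).
  by rewrite eqxx (negPf pi) mulr1 mul0r.
have diag i j : A i i = A j j.
  have [->//|ij] := eqVneq i j.
  by have := entry i j i j ij; rewrite !eqxx mulr1 mul1r.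
case: (pickP 'I_n) => [i0 _|n0]; last first.
  by exists 0; apply/matrixP => i; have := n0 i.
exists (A i0 i0); apply/matrixP => i j; rewrite mxE.
by have [->|ij] := eqVneq i j; [rewrite mulr1n (diag j i0) | rewrite mulr0n off].
Qed.

Lemma diag_normalizerP g h : SL g -> SL h ->
  diag_normalizer (g, h) <-> exists2 c, c != 0 & g = c *: h.
Proof.
move=> Sg Sh; have [Ug Uh] := (SL_unit Sg, SL_unit Sh); split.
  move=> [_ _ /= e]; have [|c ec] := @commute_SL_scalar (invmx h *m g).
    move=> x Sx.
    have : [set (y, y) | y in @SL F n] (g *m x *m invmx g, h *m x *m invmx h).
      by rewrite -e; exists x.
    case=> y _ [e1 e2].
    have e3 : g *m x *m invmx g = h *m x *m invmx h by rewrite -e1 -e2.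
    have : invmx h *m (g *m x *m invmx g) *m g =
           invmx h *m (h *m x *m invmx h) *m g by rewrite e3.
    by rewrite !mulmxA mulVmx // mul1mx mulmxKV // => ->; rewrite mulmxA.
  have eg : g = c *: h by rewrite -(mulKVmx Uh g) ec mul_mx_scalar.
  case: (posnP n) => [n0|n_gt0].
    exists 1; rewrite ?oner_eq0 //; apply/matrixP => -[i lti].
    by exfalso; move: lti; rewrite n0.
  exists c => //; apply/eqP => c0; move: Sg; rewrite /SL /= eg c0 detZ expr0n gtn_eqF //.
  by rewrite mul0r => /eqP; rewrite eq_sym oner_eq0.
move=> [c c0 eg]; split=> //=.
have conj x : g *m x *m invmx g = h *m x *m invmx h.
  rewrite eg invmxZ; last by rewrite -eg.
  by rewrite -!scalemxAl -scalemxAr scalerA divff // scale1r.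
rewrite eqEsubset; split=> _ [x Sx <-].
  exists (h *m x *m invmx h); last by rewrite conj.
  by apply: SL_mul; [exact: SL_mul | exact: SL_inv].
exists (invmx h *m x *m h).
  by apply: SL_mul => //; apply: SL_mul => //; exact: SL_inv.
by rewrite conj !mulmxA mulmxV // mul1mx mulmxK.
Qed.

Lemma group_embedding_fiber g h g' h' : (1 < n)%N ->
  SL g -> SL h -> SL g' -> SL h' ->
  group_embedding (g, h) = group_embedding (g', h') <->
  diag_normalizer (invmx g *m g', invmx h *m h').
Proof.
move=> n_gt1 Sg Sh Sg' Sh'.
have [Ug Uh Ug' Uh'] :=
  And4 (SL_unit Sg) (SL_unit Sh) (SL_unit Sg') (SL_unit Sh').
rewrite diag_normalizerP; try by apply: SL_mul => //; exact: SL_inv.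
split.
  have n1 : (0 < n.-1)%N by rewrite -subn1 subn_gt0.
  move=> /(congr1 (fun x : flines F n => x (Ordinal n1))).
  rewrite /group_embedding /ext_lines /= => e.
  have : ext_pow 1 (g' *m invmx h') \in <[ext_pow 1 (g *m invmx h)]>%VS.
    by rewrite e memv_line.
  move/vlineP => [c ec].
  have {}ec : g' *m invmx h' = c *: (g *m invmx h).
    by apply: ext_pow1_inj; rewrite ext_powZ expr1.
  have eg : invmx g *m g' = c *: (invmx h *m h').
    rewrite -(mulmxKV Uh' g') ec -scalemxAl -scalemxAr !mulmxA mulVmx //.
    by rewrite mul1mx.
  exists c => //; apply/eqP => c0.
  have : SL (invmx g *m g') by apply: SL_mul => //; exact: SL_inv.
  rewrite /SL /= eg c0 detZ expr0n gtn_eqF ?(ltnW n_gt1) //.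
  by rewrite mul0r => /eqP; rewrite eq_sym oner_eq0.
move=> [c c0 eg]; apply: functional_extensionality_dep => k.
rewrite /group_embedding /ext_lines /=.
have -> : g' *m invmx h' = c *: (g *m invmx h).
  rewrite -(mulKVmx Ug g') eg -!scalemxAr -scalemxAl !mulmxA.
  by rewrite mulmxK.
by rewrite ext_powZ; apply/esym/vspaceP => u; apply/vlineP/vlineP => -[a ->];
  [exists (a * c ^+ k.+1) | exists (a / c ^+ k.+1)];
  rewrite scalerA // divfK // expf_neq0.
Qed.

End GroupEmbedding.

(* Main.v *)
Require Import Defs.
From mathcomp Require Import all_boot all_order all_algebra fingroup perm.
From mathcomp Require Import boolp classical_sets functions cardinality reals.
From mathcomp Require Import complex mpoly.
From mathcomp Require Import zify ring.

(* Every point of either closure can be moved by the group into the affine chart of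
   nonzero leading minors.  There the LDU decomposition, written with regular functions,
   extends from the open orbit to its closure and shows that the point is the limit at
   X = 0 of an explicit polynomial matrix P diag(...) Q (with Q = P^T for quadrics).
   Gaussian elimination over F[X], pivoting on entries of minimal valuation with
   operations that are triangular at X = 0, reduces such a matrix to a monomial one.
   So an orbit on complete quadrics is given by an ordered set partition of the n indices
   together with an involution preserving its blocks; encoding the pair by a composition
   of n and a permutation bounds the number of orbits by 2^(n-1) n!, strictly, since a
   3-cycle is not an involution.  For compositions with parts 1 and 2 every permutation
   occurs, and the supports of the exterior powers tell the orbits apart, which gives at
   least F_(n+1) n! orbits.  On the group compactification the closed orbit alone has
   (n!)^2 orbits of B x B. *)

Set Implicit Arguments.
Unset Strict Implicit.
Unset Printing Implicit Defensive.

Import Order.TTheory GRing.Theory Num.Theory.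

Local Open Scope ring_scope.

(** * Exterior powers and the Cauchy-Binet formula *)

(** Membership in a Zariski closure yields only polynomial equations, so the difficulty is to
    produce curves. In the chart the LDU factors are quotients of forms by leading entries, so the
    factorization is an identity of regular functions and passes to the closure; the limiting curve
    then arises by putting X in place of each vanishing parameter, without any curve selection.
    Elimination over F[X] cannot divide. Denominators are cleared by the determinant of the pivot,
    which is nonzero at X = 0, and triangularity is required only at X = 0, because the limit
    depends on nothing else. Quadrics admit only congruences. Hence pivots may be hyperbolic 2 x 2
    blocks, and reaching the chart requires a decomposable vector on which a quadratic form on an
    exterior power does not vanish; a nonzero form may well vanish on all of them, so membership in
    the closure has to be used. To separate orbits, the Bruhat order on k-subsets is replaced by the
    sum of the elements, which is coarse but already strictly monotone along triangular matrices. *)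

Lemma eq_of_leq_sum (I : finType) (F G : I -> nat) :
  (forall i, F i <= G i)%N -> (\sum_i G i <= \sum_i F i)%N -> F =1 G.
Proof.
move=> leFG leS i; apply/eqP; rewrite eqn_leq leFG /= leqNgt; apply/negP => ltFG.
move: leS; rewrite leqNgt; case/negP.
by rewrite (bigD1 i) //= [X in (_ < X)%N](bigD1 i) //= -addSn leq_add // leq_sum.
Qed.

Section StrictIncr.
Variables (n k : nat).
Implicit Types f : {ffun 'I_k -> 'I_n}.

Lemma strict_incrP f :
  reflect (forall a b : 'I_k, (a < b)%N -> (f a < f b)%N) (strict_incr f).
Proof.
apply: (iffP forallP) => [H a b ab|H a].
  by have /forallP/(_ b)/implyP/(_ ab) := H a.
by apply/forallP => b; apply/implyP; exact: H.
Qed.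

Lemma strict_incr_inj f : strict_incr f -> injective f.
Proof.
move=> /strict_incrP H a b E; apply: val_inj.
by case: (ltngtP a b) => // /H; rewrite E ltnn.
Qed.

Lemma strict_incr_ge f (a : 'I_k) : strict_incr f -> (a <= f a)%N.
Proof.
move=> /strict_incrP H; case: a => m; elim: m => [//|m IH] ltm.
have := H (Ordinal (ltnW ltm)) (Ordinal ltm) (ltnSn m).
by apply: leq_ltn_trans; exact: IH.
Qed.

Definition weight f := (\sum_a f a)%N.

End StrictIncr.

Lemma strict_incr_id k (f : {ffun 'I_k -> 'I_k}) : strict_incr f -> f =1 id.
Proof.
move=> sf a; apply: val_inj; apply/esym.
apply: (@eq_of_leq_sum _ (fun a : 'I_k => a : nat) (fun a => f a : nat)).
  by move=> b; exact: strict_incr_ge.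
by rewrite [leqRHS](reindex_inj (strict_incr_inj sf)).
Qed.

(** [s] inherits strict monotonicity from [f] and [g], and a strictly increasing self-map of ['I_k]
    is the identity. This is how two subsets are shown to coincide below. *)
Lemma strict_incr_perm_eq n k (f g : {ffun 'I_k -> 'I_n}) (s : 'I_k -> 'I_k) :
  strict_incr f -> strict_incr g -> (forall a, f a = g (s a)) -> f = g /\ s =1 id.
Proof.
move=> sf sg fgs.
have ss : strict_incr [ffun a => s a].
  apply/strict_incrP => a b ab; rewrite !ffunE.
  have := strict_incrP _ sf _ _ ab; rewrite !fgs.
  case: (ltngtP (s a) (s b)) => // [/(strict_incrP _ sg)|/val_inj ->]; last by rewrite ltnn.
  by move=> h1 h2; have := ltn_trans h1 h2; rewrite ltnn.
have sid : s =1 id by move=> a; have := strict_incr_id ss a; rewrite ffunE.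
by split=> //; apply/ffunP => a; rewrite fgs sid.
Qed.

Lemma inj_strict_incr n k (g : 'I_k -> 'I_n) : injective g ->
  exists (f : ksub n k) (s : 'S_k), forall a, g a = val f (s a).
Proof.
move=> gi; pose S := [set g a | a in 'I_k].
have cS : k = #|S| by rewrite card_imset // card_ord.
pose f := [ffun a : 'I_k => enum_val (cast_ord cS a)].
have sf : strict_incr f.
  apply/strict_incrP => a b ab; rewrite !ffunE.
  pose x0 := g a; rewrite !(enum_val_nth x0) /=.
  have : sorted ltn (map val (enum S)).
    apply: (@subseq_sorted _ _ ltn_trans _ (map val (enum 'I_n))); last first.
      by rewrite val_enum_ord iota_ltn_sorted.
    by apply: map_subseq; rewrite [enum 'I_n]enumT; exact: filter_subseq.
  move=> /(sorted_ltn_nth ltn_trans 0%N) H.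
  have := H a b; rewrite !inE !size_map -!cardE -!cS !ltn_ord => /(_ isT isT ab).
  by rewrite !(nth_map x0) // -cardE -cS.
have gS a : g a \in S by apply: imset_f.
pose s a := cast_ord (esym cS) (enum_rank_in (gS a) (g a)).
have fs a : g a = f (s a).
  by rewrite ffunE /s cast_ordKV enum_rankK_in.
have si : injective s by move=> a b E; apply: gi; rewrite !fs E.
exists (exist (fun f => is_true (strict_incr f)) f sf), (perm si) => a.
by rewrite /= permE.
Qed.

Section ExtMx.
Variables (R : comPzRingType) (n k : nat).

Definition sb (a : 'I_(ext_dim n k)) : {ffun 'I_k -> 'I_n} := val (ksub_of_ord a).

Lemma sb_incr a : strict_incr (sb a). Proof. exact: (valP (ksub_of_ord a)). Qed.

Lemma sb_inj : injective sb.
Proof. by move=> a b /val_inj/enum_val_inj. Qed.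

(** [ext_pow] over an arbitrary commutative ring: limits need it over [{poly F}]. Over a field the
    two are convertible. *)
Definition ext_mx (A : 'M[R]_n) : 'M[R]_(ext_dim n k) :=
  \matrix_(a, b) \det (mxsub (sb a) (sb b) A).

(** An injective map factors uniquely as a permutation followed by an increasing map, so the sum
    splits into subsets and their orderings. *)
Lemma big_inj_ffun (F : {ffun 'I_k -> 'I_n} -> R) :
  (forall g : {ffun _ -> _}, ~~ injectiveb g -> F g = 0) ->
  \sum_g F g = \sum_(a < ext_dim n k) \sum_(s : 'S_k) F [ffun i => sb a (s i)].
Proof.
move=> F0; rewrite (bigID (fun g : {ffun _ -> _} => injectiveb g)) /= [X in _ + X]big1 ?addr0 //.
rewrite pair_big /=.
pose h (p : 'I_(ext_dim n k) * 'S_k) := [ffun i => sb p.1 (p.2 i)].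
have hinj p : injectiveb (h p).
  apply/injectiveP => i j; rewrite !ffunE => /(strict_incr_inj (sb_incr _)).
  exact: perm_inj.
have hi : injective h.
  move=> [a s] [b t] /ffunP E.
  have E' x : sb a x = sb b (t (s^-1 x)%g).
    by have := E (s^-1 x)%g; rewrite !ffunE /= permKV.
  have [eab ts] := strict_incr_perm_eq (sb_incr a) (sb_incr b) E'.
  congr pair; first exact: sb_inj.
  by apply/permP => x; have := ts (s x); rewrite permK.
rewrite -(big_imset F (h := h) (A := predT)) /=; last by move=> x y _ _; exact: hi.
apply: eq_bigl => g; apply/idP/imsetP => [/injectiveP gi|[p _ ->]]; last exact: hinj.
have [f [s gs]] := inj_strict_incr gi.
exists (enum_rank f, s) => //; apply/ffunP => x.
by rewrite ffunE /= gs /sb /ksub_of_ord enum_rankK.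
Qed.

Lemma det_mxsub_nninj (B : 'M[R]_(n, k)) (g : {ffun 'I_k -> 'I_n}) :
  ~~ injectiveb g -> \det (rowsub g B) = 0.
Proof.
case/injectivePn => i [j ij gij].
by apply: (determinant_alternate ij) => l; rewrite !mxE gij.
Qed.

(** Multilinear expansion produces all maps [g]; repeated rows kill the non-injective ones, and the
    signs of the permutations in the factorization of [g] rebuild the minor of [A]. *)
Lemma Cauchy_Binet (A : 'M[R]_(k, n)) (B : 'M[R]_(n, k)) :
  \det (A *m B) = \sum_(a < ext_dim n k) \det (colsub (sb a) A) * \det (rowsub (sb a) B).
Proof.
have -> : \det (A *m B) = \sum_(g : {ffun 'I_k -> 'I_n}) (\prod_i A i (g i)) * \det (rowsub g B).
  rewrite /determinant.
  under [RHS]eq_bigr do rewrite mulr_sumr.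
  rewrite exchange_big /=; apply: eq_bigr => s _.
  under eq_bigr do rewrite mxE.
  rewrite bigA_distr_bigA mulr_sumr /=; apply: eq_bigr => g _.
  rewrite mulrCA; congr (_ * _); rewrite -big_split /=; apply: eq_bigr => i _.
  by rewrite !mxE.
rewrite big_inj_ffun => [|g /det_mxsub_nninj->]; last by rewrite mulr0.
apply: eq_bigr => a _; rewrite [X in _ = X * _]/determinant mulr_suml; apply: eq_bigr => s _.
have -> : rowsub [ffun i => sb a (s i)] B = perm_mx s *m rowsub (sb a) B.
  by rewrite -row_permE; apply/matrixP => i j; rewrite !mxE ffunE.
rewrite det_mulmx det_perm mulrA [_ * (-1) ^+ _]mulrC; congr (_ * _ * _).
by apply: eq_bigr => i _; rewrite ffunE mxE.
Qed.

Lemma ext_mxM (A B : 'M[R]_n) : ext_mx (A *m B) = ext_mx A *m ext_mx B.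
Proof.
apply/matrixP => a b; rewrite !mxE mxsub_mul Cauchy_Binet; apply: eq_bigr => c _.
by rewrite !mxE -mxsubcr -mxsubrc.
Qed.

Lemma ext_mxT (A : 'M[R]_n) : ext_mx A^T = (ext_mx A)^T.
Proof. by apply/matrixP => a b; rewrite !mxE -det_tr trmx_mxsub trmxK. Qed.

Lemma ext_mxZ c (A : 'M[R]_n) : ext_mx (c *: A) = c ^+ k *: ext_mx A.
Proof.
apply/matrixP => a b; rewrite !mxE -detZ; congr (\det _).
by apply/matrixP => i j; rewrite !mxE.
Qed.

Lemma ext_mx_neq0 (A : 'M[R]_n) a b : ext_mx A a b != 0 ->
  exists s : 'S_k, forall i, A (sb a i) (sb b (s i)) != 0.
Proof.
rewrite mxE /determinant => H.
have [s Hs] : exists s : 'S_k, \prod_i (mxsub (sb a) (sb b) A) i (s i) != 0.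
  apply: contra_notP (elimN eqP H) => /forallNP H'.
  by rewrite big1 // => s _; have /negP := H' s; rewrite negbK => /eqP ->; rewrite mulr0.
exists s => i; apply: contra_neq Hs => E.
by rewrite (bigD1 i) //= mxE E mul0r.
Qed.

Lemma ext_diag_mx (d : 'rV[R]_n) a b :
  ext_mx (diag_mx d) a b = (\prod_i d 0 (sb a i)) *+ (a == b).
Proof.
have [<-|ab] := eqVneq a b.
  have -> : ext_mx (diag_mx d) a a = \det (diag_mx (\row_i d 0 (sb a i))).
    rewrite mxE; congr (\det _); apply/matrixP => i j.
    by rewrite !mxE (inj_eq (strict_incr_inj (sb_incr a))).
  by rewrite det_diag mulr1n; apply: eq_bigr => i _; rewrite mxE.
apply/eqP; rewrite mulr0n; apply: contraNT ab => /ext_mx_neq0[s Hs].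
apply/eqP/sb_inj.
suff /(strict_incr_perm_eq (sb_incr a) (sb_incr b))[] : forall i, sb a i = sb b (s i) by [].
by move=> i; apply/eqP; apply: contraNT (Hs i); rewrite mxE => /negPf ->.
Qed.

Lemma ext_mx1 : ext_mx 1%:M = 1%:M.
Proof.
apply/matrixP => a b; rewrite -diag_const_mx ext_diag_mx mxE.
by rewrite big1 // => i _; rewrite mxE.
Qed.

(* The weight (sum of the elements) linearly refines the Bruhat order on subsets. *)
Lemma ext_mx_trig (A : 'M[R]_n) a b : is_trig_mx A -> ext_mx A a b != 0 ->
  a = b \/ (weight (sb b) < weight (sb a))%N.
Proof.
move=> /is_trig_mxP At /ext_mx_neq0[s Hs].
have le i : (sb b (s i) <= sb a i)%N.
  by rewrite leqNgt; apply: contra (Hs i) => /At ->.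
have W : weight (sb b) = (\sum_i sb b (s i))%N.
  by rewrite /weight (reindex_inj (@perm_inj _ s)).
case: (ltnP (weight (sb b)) (weight (sb a))) => [|h]; [by right|left].
(* [le] bounds the terms and [h] compares the sums the other way, so all terms agree. *)
have E := eq_of_leq_sum le; rewrite -W in E.
apply: sb_inj.
suff /(strict_incr_perm_eq (sb_incr a) (sb_incr b))[] : forall i, sb a i = sb b (s i) by [].
by move=> i; apply/val_inj; rewrite /= -E.
Qed.

End ExtMx.

Lemma ext_mx_unit (R : comUnitRingType) n k (A : 'M[R]_n) :
  A \in unitmx -> ext_mx k A *m ext_mx k (invmx A) = 1%:M.
Proof. by move=> uA; rewrite -ext_mxM mulmxV // ext_mx1. Qed.

Lemma map_ext_mx (R S : comPzRingType) (h : {rmorphism R -> S}) n k (A : 'M[R]_n) :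
  map_mx h (ext_mx k A) = ext_mx k (map_mx h A).
Proof.
by apply/matrixP => a b; rewrite !mxE -det_map_mx map_mxsub.
Qed.

Lemma ext_powE (F : fieldType) n k (A : 'M[F]_n) : ext_pow k A = ext_mx k A.
Proof. by []. Qed.

(** * Multihomogeneous functions and Zariski closures *)

Section MultihomogeneousFunctions.
Variables (F : fieldType) (I : finType) (m : I -> nat).
Local Notation vecs := (forall i, 'M[F]_(m i)).
Local Notation mp := {mpoly F[#|{: Defs.coord m}|]}.
Local Notation mdg i mon := (\sum_(c < #|{: Defs.coord m}| | tag (enum_val c) == i) (mon : 'X_{1..#|{: Defs.coord m}|}) c)%N.

Definition homog_of (d : I -> nat) (p : mp) :=
  forall mon, mon \in msupp p -> forall i, mdg i mon = d i.

(** Functions with a multidegree are tracked instead of polynomials, so that equations of a closure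
    can be built algebraically without handling monomials. *)
Definition polyfun (d : I -> nat) (f : vecs -> F) :=
  exists2 p : mp, homog_of d p & forall v, p.@[coords v] = f v.

Lemma eq_polyfun d d' f g : d =1 d' -> f =1 g -> polyfun d f -> polyfun d' g.
Proof.
move=> dd fg [p hp pf]; exists p; last by move=> v; rewrite pf.
by move=> mon /hp h i; rewrite h.
Qed.

Lemma polyfun_const c : polyfun (fun=> 0%N) (fun=> c).
Proof.
exists c%:MP; last by move=> v; rewrite mevalC.
move=> mon; rewrite msuppC; case: ifP => // _; rewrite inE => /eqP -> i.
by rewrite big1 // => j _; rewrite mnm0E.
Qed.

Lemma polyfun0 d : polyfun d (fun=> 0).
Proof.
exists 0; last by move=> v; rewrite meval0.
by move=> mon; rewrite msupp0.
Qed.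

Lemma polyfun_coord (i : I) (a b : 'I_(m i)) :
  polyfun (fun j => i == j) (fun v => v i a b).
Proof.
pose c := enum_rank (Tagged (fun i => 'I_(m i) * 'I_(m i))%type (a, b) : Defs.coord m).
exists 'X_c; last first.
  by move=> v; rewrite mevalXU /coords /c enum_rankK.
move=> mon; rewrite msuppX inE => /eqP -> j.
have [ij|ij] := eqVneq i j.
  rewrite (bigD1 c) /= ?big1 ?mnm1E ?eqxx ?addn0 //; last by rewrite /c enum_rankK /=; apply/eqP.
  by move=> e /andP[_ /negPf]; rewrite mnm1E eq_sym => ->.
rewrite big1 // => e /eqP ej; rewrite mnm1E; case: eqP => // ce.
by case/eqP: ij; rewrite -ej -ce /c enum_rankK.
Qed.

Lemma polyfunD d f g : polyfun d f -> polyfun d g -> polyfun d (fun v => f v + g v).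
Proof.
move=> [p hp pf] [q hq qg]; exists (p + q); last by move=> v; rewrite mevalD pf qg.
by move=> mon /msuppD_le; rewrite mem_cat => /orP[/hp|/hq].
Qed.

Lemma polyfunM d e f g :
  polyfun d f -> polyfun e g -> polyfun (fun i => d i + e i)%N (fun v => f v * g v).
Proof.
move=> [p hp pf] [q hq qg]; exists (p * q); last by move=> v; rewrite mevalM pf qg.
move=> mon /msuppM_le/allpairsP[[m1 m2] /= [/hp h1 /hq h2 ->]] i.
by under eq_bigr do rewrite mnmDE; rewrite big_split /= h1 h2.
Qed.

Lemma polyfunZ d c f : polyfun d f -> polyfun d (fun v => c * f v).
Proof. by move=> /(polyfunM (polyfun_const c)). Qed.

Lemma polyfun_sum (T : eqType) (r : seq T) (f : T -> vecs -> F) d :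
  (forall t, t \in r -> polyfun d (f t)) -> polyfun d (fun v => \sum_(t <- r) f t v).
Proof.
elim: r => [_|t r IH H].
  by apply: (eq_polyfun _ _ (polyfun0 d)) => // v; rewrite big_nil.
apply: (eq_polyfun (frefl _) (f := fun v => f t v + \sum_(t <- r) f t v)).
  by move=> v; rewrite big_cons.
apply: polyfunD; first by apply: H; rewrite mem_head.
by apply: IH => u ur; apply: H; rewrite inE ur orbT.
Qed.

Lemma polyfunX d f j : polyfun d f -> polyfun (fun i => d i * j)%N (fun v => f v ^+ j).
Proof.
move=> pf; elim: j => [|j IH].
  by apply: eq_polyfun (polyfun_const 1) => // i; rewrite muln0.
by apply: eq_polyfun (polyfunM pf IH) => [i|v]; rewrite ?mulnS // exprS.
Qed.

Lemma polyfun_prod (T : Type) (r : seq T) (f : T -> vecs -> F) (d : T -> I -> nat) :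
  (forall t, polyfun (d t) (f t)) ->
  polyfun (fun i => \sum_(t <- r) d t i)%N (fun v => \prod_(t <- r) f t v).
Proof.
move=> H; elim: r => [|t r IH].
  by apply: eq_polyfun (polyfun_const 1) => // i; rewrite big_nil.
by apply: eq_polyfun (polyfunM (H t) IH) => i; rewrite big_cons.
Qed.

Lemma polyfun_comp d (p : mp) (G : 'I_#|{: Defs.coord m}| -> vecs -> F) :
  homog_of d p -> (forall c, polyfun (fun i => tag (enum_val c) == i) (G c)) ->
  polyfun d (fun v => p.@[fun c => G c v]).
Proof.
move=> hp HG; apply: (eq_polyfun (frefl _) (fun v => esym (mevalE _ _))).
apply: polyfun_sum => mon monp; apply: polyfunZ.
apply: (eq_polyfun _ (frefl _) (polyfun_prod _ (fun c => polyfunX (mon c) (HG c)))).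
move=> i /=; rewrite -(hp _ monp i) [RHS]big_mkcond /=.
by apply: eq_bigr => c _; case: eqP; rewrite ?mul1n ?mul0n.
Qed.

Definition is_rep (x : lines F m) (v : vecs) := forall i, x i = <[v i]>%VS.

Lemma multiproj_rep x : multiproj x -> exists2 v, is_rep x v & forall i, v i != 0.
Proof.
move=> mx; exists (fun i => vpick (x i)) => i; last first.
  by rewrite vpick0 -dimv_eq0 mx.
apply/esym/eqP; rewrite eqEdim -memvE memv_pick /= mx dim_vline.
by rewrite vpick0 -dimv_eq0 mx.
Qed.

Lemma rep_neq0 x v : multiproj x -> is_rep x v -> forall i, v i != 0.
Proof.
by move=> mx xv i; have := mx i; rewrite xv dim_vline; case: (v i != 0).
Qed.

Lemma closure_polyfun (S : set (lines F m)) x d f : zariski_closure S x -> polyfun d f ->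
  (forall y v, S y -> is_rep y v -> f v = 0) -> forall v, is_rep x v -> f v = 0.
Proof.
move=> [_ H] [p hp pf] SF v xv; rewrite -pf; apply: H => //.
  by exists d.
by move=> y Sy w yw; rewrite pf; exact: SF Sy yw.
Qed.

End MultihomogeneousFunctions.

Lemma vline_scale (K : fieldType) (vT : vectType K) (u v : vT) :
  v != 0 -> <[u]>%VS = <[v]>%VS -> exists2 c, c != 0 & u = c *: v.
Proof.
move=> v0 e; have /vlineP[c uc] : u \in <[v]>%VS by rewrite -e memv_line.
exists c => //; apply: contra_neq v0 => c0.
have /vlineP[a ->] : v \in <[u]>%VS by rewrite e memv_line.
by rewrite uc c0 scale0r scaler0.
Qed.

Lemma vlineZ (K : fieldType) (vT : vectType K) (c : K) (v : vT) :
  c != 0 -> <[c *: v]>%VS = <[v]>%VS.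
Proof.
move=> c0; apply/vspaceP => w; apply/vlineP/vlineP => -[a ->].
  by exists (a * c); rewrite scalerA.
by exists (a / c); rewrite scalerA divfK.
Qed.

(** * The two-sided action on families of lines *)

Section LeftRightAction.
Variables (F : fieldType) (n : nat).
Implicit Types (P Q A : 'M[F]_n) (x : flines F n).

Lemma lr_act_line P Q x (k : 'I_n.-1) M : x k = <[M]>%VS ->
  lr_act P Q x k = <[ext_mx k.+1 P *m M *m ext_mx k.+1 Q]>%VS.
Proof. by move=> xk; rewrite /lr_act xk limg_line comp_lfunE !lfunE. Qed.

Lemma lr_act_comp P Q P' Q' x :
  lr_act P Q (lr_act P' Q' x) = lr_act (P *m P') (Q' *m Q) x.
Proof.
apply: functional_extensionality_dep => k; rewrite /lr_act -limg_comp.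
congr (_ @: _)%VS; apply/lfunP => M; rewrite !comp_lfunE !lfunE /=.
by rewrite !ext_powE !ext_mxM !mulmxA.
Qed.

Lemma lr_act1 x : lr_act 1%:M 1%:M x = x.
Proof.
apply: functional_extensionality_dep => k; rewrite /lr_act.
rewrite -[RHS]lim1g; congr (_ @: _)%VS; apply/lfunP => M.
by rewrite !comp_lfunE !lfunE /= !ext_powE !ext_mx1 mulmx1 mul1mx.
Qed.

Lemma lr_actZ c d P Q x : c != 0 -> d != 0 ->
  lr_act (c *: P) (d *: Q) x = lr_act P Q x.
Proof.
move=> c0 d0; apply: functional_extensionality_dep => k.
have e : c ^+ k.+1 * d ^+ k.+1 != 0 by rewrite mulf_neq0 ?expf_neq0.
have E M : ext_mx k.+1 (c *: P) *m M *m ext_mx k.+1 (d *: Q) =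
   (c ^+ k.+1 * d ^+ k.+1) *: (ext_mx k.+1 P *m M *m ext_mx k.+1 Q).
  by rewrite !ext_mxZ -!scalemxAl -scalemxAr scalerA.
apply/vspaceP => N; apply/memv_imgP/memv_imgP => -[M Mx ->];
  rewrite comp_lfunE !lfunE /= !ext_powE.
  exists ((c ^+ k.+1 * d ^+ k.+1) *: M); first exact: memvZ.
  by rewrite comp_lfunE !lfunE /= ?ext_powE E -scalemxAr -scalemxAl.
exists ((c ^+ k.+1 * d ^+ k.+1)^-1 *: M); first exact: memvZ.
by rewrite comp_lfunE !lfunE /= ?ext_powE E -scalemxAr -scalemxAl scalerA divff // scale1r.
Qed.

Lemma lr_act_ext_lines P Q A : lr_act P Q (ext_lines A) = ext_lines (P *m A *m Q).
Proof.
apply: functional_extensionality_dep => k.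
by rewrite (lr_act_line _ _ (M := ext_mx k.+1 A)) // -!ext_mxM.
Qed.

Lemma lr_actK P Q x : P \in unitmx -> Q \in unitmx ->
  lr_act (invmx P) (invmx Q) (lr_act P Q x) = x.
Proof. by move=> uP uQ; rewrite lr_act_comp mulVmx // mulmxV // lr_act1. Qed.

Lemma lr_act_multiproj P Q x : P \in unitmx -> Q \in unitmx ->
  multiproj x -> multiproj (lr_act P Q x).
Proof.
move=> uP uQ mx k; rewrite -(mx k) limg_dim_eq //; apply/eqP.
rewrite -subv0; apply/subvP => M; rewrite memv_cap memv_ker memv0 => /andP[_].
rewrite comp_lfunE !lfunE /= !ext_powE => /eqP E.
have : ext_mx k.+1 (invmx P) *m (ext_mx k.+1 P *m M *m ext_mx k.+1 Q) *m ext_mx k.+1 (invmx Q) = 0.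
  by rewrite E mulmx0 mul0mx.
by rewrite -!mulmxA -ext_mxM mulmxV // ext_mx1 mulmx1 mulmxA -ext_mxM mulVmx // ext_mx1 mul1mx => ->.
Qed.

(** On representatives the action is a linear substitution in every factor, so a form vanishing on
    [S] pulls back to a form of the same multidegree that again vanishes on [S]; it is evaluated at
    the inverse translate of [v]. *)
Lemma closure_lr_act (S : set (flines F n)) P Q x :
  P \in unitmx -> Q \in unitmx -> (forall y, S y -> S (lr_act P Q y)) ->
  zariski_closure S x -> zariski_closure S (lr_act P Q x).
Proof.
move=> uP uQ stS cx; split; first by apply: lr_act_multiproj => //; case: cx.
move=> p [d hp] pS v pv.
pose act (R S : 'M[F]_n) (w : forall k : 'I_n.-1, 'M[F]_(ext_dim n k.+1)) :=
  fun k : 'I_n.-1 => ext_mx k.+1 R *m w k *m ext_mx k.+1 S.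
have pf : polyfun d (fun w => p.@[coords (act P Q w)]).
  apply: polyfun_comp hp _ => c.
  apply: (@eq_polyfun _ _ _ (fun i => tag (enum_val c) == i) _
     (fun w => \sum_j \sum_l ext_mx (tag (enum_val c)).+1 P (tagged (enum_val c)).1 l *
         w (tag (enum_val c)) l j * ext_mx (tag (enum_val c)).+1 Q j (tagged (enum_val c)).2)) => //.
    move=> w; rewrite /coords /act [RHS]mxE; apply: eq_bigr => j _.
    by rewrite [X in _ = X * _]mxE mulr_suml.
  apply: polyfun_sum => j _; apply: polyfun_sum => l _.
  apply: (eq_polyfun (frefl _) _ (polyfunZ (ext_mx (tag (enum_val c)).+1 P (tagged (enum_val c)).1 l * ext_mx (tag (enum_val c)).+1 Q j (tagged (enum_val c)).2) (polyfun_coord _ l j))) => w.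
  by ring.
have := closure_polyfun cx pf _ (v := act (invmx P) (invmx Q) v).
have -> : act P Q (act (invmx P) (invmx Q) v) = v.
  apply: functional_extensionality_dep => k; rewrite /act.
  rewrite -!mulmxA -ext_mxM mulVmx // ext_mx1 mulmx1 mulmxA -ext_mxM mulmxV //.
  by rewrite ext_mx1 mul1mx.
apply=> [y w Sy yw|k].
  apply: (pS _ (stS _ Sy)) => k; exact: lr_act_line.
by rewrite -[x](lr_actK _ uP uQ); apply: lr_act_line; exact: pv.
Qed.

End LeftRightAction.

(** * Limits of one-parameter families *)

Section Limits.
Variables (F : fieldType) (n : nat).
Implicit Types (A : 'M[{poly F}]_n) (x : flines F n).

Definition ev (c : F) p q (A : 'M[{poly F}]_(p, q)) := map_mx (horner_eval c) A.

Lemma evE c p q (A : 'M[{poly F}]_(p, q)) i j : ev c A i j = (A i j).[c].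
Proof. by rewrite mxE. Qed.

Lemma evM c p q r (A : 'M[{poly F}]_(p, q)) (B : 'M[{poly F}]_(q, r)) :
  ev c (A *m B) = ev c A *m ev c B.
Proof. exact: map_mxM. Qed.

Lemma ev_ext c k A : ev c (ext_mx k A) = ext_mx k (ev c A).
Proof. exact: map_ext_mx. Qed.

Lemma ev_polyC c p q (A : 'M[F]_(p, q)) : ev c (map_mx polyC A) = A.
Proof. by apply/matrixP => i j; rewrite !mxE /horner_eval hornerC. Qed.

Lemma det_ev c (A : 'M[{poly F}]_n) : \det (ev c A) = (\det A).[c].
Proof. exact: det_map_mx. Qed.

(* [x] is the limit at [X = 0] of the projectivized exterior powers of [A]. *)
Definition is_lim A x := forall k : 'I_n.-1, exists v N,
  [/\ ext_mx k.+1 A = 'X^v *: N, ev 0 N != 0 & x k = <[ev 0 N]>%VS].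

Lemma is_lim_multiproj A x : is_lim A x -> multiproj x.
Proof. by move=> H k; have [v [N [_ N0 ->]]] := H k; rewrite dim_vline N0. Qed.

(** If ['X^v *: N] and ['X^w *: M] agree and neither [N] nor [M] vanishes at 0, the exponents agree,
    and hence the matrices. *)
Lemma is_lim_uniq A x y : is_lim A x -> is_lim A y -> x = y.
Proof.
move=> Hx Hy; apply: functional_extensionality_dep => k.
have [v [N [E N0 ->]]] := Hx k; have [w [M [E' M0 ->]]] := Hy k.
have aux v' w' (N' M' : 'M[{poly F}]_(ext_dim n k.+1)) :
   'X^v' *: N' = 'X^w' *: M' -> ev 0 N' != 0 -> (v' <= w')%N -> ev 0 M' != 0 -> N' = M'.
  move=> e N'0 vw M'0; have : N' = 'X^(w' - v') *: M'.
    apply/matrixP => a b; have /matrixP/(_ a b) := e; rewrite !mxE.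
    rewrite -{1}(subnKC vw) exprD -mulrA => /mulfI -> //.
    by rewrite -size_poly_eq0 size_polyXn.
  case: (posnP (w' - v')) => [->|vw0 N'E]; first by rewrite expr0 scale1r.
  case/eqP: N'0; rewrite N'E; apply/matrixP => a b; rewrite !mxE.
  by rewrite /horner_eval hornerM hornerXn expr0n eqn0Ngt vw0 mul0r.
have e : 'X^v *: N = 'X^w *: M by rewrite -E -E'.
case: (leqP v w) => vw; first by rewrite (aux _ _ _ _ e).
by rewrite (aux _ _ _ _ (esym e)) // ltnW.
Qed.

Lemma is_lim_act A x (g h : 'M[{poly F}]_n) :
  ev 0 g \in unitmx -> ev 0 h \in unitmx -> is_lim A x ->
  is_lim (g *m A *m h) (lr_act (ev 0 g) (ev 0 h) x).
Proof.
move=> ug uh Ax k; have [v [N [E N0 xk]]] := Ax k.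
exists v, (ext_mx k.+1 g *m N *m ext_mx k.+1 h); split.
- by rewrite !ext_mxM E -scalemxAr -scalemxAl.
- rewrite !evM !ev_ext; apply: contra_neq N0 => N0.
  have : ext_mx k.+1 (invmx (ev 0 g)) *m (ext_mx k.+1 (ev 0 g) *m ev 0 N *m ext_mx k.+1 (ev 0 h)) *m ext_mx k.+1 (invmx (ev 0 h)) = 0.
    by rewrite N0 mulmx0 mul0mx.
  by rewrite -!mulmxA -ext_mxM mulmxV // ext_mx1 mulmx1 mulmxA -ext_mxM mulVmx // ext_mx1 mul1mx.
by rewrite (lr_act_line _ _ xk) !evM !ev_ext.
Qed.

End Limits.

(** Divide by ['X] as long as the matrix vanishes at 0; the size of one fixed nonzero entry drops
    each time. *)
Lemma poly_mx_valuation (F : fieldType) p q (M : 'M[{poly F}]_(p, q)) : M != 0 ->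
  exists v N, M = 'X^v *: N /\ ev 0 N != 0.
Proof.
move=> M0; have [i [j Mij]] : exists i j, M i j != 0.
  apply: contra_notP (elimN eqP M0) => H; apply/matrixP => i j; rewrite mxE.
  by apply/eqP; apply: contra_notT H => ?; exists i, j.
move: {2}(size (M i j)) (leqnn (size (M i j))) => s.
elim: s M Mij {M0} => [|s IH] M Mij; first by rewrite leqn0 size_poly_eq0 (negPf Mij).
move=> szM; have [M00|] := eqVneq (ev 0 M) 0; last first.
  by exists 0%N, M; rewrite expr0 scale1r.
have ME : M = 'X *: map_mx (drop_poly 1) M.
  apply/matrixP => a b; rewrite !mxE; apply/polyP => -[|l]; rewrite coefXM /=.
    by rewrite -horner_coef0; have /matrixP/(_ a b) := M00; rewrite !mxE.
  by rewrite coef_drop_poly addn1.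
have [||v [N [E N0]]] := IH (map_mx (drop_poly 1) M).
- by apply: contra_neq Mij => e; rewrite ME mxE e mulr0.
- by rewrite mxE size_drop_poly; rewrite leq_subLR add1n.
by exists v.+1, N; rewrite exprS -scalerA -E.
Qed.

Lemma meval_polyC (F : fieldType) s (p : {mpoly F[s]}) (h : 'I_s -> {poly F}) c :
  (mmap polyC h p).[c] = p.@[fun i => (h i).[c]].
Proof.
rewrite mevalE /mmap horner_sum; apply: eq_bigr => mon _.
rewrite hornerM hornerC horner_prod; congr (_ * _); apply: eq_bigr => i _.
by rewrite horner_exp.
Qed.

(** * Both varieties as closures of embedded matrices *)

Section Embeddings.
Variables (C : numClosedFieldType) (n : nat).
Local Open Scope classical_set_scope.

(** The flag [sym] lets both varieties share the closure arguments: [true] gives complete quadrics,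
    [false] the group compactification. *)
Definition matset (sym : bool) : set 'M[C]_n :=
  [set A | A \in unitmx /\ (sym -> A^T = A)].

Definition embset sym : set (flines C n) := [set ext_lines A | A in matset sym].

Lemma ext_linesZ c (A : 'M[C]_n) : c != 0 -> ext_lines (c *: A) = ext_lines A.
Proof.
move=> c0; apply: functional_extensionality_dep => k.
by rewrite /ext_lines !ext_powE ext_mxZ vlineZ // expf_neq0.
Qed.

Lemma complete_quadricsE : complete_quadrics (F := C) (n := n) = zariski_closure (embset true).
Proof.
congr zariski_closure; rewrite eqEsubset; split=> _ [A [uA sA] <-]; exists A => //.
by split=> //; exact: sA.
Qed.

Lemma exists_root d (a : C) : (0 < d)%N -> exists c, c ^+ d = a.
Proof.
move=> d0; have [c cE] := solve_monicpoly (fun i => if i == 0%N then a else 0) d0.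
exists c; rewrite cE; case: d d0 {cE} => // d _.
by rewrite big_ord_recl /= big1 ?addr0 ?expr0 ?mulr1 // => i _; rewrite mul0r.
Qed.

(** Dividing an invertible matrix by an n-th root of its determinant puts it in SL without moving
    its lines. *)
Lemma wonderful_groupE : (0 < n)%N ->
  wonderful_group (F := C) (n := n) = zariski_closure (embset false).
Proof.
move=> n0; congr zariski_closure; rewrite eqEsubset; split=> [_ [[g h] [Sg Sh] <-]|_ [A [uA _] <-]].
  exists (g *m invmx h) => //; split=> //.
  by rewrite unitmx_mul unitmx_inv !SL_unit.
have [c cE] := exists_root (\det A) n0.
have dA : \det A != 0 by rewrite -unitfE -unitmxE.
have c0 : c != 0 by apply: contra_neq dA => c0; rewrite -cE c0 expr0n gtn_eqF.
exists (c^-1 *: A, 1%:M); last first.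
  by rewrite /group_embedding /= invmx1 mulmx1 ext_linesZ // invr_eq0.
by split; rewrite /SL /= ?det1 // detZ exprVn cE mulVf.
Qed.

Lemma embset_stable (sym : bool) (P Q : 'M[C]_n) x : P \in unitmx -> Q \in unitmx -> (sym -> Q = P^T) ->
  embset sym x -> embset sym (lr_act P Q x).
Proof.
move=> uP uQ QP [A [uA sA] <-]; exists (P *m A *m Q); last by rewrite lr_act_ext_lines.
split; first by rewrite !unitmx_mul uP uA.
by move=> /[dup] s /QP ->; rewrite !trmx_mul trmxK sA // mulmxA.
Qed.

(** Along the normalized curve, a form vanishing on the embedded matrices becomes a polynomial [q]
    in one variable that vanishes at every [c] where neither [c] nor the determinant of [A] at [c]
    is zero. Such a [q] is zero, so it also vanishes at 0, where the curve represents [x]. *)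
Lemma lim_closure (sym : bool) (A : 'M[{poly C}]_n) x :
  (sym -> A^T = A) -> \det A != 0 -> is_lim A x -> zariski_closure (embset sym) x.
Proof.
move=> sA dA Ax; split; first exact: is_lim_multiproj Ax.
move=> p [d hp] pS v xv.
pose N k := sval (cid (svalP (cid (Ax k)))).
have HN (k : 'I_n.-1) : [/\ ext_mx k.+1 A = 'X^(sval (cid (Ax k))) *: N k, ev 0 (N k) != 0 &
    x k = <[ev 0 (N k)]>%VS] by exact: (svalP (cid (svalP (cid (Ax k))))).
have va (k : 'I_n.-1) : exists a, a != 0 /\ v k = a *: ev 0 (N k).
  have [_ N0 xk] := HN k; have [a a0 E] := vline_scale N0 (etrans (esym (xv k)) xk).
  by exists a.
pose a k := sval (cid (va k)).
have a0 k : a k != 0 by have [] := svalP (cid (va k)).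
have vE k : v k = a k *: ev 0 (N k) by have [] := svalP (cid (va k)).
pose q := mmap polyC (fun c => ((a (tag (enum_val c)))%:P *: N (tag (enum_val c)))
   (tagged (enum_val c)).1 (tagged (enum_val c)).2) p.
have qE c : q.[c] = p.@[coords (fun k => a k *: ev c (N k))].
  rewrite meval_polyC; apply: meval_eq => i.
  by rewrite /coords !mxE hornerM hornerC.
suff q0 : q = 0.
  have -> : v = fun k => a k *: ev 0 (N k) by exact: functional_extensionality_dep.
  by rewrite -qE q0 horner0.
apply/eqP; apply: contraT => q0.
have : q * 'X * \det A != 0 by rewrite !mulf_neq0 // polyX_eq0.
move=> /closed_nonrootP[c]; rewrite /root !hornerM hornerX !mulf_eq0 !negb_or.
move=> /andP[/andP[qc c0] dc]; case/negP: qc; apply/eqP; rewrite qE.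
apply: (pS (ext_lines (ev c A))).
  exists (ev c A) => //; split; first by rewrite unitmxE unitfE det_ev.
  by move=> s; rewrite -[in RHS](sA s); apply/matrixP => i j; rewrite !mxE.
move=> k; have [E _ _] := HN k; rewrite /ext_lines ext_powE -ev_ext E.
rewrite vlineZ // -[RHS](@vlineZ _ _ (c ^+ (sval (cid (Ax k))))) ?expf_neq0 //.
congr <[_]>%VS; apply/matrixP => i j; rewrite !mxE.
by rewrite /horner_eval hornerM hornerXn.
Qed.

End Embeddings.

(** * Diagonal matrices in ratio coordinates and their limits *)

Section StandardPoints.
Variable n : nat.

Definition partprod (R : comPzRingType) (t : nat -> R) (i : nat) := \prod_(0 <= j < i) t j.

Definition stddiag (R : comPzRingType) (t : nat -> R) : 'M[R]_n :=
  diag_mx (\row_i partprod t i).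

(** The k-th exterior power of [stddiag t] divided by its leading entry. As a product of the [t j]
    it still makes sense when some of them vanish, which is what reaches the boundary. *)
Definition stdmx (R : comPzRingType) k (t : nat -> R) : 'M[R]_(ext_dim n k) :=
  diag_mx (\row_a \prod_(i < k) \prod_(i <= j < sb a i) t j).

Lemma ext_stddiag (R : comPzRingType) k (t : nat -> R) :
  ext_mx k (stddiag t) = (\prod_(i < k) partprod t i) *: stdmx k t.
Proof.
apply/matrixP => a b; rewrite ext_diag_mx !mxE.
case: eqP => _; rewrite ?mulr1n ?mulr0n ?mulr0 // -big_split /=; apply: eq_bigr => i _.
rewrite mxE /partprod [LHS](big_cat_nat (n := i)) //.
exact: strict_incr_ge (sb_incr a).
Qed.

Lemma map_stdmx (R S : comPzRingType) (h : {rmorphism R -> S}) k (t : nat -> R) :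
  map_mx h (stdmx k t) = stdmx k (h \o t).
Proof.
apply/matrixP => a b; rewrite !mxE rmorphMn /= rmorph_prod; congr (_ *+ _).
by apply: eq_bigr => i _; rewrite rmorph_prod.
Qed.

Lemma top_incr k (kn : (k <= n)%N) : strict_incr [ffun i => widen_ord kn i].
Proof. by apply/strict_incrP => a b; rewrite !ffunE. Qed.

Definition top k (kn : (k <= n)%N) : 'I_(ext_dim n k) :=
  enum_rank (exist (fun f => is_true (strict_incr f)) _ (top_incr kn) : ksub n k).

Lemma sb_top k (kn : (k <= n)%N) i : sb (top kn) i = widen_ord kn i.
Proof. by rewrite /sb /ksub_of_ord /top enum_rankK ffunE. Qed.

Lemma stdmx_top (R : comPzRingType) k (kn : (k <= n)%N) (t : nat -> R) :
  stdmx k t (top kn) (top kn) = 1.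
Proof.
rewrite !mxE eqxx mulr1n big1 // => i _; rewrite sb_top big_geq //.
Qed.

Lemma ltn_ext_deg (k : 'I_n.-1) : (k.+1 < n)%N.
Proof. by have := ltn_ord k; lia. Qed.

Variable F : fieldType.

Lemma stdmx_neq0 k (t : nat -> F) : (k <= n)%N -> stdmx k t != 0.
Proof.
move=> kn; apply/eqP => /matrixP/(_ (top kn) (top kn)); rewrite stdmx_top mxE => /eqP.
by rewrite oner_eq0.
Qed.

Definition stdpt (t : nat -> F) : flines F n := fun k => <[stdmx k.+1 t]>%VS.

(** Once the leading minor is factored out, the entries are products of the parameters
    [c j *: 'X^(e j)], which at 0 become [c j] or 0 according to whether [e j] is zero. *)
Lemma is_lim_stddiag (c : nat -> F) (e : nat -> nat) : (forall j, c j != 0) ->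
  is_lim (stddiag (fun j => c j *: 'X^(e j))) (stdpt (fun j => c j * (e j == 0%N)%:R)).
Proof.
move=> c0 k; pose t j : {poly F} := c j *: 'X^(e j).
pose a := \prod_(i < k.+1) \prod_(0 <= j < i) c j.
have a0 : a != 0.
  by apply/prodf_neq0 => i _; rewrite prodf_seq_neq0; apply/allP => j _; rewrite c0.
have aE : \prod_(i < k.+1) partprod t i =
    a%:P * 'X^(\sum_(i < k.+1) \sum_(0 <= j < i) e j).
  rewrite /a rmorph_prod -prodrXr -big_split /=; apply: eq_bigr => i _.
  rewrite /partprod rmorph_prod -prodrXr -big_split /=; apply: eq_bigr => j _.
  by rewrite mul_polyC.
have evE : ev 0 (a%:P *: stdmx k.+1 t) = a *: stdmx k.+1 (fun j => c j * (e j == 0%N)%:R).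
  rewrite /ev map_mxZ map_stdmx /= horner_evalE hornerC; congr (_ *: _).
  congr stdmx; apply: funext => j; rewrite /t /= horner_evalE hornerZ hornerXn.
  by rewrite expr0n.
exists (\sum_(i < k.+1) \sum_(0 <= j < i) e j)%N, (a%:P *: stdmx k.+1 t); split.
- by rewrite ext_stddiag aE scalerA mulrC.
- by rewrite evE scaler_eq0 (negPf a0) stdmx_neq0 // ltnW // ltn_ext_deg.
by rewrite evE vlineZ.
Qed.

End StandardPoints.

(** * Elimination over polynomial matrices *)

Section Triangular.
Variables (F : fieldType) (n : nat).
Implicit Types A B : 'M[F]_n.

(** Lower triangular, because an upper triangular [g] acts on quadrics through the inverse of [g^T].
    The upper triangular matrices of the group case appear as transposes. *)
Definition trigu A := is_trig_mx A && (A \in unitmx).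

Lemma is_trigM A B : is_trig_mx A -> is_trig_mx B -> is_trig_mx (A *m B).
Proof.
move=> /is_trig_mxP tA /is_trig_mxP tB; apply/is_trig_mxP => i j ij.
rewrite mxE big1 // => l _; case: (ltnP i l) => il; first by rewrite tA // mul0r.
by rewrite (tB l j) ?mulr0 // (leq_ltn_trans il).
Qed.

Lemma trigu_diag A i : trigu A -> A i i != 0.
Proof.
move=> /andP[tA]; rewrite unitmxE unitfE det_trig // => /prodf_neq0; exact.
Qed.

Lemma triguP A : reflect (is_trig_mx A /\ forall i, A i i != 0) (trigu A).
Proof.
apply: (iffP idP) => [tA|[tA dA]]; first by split=> [|i]; [case/andP: tA|exact: trigu_diag].
rewrite /trigu tA unitmxE unitfE det_trig //=.
by apply/prodf_neq0 => i _; exact: dA.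
Qed.

Lemma triguM A B : trigu A -> trigu B -> trigu (A *m B).
Proof.
by move=> /andP[tA uA] /andP[tB uB]; rewrite /trigu is_trigM //= unitmx_mul uA.
Qed.

Lemma trigu_inv A : trigu A -> trigu (invmx A).
Proof.
move=> tA; rewrite /trigu unitmx_inv; case/andP: (tA) => /is_trig_mxP At uA; rewrite uA andbT.
apply/is_trig_mxP => i j ij.
have [m] := ubnP i; elim: m => // m IH in i ij *; rewrite ltnS => im.
have /matrixP/(_ i j) := mulmxV uA; rewrite !mxE (bigD1 i) //= big1 ?addr0; last first.
  move=> l li; case: (ltngtP i l) => [il|il|/val_inj e]; last by rewrite e eqxx in li.
    by rewrite At // mul0r.
  by rewrite (_ : invmx A l j = 0) ?mulr0 //; apply: IH; lia.
have -> : (i == j) = false by apply/negbTE; rewrite neq_ltn ij.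
by move=> /eqP; rewrite mulf_eq0 (negPf (trigu_diag i tA)) => /eqP.
Qed.

Lemma trigu1 : trigu 1%:M.
Proof. by rewrite /trigu scalar_mx_is_trig unitmx1. Qed.

End Triangular.

Section RowOperation.
Variables (R : comNzRingType) (n : nat).

(** Two pivot rows at once serve the 2 x 2 pivots; the scaling [d] clears denominators, since
    elimination takes place over polynomials. *)
Definition rowop (d a b : 'I_n -> R) (i j : 'I_n) : 'M[R]_n :=
  \matrix_(k, l) (d k *+ (k == l) - a k *+ (l == i) - b k *+ (l == j)).

Lemma rowopE d a b i j m (B : 'M[R]_(n, m)) k l :
  (rowop d a b i j *m B) k l = d k * B k l - a k * B i l - b k * B j l.
Proof.
have sel c (i0 : 'I_n) : \sum_s c *+ (s == i0) * B s l = c * B i0 l.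
  rewrite (bigD1 i0) //= eqxx mulr1n big1 ?addr0 // => s /negPf ->.
  by rewrite mulr0n mul0r.
rewrite mxE -!sel -!sumrB; apply: eq_bigr => s _; rewrite mxE [k == s]eq_sym.
by rewrite !mulrBl.
Qed.

Lemma rowop_trE d a b i j m (B : 'M[R]_(m, n)) k l :
  (B *m (rowop d a b i j)^T) k l = d l * B k l - a l * B k i - b l * B k j.
Proof.
by rewrite -[B in LHS]trmxK -trmx_mul [LHS]mxE rowopE !mxE.
Qed.

End RowOperation.

(** * Symmetric elimination by congruences *)

Section SymmetricPivots.
Variables (F : fieldType) (n : nat).
Implicit Types (A B : 'M[{poly F}]_n) (J : {set 'I_n}) (pi : {perm 'I_n}) (v : 'I_n -> nat).

(** Coefficients on the wrong side of the diagonal may be nonzero as long as they are divisible by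
    ['X]. *)
Lemma rowop_trigu (d a b : 'I_n -> {poly F}) (i j : 'I_n) :
  (forall k, (d k).[0] != 0) -> (forall k : 'I_n, (k <= i)%N -> (a k).[0] = 0) ->
  (forall k : 'I_n, (k <= j)%N -> (b k).[0] = 0) -> trigu (ev 0 (rowop d a b i j)).
Proof.
move=> d0 a0 b0; apply/triguP; split=> [|k]; last first.
  rewrite evE mxE eqxx mulr1n !hornerD !hornerN !hornerMn.
  have -> : (a k).[0] *+ (k == i) = 0 by case: eqP => [->|_]; rewrite ?mulr0n // a0.
  have -> : (b k).[0] *+ (k == j) = 0 by case: eqP => [->|_]; rewrite ?mulr0n // b0.
  by rewrite !subr0.
apply/is_trig_mxP => k l kl; rewrite evE mxE !hornerD !hornerN !hornerMn.
have -> : (k == l) = false by apply/negbTE; rewrite neq_ltn kl.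
have -> : (a k).[0] *+ (l == i) = 0.
  by case: eqP => [e|_]; rewrite ?mulr0n // a0 // -e ltnW.
have -> : (b k).[0] *+ (l == j) = 0.
  by case: eqP => [e|_]; rewrite ?mulr0n // b0 // -e ltnW.
by rewrite mulr0n !subr0.
Qed.

(* The rows outside [J] already have the form of the conclusion of [elim_sym]. *)
Definition sym_state B J pi v :=
  [/\ B^T = B, (forall k, pi (pi k) = k) /\ (forall k, k \in J -> pi k = k),
      forall k, v (pi k) = v k,
      forall k l, k \notin J -> l != k -> l != pi k -> B k l = 0 &
      forall k l, k \notin J -> exists c, B k l = 'X^(v k) * c /\ (c.[0] != 0) = (l == pi k)].

(** [C] is the block of [B] on [J] divided by the highest possible power of ['X], and [(i, j)] is
    its first position, row by row, that survives at 0. Rows before [i] then vanish at 0, and so do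
    the coefficients that elimination would apply to them; this is what triangularity at 0
    requires. *)
Definition sym_pivot B J w (C : 'M[{poly F}]_n) (i j : 'I_n) :=
  [/\ C^T = C, forall k l, C k l = 0 \/ k \in J /\ l \in J,
      forall k l, k \in J -> l \in J -> B k l = 'X^w * C k l,
      [/\ i \in J, j \in J, (i <= j)%N & (C i j).[0] != 0] &
      (forall k l : 'I_n, (k < i)%N -> (C k l).[0] = 0) /\
      (forall l : 'I_n, (l < j)%N -> (C i l).[0] = 0)].

Lemma sym_state_cross B J pi v k l : sym_state B J pi v ->
  k \notin J -> l \in J -> B k l = 0 /\ B l k = 0.
Proof.
move=> [BT [pi2 piJ] _ B0 _] kJ lJ.
suff E : B k l = 0 by split=> //; rewrite -BT mxE.
apply: B0 => //; first by apply: contraNneq kJ => <-.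
by apply: contraNneq kJ => lk; rewrite -(pi2 k) -lk piJ.
Qed.

Lemma sym_pivot_exists B J pi v : sym_state B J pi v -> \det B != 0 -> J != finset.set0 ->
  exists w C i j, sym_pivot B J w C i j.
Proof.
move=> st dB /set0Pn[k0 k0J]; have [BT _ _ _ _] := st.
pose M := \matrix_(k, l) (B k l *+ ((k \in J) && (l \in J))).
have M0 : M != 0.
  apply: contra_neq dB => /matrixP M0; rewrite (expand_det_row _ k0) big1 // => l _.
  suff -> : B k0 l = 0 by rewrite mul0r.
  have [lJ|lJ] := boolP (l \in J); last by case: (sym_state_cross st lJ k0J).
  by have := M0 k0 l; rewrite !mxE k0J lJ.
have [w [C [MC C0]]] := poly_mx_valuation M0.
have X0 : 'X^w != 0 :> {poly F} by rewrite -size_poly_eq0 size_polyXn.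
have CE k l : 'X^w * C k l = B k l *+ ((k \in J) && (l \in J)).
  by have /matrixP/(_ k l) := MC; rewrite !mxE.
have CT k l : C k l = C l k.
  apply: (mulfI X0); rewrite !CE andbC; congr (_ *+ _).
  by rewrite -[in LHS]BT mxE.
have CJ k l : C k l = 0 \/ k \in J /\ l \in J.
  have := CE k l; case: (k \in J); case: (l \in J) => /=; [by right|left..];
  by move: H; rewrite mulr0n => /eqP; rewrite mulf_eq0 (negPf X0) => /eqP.
pose Pr i := [exists l, (C i l).[0] != 0].
have [i0 [j0 Cij0]] : exists i j, (C i j).[0] != 0.
  apply: contra_notP (elimN eqP C0) => H; apply/matrixP => i j; rewrite !mxE.
  by apply/eqP; apply: contra_notT H => ?; exists i, j.
have Pi0 : Pr i0 by apply/existsP; exists j0.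
case: (arg_minnP (fun i : 'I_n => i : nat) Pi0) => i /existsP[j1 Cij1] imin.
case: (@arg_minnP _ j1 (fun l => (C i l).[0] != 0) (fun l : 'I_n => l : nat) Cij1) => j Cij jmin.
have Ci (k l : 'I_n) : (k < i)%N -> (C k l).[0] = 0.
  move=> ki; apply/eqP; apply: contraLR ki => Ckl; rewrite -leqNgt; apply: imin.
  by apply/existsP; exists l.
have Cj (l : 'I_n) : (l < j)%N -> (C i l).[0] = 0.
  by move=> lj; apply/eqP; apply: contraLR lj => Cil; rewrite -leqNgt; exact: jmin.
have [ij0|[iJ jJ]] := CJ i j; first by rewrite ij0 horner0 eqxx in Cij.
exists w, C, i, j; split=> //.
- by apply/matrixP => k l; rewrite mxE CT.
- by move=> k l kJ lJ; rewrite CE kJ lJ.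
(* By symmetry row [j] is also nonzero at 0, so it cannot precede row [i]. *)
split=> //; rewrite leqNgt; apply: contra Cij => ji.
by rewrite CT Ci.
Qed.

(* A transvection making the second diagonal entry of a hyperbolic 2 x 2 pivot
   vanish at 0; exact vanishing would require a square root in F[[X]]. *)
Lemma sym_pivot_adjust B J pi v w C i j : (2 : F) != 0 ->
  sym_state B J pi v -> sym_pivot B J w C i j -> (i < j)%N ->
  exists g C', [/\ trigu (ev 0 g), sym_state (g *m B *m g^T) J pi v,
     sym_pivot (g *m B *m g^T) J w C' i j & (C' j j).[0] = 0].
Proof.
move=> two st [CT CJ BC [iJ jJ _ Cij] [Ci Cj]] ij.
(* The new entry at [(j, j)] is [C j j - 2 c C i j + c^2 C i i], and [C i i] vanishes at 0 because
   [i < j]. *)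
pose c := (C j j).[0] / (2 * (C i j).[0]).
pose g := rowop (fun=> 1) (fun k => c%:P *+ (k == j)) (fun=> 0) i i.
have gE (M : 'M[{poly F}]_n) k l : (g *m M *m g^T) k l =
    M k l - c%:P *+ (k == j) * M i l - c%:P *+ (l == j) * (M k i - c%:P *+ (k == j) * M i i).
  by rewrite rowop_trE !rowopE; ring.
have CTE k l : C k l = C l k by rewrite -[in LHS]CT mxE.
exists g, (g *m C *m g^T).
have [BT [pi2 piJ] vpi B0 Bc] := st.
have Bg k l : k \notin J -> (g *m B *m g^T) k l = B k l.
  move=> kJ; rewrite gE; have [-> _] := sym_state_cross st kJ iJ.
  have -> : (k == j) = false by apply: contraNF kJ => /eqP ->.
  by rewrite mulr0n !mul0r !subr0 mulr0 subr0.
split.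
- apply: rowop_trigu => k; rewrite ?hornerC ?oner_eq0 ?horner0 // => ki.
  have -> : (k == j) = false by apply/negbTE; rewrite neq_ltn (leq_ltn_trans ki).
  by rewrite horner0.
- split=> //.
  + by rewrite !trmx_mul trmxK BT mulmxA.
  + by move=> k l kJ lk lpk; rewrite Bg ?B0.
  by move=> k l kJ; rewrite Bg //; exact: Bc.
- split.
  + by rewrite !trmx_mul trmxK CT mulmxA.
  + move=> k l; rewrite gE.
    have [kJ|kJ] := boolP (k \in J); have [lJ|lJ] := boolP (l \in J); try by right.
    * have z (m : 'I_n) : C m l = 0 by case: (CJ m l) => // -[_]; rewrite (negPf lJ).
      have -> : (l == j) = false by apply: contraNF lJ => /eqP ->.
      by left; rewrite !z ?mulr0n !(mulr0, mul0r, subr0).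
    * have z (m : 'I_n) : C k m = 0 by case: (CJ k m) => // -[]; rewrite (negPf kJ).
      have -> : (k == j) = false by apply: contraNF kJ => /eqP ->.
      by left; rewrite !z ?mulr0n !(mulr0, mul0r, subr0).
    * have z (m : 'I_n) : C k m = 0 by case: (CJ k m) => // -[]; rewrite (negPf kJ).
      have -> : (k == j) = false by apply: contraNF kJ => /eqP ->.
      by left; rewrite !z ?mulr0n !(mulr0, mul0r, subr0).
  + by move=> k l kJ lJ; rewrite !gE !BC //; ring.
  + split=> //; first exact: ltnW.
    rewrite gE eqxx mulr1n.
    have -> : (i == j) = false by apply/negbTE; rewrite neq_ltn ij.
    by rewrite mulr0n !mul0r !subr0 !hornerE (Cj i ij) mulr0 subr0.
  split=> [k l ki|l lj]; rewrite gE.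
    have -> : (k == j) = false by apply/negbTE; rewrite neq_ltn (ltn_trans ki).
    by rewrite mulr0n !(mul0r, subr0) hornerD hornerN hornerM !(Ci k) // mulr0 subr0.
  have -> : (l == j) = false by apply/negbTE; rewrite neq_ltn lj.
  have -> : (i == j) = false by apply/negbTE; rewrite neq_ltn ij.
  by rewrite !mulr0n !mul0r !subr0 Cj.
rewrite gE eqxx mulr1n !hornerE (Cj i ij) (CTE j i) /c.
by field; rewrite two Cij.
Qed.

End SymmetricPivots.

Section SymmetricElimination.
Variables (F : fieldType) (n : nat).
Implicit Types (A B : 'M[{poly F}]_n) (J : {set 'I_n}) (pi : {perm 'I_n}) (v : 'I_n -> nat).

Lemma trigu_det_neq0 (g : 'M[{poly F}]_n) : ev 0 g \in unitmx -> \det g != 0.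
Proof.
rewrite unitmxE unitfE det_ev; apply: contra_neq => ->; exact: horner0.
Qed.

(** Treats 1 x 1 and 2 x 2 pivots together: for [i = j] the transposition is the identity. The two
    linear equations on [a] and [b] are the elimination system multiplied by [dl], so that row [k]
    loses its entries in the pivot columns. *)
Lemma sym_step B J pi v w C i j (dl : {poly F}) (a b : 'I_n -> {poly F}) :
  sym_state B J pi v -> sym_pivot B J w C i j ->
  dl.[0] != 0 ->
  (forall k, (k \notin J) || (k == i) || (k == j) -> a k = 0 /\ b k = 0) ->
  (forall k, k != i -> k != j -> a k * C i i + b k * C j i = dl * C k i) ->
  (forall k, k != i -> k != j -> a k * C i j + b k * C j j = dl * C k j) ->
  (forall k : 'I_n, (k <= i)%N -> (a k).[0] = 0) ->
  (forall k : 'I_n, (k <= j)%N -> (b k).[0] = 0) ->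
  (forall k l, k \in [set i; j]%SET -> l \in [set i; j]%SET ->
     ((C k l).[0] != 0) = (l == tperm i j k)) ->
  exists g pi' v', trigu (ev 0 g) /\
    sym_state (g *m B *m g^T) (J :\: [set i; j])%SET pi' v'.
Proof.
move=> st [CT CJ BC [iJ jJ _ Cij] _] dl0 ab0 ai bj ta tb Cb.
(* Scaling the rows outside the pivot by [dl] replaces division. It costs only factors that are
   nonzero at 0, which [sym_state] tolerates. *)
pose d k := if (k == i) || (k == j) then 1 else dl.
have d0 k : (d k).[0] != 0 by rewrite /d; case: ifP; rewrite ?hornerC ?oner_eq0.
pose g := rowop d a b i j; exists g, (tperm i j * pi)%g.
exists (fun k => if (k == i) || (k == j) then w else v k); split; first exact: rowop_trigu.
have [BT [pi2 piJ] vpi B0 Bc] := st.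
set J' := (J :\: _)%SET.
have J'E k : (k \in J') = [&& k != i, k != j & k \in J] by rewrite !inE negb_or andbA.
have R0 k l : k \in J' -> l \notin J' -> (g *m B) k l = 0.
  rewrite !J'E rowopE => /and3P[ki kj kJ].
  have -> : d k = dl by rewrite /d (negPf ki) (negPf kj).
  have [lJ|lJ] := boolP (l \in J); last first.
    have cr m : m \in J -> B m l = 0 by move=> mJ; case: (sym_state_cross st lJ mJ).
    by rewrite !cr // !mulr0 !subr0.
  rewrite andbT -negb_or negbK => /orP[] /eqP ->; rewrite !BC //.
    have -> : dl * ('X^w * C k i) - a k * ('X^w * C i i) - b k * ('X^w * C j i) =
       'X^w * (dl * C k i - (a k * C i i + b k * C j i)) by ring.
    by rewrite ai // subrr mulr0.
  have -> : dl * ('X^w * C k j) - a k * ('X^w * C i j) - b k * ('X^w * C j j) =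
       'X^w * (dl * C k j - (a k * C i j + b k * C j j)) by ring.
  by rewrite bj // subrr mulr0.
have abJ' k : k \notin J' -> a k = 0 /\ b k = 0.
  rewrite J'E => H; apply: ab0; move: H.
  by case: (k == i); case: (k == j); case: (k \in J).
have RE k l : k \notin J' -> (g *m B) k l = d k * B k l.
  by move=> kJ'; rewrite rowopE; have [-> ->] := abJ' _ kJ'; rewrite !mul0r !subr0.
have B'T : (g *m B *m g^T)^T = g *m B *m g^T by rewrite !trmx_mul trmxK BT mulmxA.
have B'E k l : k \notin J' -> l \notin J' -> (g *m B *m g^T) k l = d k * d l * B k l.
  move=> kJ' lJ'; rewrite rowop_trE; have [-> ->] := abJ' _ lJ'.
  by rewrite !mul0r !subr0 RE //; ring.
have B'0 k l : k \notin J' -> l \in J' -> (g *m B *m g^T) k l = 0.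
  move=> kJ' lJ'; rewrite -B'T mxE rowop_trE; have [-> ->] := abJ' _ kJ'.
  by rewrite R0 // mulr0 !mul0r !subr0.
have pii := piJ i iJ; have pij := piJ j jJ.
have notij k : k \notin J -> (k != i) /\ (k != j).
  by move=> kJ; split; apply: contraNneq kJ => ->.
have piij k : k != i -> k != j -> (pi k != i) /\ (pi k != j).
  move=> ki kj; split; first by rewrite -pii (inj_eq perm_inj).
  by rewrite -pij (inj_eq perm_inj).
have pi'E k : (tperm i j * pi)%g k = if k == i then j else if k == j then i else pi k.
  rewrite permM; case: tpermP => [->|->|/eqP/negPf -> /eqP/negPf ->] //.
    by rewrite eqxx.
  by rewrite eqxx pii; case: eqP => // ->.
have pi'J k : k \notin J' -> (tperm i j * pi)%g k \notin J'.
  rewrite pi'E; case: eqP => [-> _|/eqP ki]; first by rewrite J'E eqxx andbF.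
  case: eqP => [-> _|/eqP kj]; first by rewrite J'E eqxx.
  rewrite !J'E ki kj /=; apply: contra => /and3P[_ _ pkJ].
  by have := piJ _ pkJ; rewrite pi2 => ->.
split=> //.
- split=> k.
    rewrite !pi'E; case: (eqVneq k i) => [->|ki]; first by rewrite eqxx; case: eqP => // ->.
    case: (eqVneq k j) => [->|kj]; first by rewrite eqxx.
    by have [/negPf -> /negPf ->] := piij _ ki kj.
  by rewrite J'E pi'E => /and3P[/negPf -> /negPf -> /piJ].
- move=> k; rewrite !pi'E; case: (eqVneq k i) => [->|ki]; first by rewrite eqxx orbT.
  case: (eqVneq k j) => [->|kj]; first by rewrite eqxx.
  by have [/negPf -> /negPf ->] := piij _ ki kj; rewrite /= vpi.
- move=> k l kJ' lk lpk; have [lJ'|lJ'] := boolP (l \in J'); first exact: B'0.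
  rewrite B'E //; suff -> : B k l = 0 by rewrite mulr0.
  have [kJ|kJ] := boolP (k \in J); last first.
    have [ki kj] := notij _ kJ; apply: B0 => //.
    by move: lpk; rewrite pi'E (negPf ki) (negPf kj).
  have lij : (l != i) && (l != j).
    move: kJ'; rewrite J'E kJ andbT -negb_or negbK => /orP[] /eqP e; subst k.
      by rewrite lk; move: lpk; rewrite pi'E eqxx.
    move: lpk; rewrite pi'E eqxx; case: (eqVneq j i) => [e _|_ li]; last by rewrite li lk.
    by rewrite -e lk.
  have lJ : l \notin J by move: lJ'; rewrite J'E; case/andP: lij => -> ->.
  by case: (sym_state_cross st lJ kJ).
move=> k l kJ'; have [lJ'|lJ'] := boolP (l \in J').
  exists 0; rewrite B'0 // mulr0 horner0 eqxx; split=> //; apply/esym/negbTE.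
  by apply: contraNneq (pi'J _ kJ') => <-.
have [kJ|kJ] := boolP (k \in J); last first.
  have [ki kj] := notij _ kJ; rewrite B'E // (negPf ki) (negPf kj) /=.
  have [c [-> cE]] := Bc k l kJ; exists (d k * d l * c); split; first by ring.
  by rewrite !hornerM !mulf_eq0 !(negPf (d0 _)) /= cE pi'E (negPf ki) (negPf kj).
have kij : (k == i) || (k == j) by move: kJ'; rewrite J'E kJ andbT -negb_or negbK.
rewrite B'E // kij; have [lJ|lJ] := boolP (l \in J); last first.
  have [_ ->] := sym_state_cross st lJ kJ.
  exists 0; rewrite !mulr0 horner0 eqxx; split=> //; apply/esym/negbTE.
  have [li lj] := notij _ lJ; move: kij; rewrite pi'E; case: (k == i) => //=; by case: (k == j).
have lij : (l == i) || (l == j) by move: lJ'; rewrite J'E lJ andbT -negb_or negbK.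
exists (d k * d l * C k l); rewrite BC //; split; first by ring.
rewrite !hornerM !mulf_eq0 !(negPf (d0 _)) /= Cb ?inE // pi'E.
case: tpermP kij => [->|->|]; rewrite ?eqxx //.
  by move=> _; case: (eqVneq j i) => [->|].
by move=> /eqP/negPf -> /eqP/negPf ->.
Qed.

Lemma elim_sym_state B J pi v : (2 : F) != 0 -> \det B != 0 -> sym_state B J pi v ->
  exists g pi' v', trigu (ev 0 g) /\ sym_state (g *m B *m g^T) finset.set0 pi' v'.
Proof.
move=> two; have [m] := ubnP #|J|; elim: m => // m IH in B J pi v *; rewrite ltnS => Jm dB st.
have [J0|J0] := eqVneq J finset.set0.
  exists 1%:M, pi, v; split; last by rewrite mul1mx trmx1 mulmx1 -J0.
  by rewrite /ev map_mx1 trigu1.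
have next g J' pi' v' : trigu (ev 0 g) -> sym_state (g *m B *m g^T) J' pi' v' ->
    (#|J'| < #|J|)%N ->
    exists g pi' v', trigu (ev 0 g) /\ sym_state (g *m B *m g^T) finset.set0 pi' v'.
  move=> tg st' J'J; have dg := trigu_det_neq0 (proj2 (andP tg)).
  have [||g' [pi'' [v'' [tg' st'']]]] := IH _ J' pi' v' _ _ st'.
  - exact: leq_trans J'J Jm.
  - by rewrite !det_mulmx det_tr !mulf_neq0.
  exists (g' *m g), pi'', v''; split; first by rewrite evM triguM.
  by rewrite trmx_mul !mulmxA in st'' *.
have [w [C [i [j pv]]]] := sym_pivot_exists st dB J0.
have [_ _ _ [iJ jJ ij Cij] _] := pv.
have cardJ' : (#|J :\: [set i; j]| < #|J|)%N.
  by apply: proper_card; apply/properP; split; [exact: subsetDl|exists i; rewrite // !inE eqxx].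
have [eij|nij] := eqVneq i j.
  subst j; have [CT CJ BC _ [Ci Cj]] := pv.
  (* Diagonal pivot: [dl] is the pivot itself, and [C k i] vanishes at 0 for [k < i]. *)
  pose a k := if k == i then 0 else C k i.
  have CTE k l : C k l = C l k by rewrite -[in LHS]CT mxE.
  have [|||||||g [pi' [v' [tg st']]]] := @sym_step B J pi v w C i i (C i i) a (fun=> 0) st pv.
  - by [].
  - move=> k; rewrite -orbA orbb /a; case: (eqVneq k i) => [//|_]; rewrite orbF => kJ; split=> //.
    by case: (CJ k i) => // -[]; rewrite (negPf kJ).
  - by move=> k /negPf ki _; rewrite /a ki; ring.
  - by move=> k /negPf ki _; rewrite /a ki; ring.
  - move=> k ki; rewrite /a; case: eqP => [_|kni]; first exact: horner0.
    by apply: Ci; rewrite ltn_neqAle ki andbT; apply/eqP => /val_inj.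
  - by move=> k _; exact: horner0.
  - by move=> k l; rewrite !inE !orbb => /eqP -> /eqP ->; rewrite tperm1 perm1 eqxx.
  exact: next st' cardJ'.
have ltij : (i < j)%N by rewrite ltn_neqAle ij andbT.
have [g0 [C' [tg0 st0 pv0 Cjj]]] := sym_pivot_adjust two st pv ltij.
have [CT CJ BC [_ _ _ C'ij] [Ci Cj]] := pv0.
have CTE k l : C' k l = C' l k by rewrite -[in LHS]CT mxE.
(* Numerators of Cramer's rule for the 2 x 2 pivot. At 0, [a k] vanishes for [k < i] because row [k]
   does; [b k] vanishes for [k < j] because [C' i i] and [C' k i = C' i k] do. *)
pose a k := if (k == i) || (k == j) then 0 else C' k i * C' j j - C' k j * C' i j.
pose b k := if (k == i) || (k == j) then 0 else C' k j * C' i i - C' k i * C' i j.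
have Cii : (C' i i).[0] = 0 by apply: Cj.
have [|||||||g [pi' [v' [tg st']]]] :=
    @sym_step _ J pi v w C' i j (C' i i * C' j j - C' i j * C' i j) a b st0 pv0.
- by rewrite !hornerE Cii mul0r sub0r oppr_eq0 mulf_neq0.
- move=> k; rewrite /a /b -orbA; case: (_ || (k == j)) => //; rewrite orbF => kJ.
  have z s : C' k s = 0 by case: (CJ k s) => // -[]; rewrite (negPf kJ).
  by rewrite !z !mul0r subr0.
- move=> k /negPf ki /negPf kj; rewrite /a /b ki kj /= (CTE j i); ring.
- move=> k /negPf ki /negPf kj; rewrite /a /b ki kj /=; ring.
- move=> k ki; rewrite /a; case: ifP => [_|]; first exact: horner0.
  move=> /norP[kni _]; have lki : (k < i)%N by rewrite ltn_neqAle ki andbT.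
  by rewrite !hornerE !(Ci k) // !mul0r subr0.
- move=> k kj; rewrite /b; case: ifP => [_|]; first exact: horner0.
  move=> /norP[_ knj]; have lkj : (k < j)%N by rewrite ltn_neqAle kj andbT.
  by rewrite !hornerE Cii (CTE k i) (Cj k) // mulr0 mul0r subr0.
- have [/negPf nji] : j != i by rewrite eq_sym.
  move=> k l; rewrite !inE => /orP[] /eqP -> /orP[] /eqP ->;
  by rewrite ?tpermL ?tpermR ?eqxx ?Cii ?Cjj ?(CTE j i) ?C'ij ?(negPf nij) ?nji ?eqxx.
apply: (@next (g *m g0) (J :\: [set i; j])%SET pi' v') => //.
  by rewrite evM triguM.
by rewrite trmx_mul !mulmxA in st' *.
Qed.

(** In the final state the power ['X^(v k)] stands on row [k]; since [v] is constant on the orbits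
    of [pi] it can be moved to the columns, and what remains is at 0 a symmetric monomial matrix. *)
Lemma elim_sym A : (2 : F) != 0 -> \det A != 0 -> A^T = A ->
  exists g pi v Cm, [/\ trigu (ev 0 g),
    g *m A *m g^T = Cm *m diag_mx (\row_k 'X^(v k)), (ev 0 Cm)^T = ev 0 Cm,
    (forall k, pi (pi k) = k) /\ (forall k, v (pi k) = v k) &
    forall k l, (ev 0 Cm k l != 0) = (l == pi k)].
Proof.
move=> two dA AT.
have [|g [pi [v [tg st]]]] := @elim_sym_state A finset.setT 1%g (fun=> 0%N) two dA.
  by split=> // [|k l|k l]; rewrite ?inE //; split=> k *; rewrite ?perm1.
exists g, pi, v; have [BT [pi2 _] vpi B0 Bc] := st.
set B := g *m A *m g^T in BT B0 Bc *.
have X0 m : 'X^m != 0 :> {poly F} by rewrite -size_poly_eq0 size_polyXn.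
have Bc' k l : exists c, B k l = 'X^(v k) * c /\ (c.[0] != 0) = (l == pi k).
  by apply: Bc; rewrite inE.
pose c k l := sval (cid (Bc' k l)).
have cE k l : B k l = 'X^(v k) * c k l by case: (svalP (cid (Bc' k l))).
have c0 k l : ((c k l).[0] != 0) = (l == pi k) by case: (svalP (cid (Bc' k l))).
exists (\matrix_(k, l) c k l); split=> //.
- apply/matrixP => k l; rewrite [RHS]mxE (bigD1 l) //= big1 ?addr0; last first.
    by move=> s /negPf sl; rewrite !mxE sl mulr0n mulr0.
  rewrite cE ![in RHS]mxE eqxx mulr1n mulrC.
  have [->|lk] := eqVneq l k; first by [].
  have [->|lpk] := eqVneq l (pi k); first by rewrite vpi.
  have /eqP : B k l = 0 by apply: B0; rewrite ?inE.
  by rewrite cE mulf_eq0 (negPf (X0 _)) => /eqP ->; rewrite !mul0r.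
- apply/matrixP => k l; rewrite !mxE /horner_eval.
  have [e|ne] := eqVneq l (pi k).
    congr (_.[_]); apply: (mulfI (X0 (v k))).
    by rewrite -cE -(vpi k) -e -cE -[in LHS]BT mxE.
  have /negbFE/eqP -> : ((c k l).[0] != 0) = false by rewrite c0 (negPf ne).
  apply/eqP; apply: contraNT ne; rewrite c0 => /eqP ->.
  by rewrite pi2.
by move=> k l; rewrite !mxE; exact: c0.
Qed.

End SymmetricElimination.

(** * Two-sided elimination by upper triangular matrices *)

Section GeneralElimination.
Variables (F : fieldType) (n : nat).
Implicit Types (A B : 'M[{poly F}]_n) (J : {set 'I_n}) (pi : {perm 'I_n}) (v : 'I_n -> nat).

(** [pi] is a full permutation at every stage, but only its values off [J] are pivots; on [J] it
    merely matches the remaining rows with the remaining columns. *)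
Definition gen_state B J pi v :=
  [/\ forall k l, k \notin J -> l != pi k -> B k l = 0,
      forall k l, k \notin J -> l != k -> B l (pi k) = 0 &
      forall k, k \notin J -> exists c, B k (pi k) = 'X^(v k) * c /\ c.[0] != 0].

Lemma rowop_trigu_tr (d a : 'I_n -> {poly F}) (i : 'I_n) :
  (forall k, (d k).[0] != 0) -> (forall k : 'I_n, (i <= k)%N -> (a k).[0] = 0) ->
  trigu (ev 0 (rowop d a (fun=> 0) i i))^T.
Proof.
move=> d0 a0; apply/triguP; split=> [|k]; last first.
  rewrite mxE evE mxE eqxx mulr1n !hornerD !hornerN !hornerMn horner0 mul0rn.
  have -> : (a k).[0] *+ (k == i) = 0 by case: eqP => [->|_]; rewrite ?mulr0n // a0.
  by rewrite !subr0.
apply/is_trig_mxP => k l kl; rewrite mxE evE mxE !hornerD !hornerN !hornerMn horner0 mul0rn.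
have -> : (l == k) = false by apply/negbTE; rewrite neq_ltn kl orbT.
have -> : (a l).[0] *+ (k == i) = 0.
  by case: eqP => [e|_]; rewrite ?mulr0n // a0 // -e ltnW.
by rewrite mulr0n !subr0.
Qed.

(** The pivot is in the last row, and there in the first column, that is nonzero at 0: upper
    triangular factors can only clear upwards from the left and rightwards from the right, and the
    other entries to be cleared already vanish at 0. *)
Lemma elim_gen_state B J pi v : \det B != 0 -> gen_state B J pi v ->
  exists g h pi' v', [/\ trigu (ev 0 g)^T, trigu (ev 0 h)^T &
    gen_state (g *m B *m h) finset.set0 pi' v'].
Proof.
have [m] := ubnP #|J|; elim: m => // m IH in B J pi v *; rewrite ltnS => Jm dB st.
have [J0|/set0Pn[k0 k0J]] := eqVneq J finset.set0.
  exists 1%:M, 1%:M, pi, v; split; last by rewrite mul1mx mulmx1 -J0.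
    by rewrite /ev map_mx1 trmx1 trigu1.
  by rewrite /ev map_mx1 trmx1 trigu1.
have [N1 N2 N3] := st.
pose M := \matrix_(k, l) (B k l *+ (k \in J)).
have M0 : M != 0.
  apply: contra_neq dB => /matrixP M0; rewrite (expand_det_row _ k0) big1 // => l _.
  by have := M0 k0 l; rewrite !mxE k0J mulr1n => ->; rewrite mul0r.
have [w [C [MC C0]]] := poly_mx_valuation M0.
have X0 : 'X^w != 0 :> {poly F} by rewrite -size_poly_eq0 size_polyXn.
have CE k l : 'X^w * C k l = B k l *+ (k \in J).
  by have /matrixP/(_ k l) := MC; rewrite !mxE.
have CJ k l : k \notin J -> C k l = 0.
  by move=> /negPf kJ; apply: (mulfI X0); rewrite CE kJ mulr0.
have BC k l : k \in J -> B k l = 'X^w * C k l by move=> kJ; rewrite CE kJ.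
pose Pr i := [exists l, (C i l).[0] != 0].
have [i0 [j0 Cij0]] : exists i j, (C i j).[0] != 0.
  apply: contra_notP (elimN eqP C0) => H; apply/matrixP => i j; rewrite !mxE.
  by apply/eqP; apply: contra_notT H => ?; exists i, j.
have Pi0 : Pr i0 by apply/existsP; exists j0.
case: (arg_maxnP (fun i : 'I_n => i : nat) Pi0) => i /existsP[j1 Cij1] imax.
case: (@arg_minnP _ j1 (fun l => (C i l).[0] != 0) (fun l : 'I_n => l : nat) Cij1) => j Cij jmin.
have Ci (k l : 'I_n) : (i < k)%N -> (C k l).[0] = 0.
  move=> ki; apply/eqP; apply: contraLR ki => Ckl; rewrite -leqNgt; apply: imax.
  by apply/existsP; exists l.
have Cj (l : 'I_n) : (l < j)%N -> (C i l).[0] = 0.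
  by move=> lj; apply/eqP; apply: contraLR lj => Cil; rewrite -leqNgt; exact: jmin.
have iJ : i \in J by apply: contraNT Cij => /CJ ->; rewrite horner0.
have Cij0' : C i j != 0 by apply: contra_neq Cij => ->; rewrite horner0.
(* [k1] is the row to which [pi] currently assigns column [j]. It is still in [J], because used
   pivot columns vanish in row [i]; swapping [i] and [k1] gives [j] to [i]. *)
pose k1 := (pi^-1)%g j; have pk1 : pi k1 = j by rewrite permKV.
have k1J : k1 \in J.
  apply: contraNT Cij0' => k1J; apply/eqP/(mulfI X0); rewrite CE iJ mulr0 -pk1 N2 //.
  by apply: contraNneq k1J => <-.
pose d (e k : 'I_n) := if k == e then 1 else C i j.
have d0 e k : (d e k).[0] != 0 by rewrite /d; case: ifP; rewrite ?hornerC ?oner_eq0.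
pose a k := if k == i then 0 else C k j.
pose b l := if l == j then 0 else C i l.
pose g := rowop (d i) a (fun=> 0) i i.
pose h := (rowop (d j) b (fun=> 0) j j)^T.
have tg : trigu (ev 0 g)^T.
  apply: rowop_trigu_tr => // k ik; rewrite /a; case: eqP => [_|/eqP ki]; first exact: horner0.
  by apply: Ci; rewrite ltn_neqAle eq_sym ik andbT.
have th : trigu (ev 0 h)^T.
  have -> : (ev 0 h)^T = ev 0 (rowop (d j) b (fun=> 0) j j).
    by apply/matrixP => k l; rewrite !mxE.
  apply: rowop_trigu => // k kj; rewrite ?horner0 // /b; case: eqP => [_|/eqP ki]; first exact: horner0.
  by apply: Cj; rewrite ltn_neqAle kj andbT.
have gB k l : (g *m B) k l = d i k * B k l - a k * B i l.
  by rewrite rowopE mul0r subr0.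
have gBh k l : (g *m B *m h) k l = d j l * (g *m B) k l - b l * (g *m B) k j.
  by rewrite rowop_trE mul0r subr0.
have gBi l : (g *m B) i l = B i l by rewrite gB /d /a eqxx mul1r mul0r subr0.
have gBJ k l : k \notin J -> (g *m B) k l = C i j * B k l.
  move=> kJ; have ki : k != i by apply: contraNneq kJ => ->.
  by rewrite gB /d /a (negPf ki) (CJ k) // mul0r subr0.
have notk k : k \notin J -> k != i /\ k != k1.
  by move=> kJ; split; apply: contraNneq kJ => ->.
have pikj k : k \notin J -> pi k != j.
  by move=> /notk[_ kk1]; rewrite -pk1 (inj_eq perm_inj).
have gBj k : k != i -> (g *m B) k j = 0.
  move=> ki; have [kJ|kJ] := boolP (k \in J).
    by rewrite gB /d /a (negPf ki) !BC //; ring.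
  by rewrite gBJ // N1 ?mulr0 // eq_sym pikj.
have st' : gen_state (g *m B *m h) (J :\ i)%SET (tperm i k1 * pi)%g
    (fun k => if k == i then w else v k).
  have J'E k : k \notin (J :\ i)%SET -> k = i \/ k \notin J.
    by rewrite !inE negb_and negbK => /orP[/eqP|]; [left|right].
  have pi'i : (tperm i k1 * pi)%g i = j by rewrite permM tpermL.
  have pi'J k : k \notin J -> (tperm i k1 * pi)%g k = pi k.
    by move=> /notk[ki kk1]; rewrite permM tpermD // eq_sym.
  split.
  - move=> k l /J'E[->|kJ]; rewrite ?pi'i ?pi'J // => lj; rewrite gBh.
      by rewrite !gBi /d /b (negPf lj) !BC //; ring.
    by rewrite !gBJ // !(N1 k) // ?(eq_sym j) ?pikj // !mulr0 subrr.
  - move=> k l /J'E[->|kJ]; rewrite ?pi'i ?pi'J // => lk; rewrite gBh.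
      by rewrite gBj // !mulr0 subrr.
    have Bi0 : B i (pi k) = 0 by apply: N2 => //; rewrite eq_sym; case: (notk _ kJ).
    have Ci0 : C i (pi k) = 0 by apply: (mulfI X0); rewrite -BC // Bi0 mulr0.
    by rewrite /b (negPf (pikj _ kJ)) Ci0 mul0r subr0 gB N2 // Bi0 !mulr0 subrr mulr0.
  move=> k /J'E[->|kJ].
    by rewrite pi'i eqxx gBh /d /b eqxx mul1r mul0r subr0 gBi BC //; exists (C i j).
  have [/negPf ki _] := notk _ kJ; rewrite ki pi'J //.
  have [c [Bc c0]] := N3 _ kJ; exists (d j (pi k) * C i j * c); split.
    by rewrite gBh !gBJ // Bc (N1 k j) ?(eq_sym j) ?pikj //; ring.
  by rewrite !hornerM !mulf_neq0.
have [||g' [h' [pi' [v' [tg' th' st'']]]]] := IH _ (J :\ i)%SET _ _ _ _ st'.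
- by apply: leq_trans Jm; rewrite [X in (_ < X)%N](cardsD1 i) iJ.
- rewrite !det_mulmx !mulf_neq0 //; apply: trigu_det_neq0.
    by case/andP: tg => _; rewrite unitmx_tr.
  by case/andP: th => _; rewrite unitmx_tr.
exists (g' *m g), (h *m h'), pi', v'; split; last by rewrite !mulmxA in st'' *.
  by rewrite evM trmx_mul triguM.
by rewrite evM trmx_mul triguM.
Qed.

Lemma elim_gen A : \det A != 0 ->
  exists g h pi v u, [/\ trigu (ev 0 g)^T, trigu (ev 0 h)^T,
    g *m A *m h = diag_mx u *m diag_mx (\row_k 'X^(v k)) *m perm_mx pi &
    forall k, (u 0 k).[0] != 0].
Proof.
move=> dA; have [|g [h [pi [v [tg th [N1 N2 N3]]]]]] := @elim_gen_state A finset.setT 1%g (fun=> 0%N) dA.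
  by split=> k; rewrite ?inE // => l; rewrite inE.
have N3' k : exists c, (g *m A *m h) k (pi k) = 'X^(v k) * c /\ c.[0] != 0.
  by apply: N3; rewrite inE.
have [c cE] := choice N3'.
exists g, h, pi, v, (\row_k c k); split=> // [|k]; last by rewrite mxE; case: (cE k).
apply/matrixP => k l; rewrite -[in RHS]mulmxA !mul_diag_mx ![in RHS]mxE.
have [<-|ne] := eqVneq (pi k) l; last by rewrite !mulr0 N1 ?inE // eq_sym.
by have [-> _] := cE k; rewrite mulr1 mulrC.
Qed.

End GeneralElimination.

(** * Normal forms of limits *)

Lemma diag_mx_perm (R : comNzRingType) n (W : 'S_n) (f : 'I_n -> R) :
  diag_mx (\row_k f (W k)) = perm_mx W *m diag_mx (\row_k f k) *m perm_mx (W^-1)%g.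
Proof.
rewrite -row_permE -col_permE; apply/matrixP => i j.
by rewrite !mxE (inj_eq perm_inj).
Qed.

Lemma unitmx_diag (F : fieldType) n (d : 'rV[F]_n) :
  (forall k, d 0 k != 0) -> diag_mx d \in unitmx.
Proof. by move=> d0; rewrite unitmxE unitfE det_diag; apply/prodf_neq0 => k _. Qed.

Section NormalForms.
Variables (C : numClosedFieldType) (n : nat).
Implicit Types (d : nat -> bool) (W pi : 'S_n) (x y : flines C n).

(* [d j] means that the standard indices [j] and [j.+1] lie in the same block of the
   ordered set partition, so [level d i] is the number of the block of [i]. *)
Definition level d i := (\sum_(0 <= j < i) ~~ d j)%N.

Definition dpt d : flines C n := @stdpt n C (fun j => (d j)%:R).

Definition permpt d W := lr_act (perm_mx W) (perm_mx W^-1%g) (dpt d).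

Lemma is_limZ m (A : 'M[{poly C}]_n) x : is_lim A x -> is_lim ('X^m *: A) x.
Proof.
move=> Ax k; have [v [N [E N0 xk]]] := Ax k.
by exists (m * k.+1 + v)%N, N; split=> //; rewrite ext_mxZ E scalerA -exprM -exprD.
Qed.

Lemma is_lim_perm (A : 'M[{poly C}]_n) x (U W : 'S_n) : is_lim A x ->
  is_lim (perm_mx U *m A *m perm_mx W) (lr_act (perm_mx U) (perm_mx W) x).
Proof.
have E (s : 'S_n) : ev 0 (perm_mx s) = perm_mx s :> 'M[C]_n by exact: map_perm_mx.
by move=> /(@is_lim_act _ _ _ _ (perm_mx U) (perm_mx W)); rewrite !E; apply; exact: unitmx_perm.
Qed.

Lemma is_lim_levels d W :
  is_lim (diag_mx (\row_k 'X^(level d (W k)))) (permpt d W).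
Proof.
rewrite (diag_mx_perm W (fun k : 'I_n => 'X^(level d k))); apply: is_lim_perm.
have := @is_lim_stddiag n C (fun=> 1) (fun j => ~~ d j) (fun=> oner_neq0 _).
rewrite /dpt (_ : (fun j => 1 * _) = (fun j => (d j)%:R)); last first.
  by apply: funext => j; rewrite mul1r; case: (d j).
congr is_lim; congr diag_mx; apply/rowP => k; rewrite !mxE /partprod /level.
by rewrite -prodrXr; apply: eq_bigr => j _; rewrite scale1r.
Qed.

(** Sorting the exponents turns the matrix into a power of ['X] times [stddiag] of the powers
    ['X^(e j)], with [e] the successive differences; the limit only remembers which differences
    vanish. Equal exponents land in one block. *)
Lemma is_lim_diag (v : 'I_n -> nat) : exists W d,
  is_lim (diag_mx (\row_k 'X^(v k))) (permpt d W) /\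
  (forall k l, v k = v l -> level d (W k) = level d (W l)).
Proof.
pose s := sort leq [seq v k | k <- enum 'I_n].
have szs : size s == n by rewrite size_sort size_map size_enum_ord.
have : perm_eq (Tuple szs) [tuple v k | k < n] by rewrite /= perm_sort.
move=> /tuple_permP[w sw].
have sE (k : 'I_n) : nth 0%N s k = v (w k).
  have /(congr1 (fun t => nth 0%N t k)) := sw; rewrite /= => ->.
  by rewrite (nth_map k) ?size_enum_ord // nth_ord_enum tnth_mktuple.
have smono i j : (i <= j)%N -> (j < n)%N -> (nth 0%N s i <= nth 0%N s j)%N.
  move=> ij jn; have ss : sorted leq s by exact: sort_sorted leq_total _.
  by apply: (sorted_leq_nth leq_trans leqnn 0%N ss); rewrite ?inE ?(eqP szs) //; lia.
pose e j := (nth 0%N s j.+1 - nth 0%N s j)%N.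
pose d j := (e j == 0)%N; exists (w^-1)%g, d.
have se i : (i < n)%N -> nth 0%N s i = (nth 0%N s 0 + \sum_(0 <= j < i) e j)%N.
  elim: i => [|i IH] lin; first by rewrite big_geq ?addn0.
  rewrite big_nat_recr //= addnA -IH ?(ltnW lin) // /e subnKC //.
  exact: smono.
split; last first.
  move=> k l; rewrite -{1}(permKV w k) -{1}(permKV w l) -!sE.
  move: ((w^-1)%g k) ((w^-1)%g l) => i j sij.
  wlog ij : i j sij / (i <= j)%N.
    by move=> H; case: (leqP i j) => [|/ltnW] /H -> //.
  rewrite /level [in RHS](big_cat_nat (n := i)) //= [X in (_ + X)%N]big1_seq ?addn0 //.
  move=> l' /=; rewrite mem_index_iota => /andP[il lj]; apply/eqP; rewrite eqb0 negbK /d /e.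
  have := smono _ _ il (ltn_trans lj (ltn_ord j)).
  have := smono _ _ lj (ltn_ord j); have := smono _ _ (leqnSn l') (leq_ltn_trans lj (ltn_ord j)).
  by move: sij; lia.
have -> : diag_mx (\row_k 'X^(v k)) = 'X^(nth 0%N s 0) *:
    (perm_mx (w^-1)%g *m stddiag n (fun j => 1 *: 'X^(e j) : {poly C}) *m perm_mx w).
  have -> : (\row_k 'X^(v k) : 'rV[{poly C}]_n) = \row_k 'X^(nth 0%N s ((w^-1)%g k)).
    by apply/rowP => k; rewrite !mxE sE permKV.
  rewrite (diag_mx_perm _ (fun k : 'I_n => 'X^(nth 0%N s k))) invgK.
  rewrite scalemxAl scalemxAr; congr (_ *m _ *m _).
  apply/matrixP => i j; rewrite !mxE mulrnAr; congr (_ *+ _).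
  rewrite se // exprD /partprod -prodrXr; congr (_ * _).
  by apply: eq_bigr => k _; rewrite scale1r.
apply: is_limZ; rewrite /permpt invgK; apply: is_lim_perm.
have := @is_lim_stddiag n C (fun=> 1) e (fun=> oner_neq0 _).
rewrite /dpt (_ : (fun j => 1 * _) = (fun j => (d j)%:R)) //.
by apply: funext => j; rewrite mul1r.
Qed.

(* Both sides are the limit of [S diag(X^v) = diag(X^v) S]. *)
Lemma diag_act_levels (v : 'I_n -> nat) y (s : 'rV[C]_n) : (forall k, s 0 k != 0) ->
  is_lim (diag_mx (\row_k 'X^(v k))) y ->
  lr_act (diag_mx s) 1%:M y = lr_act 1%:M (diag_mx s) y.
Proof.
move=> s0 ly; have us := unitmx_diag s0.
have E : ev 0 (map_mx polyC (diag_mx s)) = diag_mx s by exact: ev_polyC.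
have E1 : ev 0 1%:M = 1%:M :> 'M[C]_n by exact: map_mx1.
have := is_lim_act (g := map_mx polyC (diag_mx s)) (h := 1%:M) _ _ ly.
have := is_lim_act (g := 1%:M) (h := map_mx polyC (diag_mx s)) _ _ ly.
rewrite !E !E1 us unitmx1 => /(_ isT isT) l1 /(_ isT isT).
rewrite mulmx1 mul1mx in l1 *; move=> l2; apply: (is_lim_uniq l2).
rewrite (_ : _ *m diag_mx _ = diag_mx (\row_k 'X^(v k)) *m map_mx polyC (diag_mx s)) //.
apply/matrixP => i j; rewrite map_diag_mx mul_diag_mx mul_mx_diag !mxE.
by case: eqP => [->|_]; rewrite ?mulr1n ?mulr0n ?mulr0 ?mul0r // mulrC.
Qed.

(** Take [s k] to be a square root of [M k (pi k)]: symmetry makes it constant on the orbits of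
    [pi], so [s k * s (pi k)] is the entry. *)
Lemma sym_monomial (M : 'M[C]_n) pi : M^T = M -> (forall k, pi (pi k) = k) ->
  (forall k l, (M k l != 0) = (l == pi k)) ->
  exists2 s : 'rV[C]_n, forall k, s 0 k != 0 & M = diag_mx s *m perm_mx pi *m diag_mx s.
Proof.
move=> MT pi2 M0; exists (\row_k sqrtC (M k (pi k))) => [k|].
  by rewrite mxE sqrtC_eq0 M0.
apply/matrixP => k l; rewrite mul_mx_diag mul_diag_mx !mxE.
have [<-|ne] := eqVneq (pi k) l; last first.
  apply/eqP; rewrite mulr0 mul0r; apply: contraNT ne; rewrite M0 => /eqP ->; exact: eqxx.
rewrite mulr1 pi2.
have -> : M (pi k) k = M k (pi k) by rewrite -[in LHS]MT mxE.
by rewrite -expr2 sqrtCK.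
Qed.

(** Elimination gives [Cm] at 0, that is S pi S with S diagonal, acting on [y] from the left alone.
    By [diag_act_levels] the inner S crosses [y] to the other side, and the result is a congruence
    by S, which joins the Borel factor. *)
Lemma sym_normal_form (A : 'M[{poly C}]_n) x :
  A^T = A -> \det A != 0 -> is_lim A x ->
  exists P d W pi, [/\ trigu P, forall k, pi (pi k) = k,
    forall k, level d (W (pi k)) = level d (W k) &
    x = lr_act P P^T (lr_act (perm_mx pi) 1%:M (permpt d W))].
Proof.
move=> AT dA lx; have two : (2 : C) != 0 by rewrite pnatr_eq0.
have [g [pi [v [Cm [tg gA CmT [pi2 vpi] Cm0]]]]] := elim_sym two dA AT.
have [W [d [ly lev]]] := is_lim_diag v.
set y := permpt d W in ly.
set g0 := ev 0 g in tg; have ug : g0 \in unitmx by case/andP: tg.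
have lx' : is_lim (g *m A *m g^T) (lr_act g0 g0^T x).
  have := is_lim_act (g := g) (h := g^T) _ _ lx.
  have -> : ev 0 g^T = g0^T by apply/matrixP => i j; rewrite !mxE.
  by apply; rewrite ?unitmx_tr.
have [s s0 CmE] := sym_monomial CmT pi2 Cm0.
have us := unitmx_diag s0.
have E : lr_act g0 g0^T x = lr_act (diag_mx s) (diag_mx s) (lr_act (perm_mx pi) 1%:M y).
  have uCm : ev 0 Cm \in unitmx by rewrite CmE !unitmx_mul us unitmx_perm.
  have E1 : ev 0 1%:M = 1%:M :> 'M[C]_n by exact: map_mx1.
  have := is_lim_act (g := Cm) (h := 1%:M) _ _ ly; rewrite E1 unitmx1 mulmx1 -gA.
  move=> /(_ uCm isT) l2; rewrite (is_lim_uniq lx' l2) CmE.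
  rewrite -[X in lr_act _ X]mulmx1 -lr_act_comp (diag_act_levels s0 ly).
  by rewrite !lr_act_comp !mulmx1 !mul1mx.
exists (invmx g0 *m diag_mx s), d, W, pi; split=> //; last first.
- rewrite trmx_mul tr_diag_mx trmx_inv -lr_act_comp -E.
  by rewrite lr_actK // unitmx_tr.
- by move=> k; apply: lev.
apply: triguM; first exact: trigu_inv.
by rewrite /trigu diag_mx_is_trig.
Qed.

Lemma gen_normal_form (A : 'M[{poly C}]_n) x :
  \det A != 0 -> is_lim A x ->
  exists P Q d W pi, [/\ trigu P^T, trigu Q^T &
    x = lr_act P Q (lr_act 1%:M (perm_mx pi) (permpt d W))].
Proof.
move=> dA lx; have [g [h [pi [v [u [tg th gA u0]]]]]] := elim_gen dA.
have [W [d [ly _]]] := is_lim_diag v.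
set y := permpt d W in ly.
set g0 := ev 0 g in tg; have ug : g0 \in unitmx by case/andP: tg; rewrite unitmx_tr.
set h0 := ev 0 h in th; have uh : h0 \in unitmx by case/andP: th; rewrite unitmx_tr.
have lx' := is_lim_act ug uh lx; rewrite gA in lx'.
have E : ev 0 (diag_mx u) = diag_mx (map_mx (horner_eval 0) u) by exact: map_diag_mx.
have Ep : ev 0 (perm_mx pi) = perm_mx pi :> 'M[C]_n by exact: map_perm_mx.
have uu : diag_mx (map_mx (horner_eval 0) u) \in unitmx.
  by apply: unitmx_diag => k; rewrite mxE; exact: u0.
have := is_lim_act (g := diag_mx u) (h := perm_mx pi) _ _ ly.
rewrite E Ep uu unitmx_perm => /(_ isT isT) /(is_lim_uniq lx') eq.
exists (invmx g0 *m diag_mx (map_mx (horner_eval 0) u)), (invmx h0), d, W, pi.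
rewrite -/y; split; last first.
- by rewrite lr_act_comp mulmx1 -lr_act_comp -eq lr_actK.
- by rewrite trmx_inv trigu_inv.
rewrite trmx_mul tr_diag_mx trmx_inv triguM ?trigu_inv // /trigu diag_mx_is_trig.
exact: uu.
Qed.

End NormalForms.

(** * The affine chart of nonzero leading minors *)

Section TopMinors.
Variables (R : comNzRingType) (n k : nat).
Hypothesis kn : (k <= n)%N.

Lemma top_minimal (c : 'I_(ext_dim n k)) : ~ (weight (sb c) < weight (sb (top kn)))%N.
Proof.
apply/negP; rewrite -leqNgt; apply: leq_sum => i _; rewrite sb_top /=.
exact: strict_incr_ge (sb_incr c).
Qed.

(** The leading subset has the least weight, so a triangular matrix has no nonzero entry from it to
    another subset. *)
Lemma ext_trig_top (L : 'M[R]_n) c : is_trig_mx L ->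
  ext_mx k L (top kn) c = (\prod_(i < k) L (widen_ord kn i) (widen_ord kn i)) *+ (c == top kn).
Proof.
move=> tL; have [->|ne] := eqVneq c (top kn); last first.
  apply/eqP; rewrite mulr0n; apply: contraNT ne => /(ext_mx_trig tL)[->//|].
  by move=> /top_minimal.
rewrite mxE mulr1n det_trig; last first.
  by apply/is_trig_mxP => i j ij; rewrite mxE !sb_top (is_trig_mxP tL).
by apply: eq_bigr => i _; rewrite mxE !sb_top.
Qed.

Lemma ext_trig_topT (U : 'M[R]_n) c : is_trig_mx U^T ->
  ext_mx k U c (top kn) = (\prod_(i < k) U (widen_ord kn i) (widen_ord kn i)) *+ (c == top kn).
Proof.
move=> tU; rewrite -[U]trmxK ext_mxT mxE ext_trig_top //; congr (_ *+ _).
by apply: eq_bigr => i _; rewrite !mxE.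
Qed.

End TopMinors.

(** * LDU decomposition from nonzero leading minors *)

Section LDU.
Variables (F : fieldType) (n : nat).

Definition unitrig (L : 'M[F]_n) := is_trig_mx L /\ forall i, L i i = 1.

Lemma unitrig_det L : unitrig L -> \det L = 1.
Proof. by move=> [tL dL]; rewrite det_trig // big1. Qed.

Lemma unitrigM L M : unitrig L -> unitrig M -> unitrig (L *m M).
Proof.
move=> [/[dup] tL /is_trig_mxP L0 dL] [/[dup] tM /is_trig_mxP M0 dM]; split; first exact: is_trigM.
move=> i; rewrite mxE (bigD1 i) //= dL dM mulr1 big1 ?addr0 // => j ji.
by case: (ltngtP i j) ji => [ij _|ij _|/val_inj ->];
  [rewrite L0 ?mul0r|rewrite (M0 j i) ?mulr0|rewrite eqxx].
Qed.

Lemma unitrig_inv L : unitrig L -> unitrig (invmx L).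
Proof.
move=> uL; have [tL dL] := uL.
have ul : L \in unitmx by rewrite unitmxE unitrig_det // unitr1.
have tL' : is_trig_mx (invmx L) by have /andP[] : trigu (invmx L) by apply: trigu_inv; rewrite /trigu tL.
split=> // i; have /matrixP/(_ i i) := mulmxV ul; rewrite !mxE eqxx (bigD1 i) //= dL mul1r big1 ?addr0 //.
move=> j ji; case: (ltngtP i j) ji => [ij|ij|/val_inj ->]; rewrite ?eqxx // => _.
  by rewrite (is_trig_mxP tL) ?mul0r.
by rewrite (is_trig_mxP tL') ?mulr0.
Qed.

Definition nonzero_minors (A : 'M[F]_n) :=
  forall k (kn : (k <= n)%N), ext_mx k A (top kn) (top kn) != 0.

Lemma minors_unitrig L A : unitrig L -> nonzero_minors A -> nonzero_minors (L *m A).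
Proof.
move=> [tL dL] mA k kn; rewrite ext_mxM mxE (bigD1 (top kn)) //= big1 ?addr0; last first.
  by move=> c /negPf ct; rewrite ext_trig_top // ct mulr0n mul0r.
by rewrite ext_trig_top // eqxx big1 // mul1r.
Qed.

(** With the first [m] columns cleared, the leading minor of size [m + 1] is a product of diagonal
    entries, so the next pivot is nonzero. Left multiplication by unitriangular matrices preserves
    leading minors. *)
Lemma lu_step (A : 'M[F]_n) m : (m <= n)%N -> nonzero_minors A ->
  exists2 L, unitrig L & forall i j : 'I_n, (j < m)%N -> (j < i)%N -> (L *m A) i j = 0.
Proof.
move=> + mA; elim: m => [|m IH] mn.
  by exists 1%:M => //; split=> [|i]; rewrite ?scalar_mx_is_trig // mxE eqxx.
have [L uL] := IH (ltnW mn); have := minors_unitrig uL mA.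
have [M ME] : exists M, M = L *m A by exists (L *m A).
rewrite -ME => mM LA.
pose p := Ordinal mn.
have Mpp : M p p != 0.
  have := mM _ mn; rewrite mxE -det_tr det_trig; last first.
    apply/is_trig_mxP => i j ij; rewrite !mxE !sb_top LA //=.
    by apply: leq_trans ij _; rewrite -ltnS.
  by move=> /prodf_neq0/(_ ord_max isT); rewrite !mxE !sb_top; congr (M _ _ != 0); exact: val_inj.
pose a (i : 'I_n) := if (m < i)%N then M i p / M p p else 0.
pose G := rowop (fun=> 1) a (fun=> 0) p p.
have uG : unitrig G.
  split=> [|i]; last first.
    rewrite mxE eqxx mulr1n mul0rn subr0 /a; case: eqP => [->|_]; last by rewrite mulr0n subr0.
    by rewrite /= ltnn mul0rn subr0.
  apply/is_trig_mxP => i j ij; rewrite mxE.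
  have -> : (i == j) = false by apply/negbTE; rewrite neq_ltn ij.
  rewrite mul0rn mulr0n subr0 sub0r; case: eqP => [e|_]; rewrite ?mulr0n ?oppr0 //.
  by rewrite /a ifN ?mul0rn ?oppr0 // -leqNgt; move: ij; rewrite e => /ltnW.
exists (G *m L); first exact: unitrigM.
move=> i j; rewrite ltnS leq_eqVlt -mulmxA -ME rowopE mul0r subr0 mul1r => /orP[/eqP jm|jm] ji.
  have -> : j = p by exact: val_inj.
  by rewrite /a -jm ji divfK // subrr.
by rewrite LA // LA ?mulr0 ?subr0.
Qed.

Lemma LDU (A : 'M[F]_n) : nonzero_minors A -> exists (L : 'M[F]_n) (D : 'rV[F]_n) (U : 'M[F]_n),
  [/\ unitrig L, unitrig U^T, forall i, D 0 i != 0 & A = L *m diag_mx D *m U].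
Proof.
move=> mA; have [L uL] := lu_step (leqnn n) mA; have := minors_unitrig uL mA.
have [M ME] : exists M, M = L *m A by exists (L *m A).
rewrite -ME => mM LA.
have tM : is_trig_mx M^T by apply/is_trig_mxP => i j ij; rewrite mxE LA.
have M0 i : M i i != 0.
  have := mM _ (leqnn n); rewrite ext_trig_topT // eqxx mulr1n.
  move=> /prodf_neq0/(_ i isT); congr (M _ _ != 0); exact: val_inj.
have ul : L \in unitmx by rewrite unitmxE unitrig_det // unitr1.
exists (invmx L), (\row_i M i i), (\matrix_(i, j) (M i j / M i i)); split.
- exact: unitrig_inv.
- split=> [|i]; last by rewrite !mxE divff.
  by apply/is_trig_mxP => i j ij; rewrite !mxE LA // mul0r.
- by move=> i; rewrite mxE.
rewrite -mulmxA; apply: (canRL (mulKmx ul)); rewrite -ME.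
by apply/matrixP => i j; rewrite mul_diag_mx !mxE mulrC divfK.
Qed.

End LDU.

(** * Minors from which the LDU factors are read *)

Section HookIndices.
Variable n : nat.

(** [top kn] is a default value for maps that are not strictly increasing, so that an index can be
    written without a proof. *)
Definition idx k (kn : (k <= n)%N) (f : {ffun 'I_k -> 'I_n}) : 'I_(ext_dim n k) :=
  oapp enum_rank (top kn) (insub f : option (ksub n k)).

Lemma sb_idx k (kn : (k <= n)%N) f : strict_incr f -> sb (idx kn f) = f.
Proof.
by move=> sf; rewrite /idx insubT /= /sb /ksub_of_ord enum_rankK.
Qed.

(* The subset {0, ..., k - 1, i}. *)
Definition fcol (k : nat) (i : 'I_n) : {ffun 'I_k.+1 -> 'I_n} :=
  [ffun a : 'I_k.+1 => if (a < k)%N then insubd i (val a) else i].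

Lemma fcolE k (i : 'I_n) (a : 'I_k.+1) : (k <= i)%N ->
  fcol k i a = (if (a < k)%N then a : nat else i) :> nat.
Proof.
move=> ki; rewrite ffunE; case: ifP => // ak; rewrite val_insubd ifT //.
by rewrite (ltn_trans ak) // (leq_ltn_trans ki).
Qed.

Lemma fcol_incr k (i : 'I_n) : (k <= i)%N -> strict_incr (fcol k i).
Proof.
move=> ki; apply/strict_incrP => a b ab; rewrite !fcolE //.
by have := ltn_ord b; case: ifP; case: ifP; lia.
Qed.

(** The submatrix is triangular with unit diagonal except for its last entry, so this minor reads
    off a single entry of [L]. *)
Lemma ext_trig_fcol (R : comNzRingType) (L : 'M[R]_n) (k : nat) (kn : (k.+1 <= n)%N) (i : 'I_n) :
  is_trig_mx L -> (forall j, L j j = 1) -> (k <= i)%N ->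
  ext_mx k.+1 L (idx kn (fcol k i)) (top kn) = L i (Ordinal kn).
Proof.
move=> tL dL ki; rewrite mxE sb_idx ?fcol_incr // det_trig; last first.
  apply/is_trig_mxP => a b ab; rewrite !mxE sb_top (is_trig_mxP tL) //=.
  by rewrite fcolE //; have := ltn_ord b; case: ifP; lia.
rewrite big_ord_recr /= mxE sb_top big1 ?mul1r; last first.
  move=> a _; rewrite mxE sb_top (_ : fcol k i _ = widen_ord kn (widen_ord (leqnSn k) a)) ?dL //.
  by apply: val_inj; rewrite /= fcolE //= ltn_ord.
congr (L _ _); last exact: val_inj.
by apply: val_inj; rewrite /= fcolE //= ltnn.
Qed.

(** For the subset {0, ..., k - 1, k + 1} all products are empty except the last, which is the
    single factor [t k]; this recovers the parameters from a point. *)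
Lemma stdmx_fcol (R : comPzRingType) (t : nat -> R) (k : nat) (kn : (k.+1 < n)%N) :
  stdmx n k.+1 t (idx (ltnW kn) (fcol k (Ordinal kn))) (idx (ltnW kn) (fcol k (Ordinal kn))) = t k.
Proof.
rewrite !mxE eqxx mulr1n sb_idx; last by apply: fcol_incr => /=.
rewrite big_ord_recr /= big1 ?mul1r; last first.
  by move=> a _; rewrite fcolE //= ltn_ord big_geq.
by rewrite fcolE //= ltnn big_nat1.
Qed.

Lemma eq_stdmx (R : comPzRingType) k (t t' : nat -> R) :
  (forall j, (j < n.-1)%N -> t j = t' j) -> stdmx n k t = stdmx n k t'.
Proof.
move=> tt'; congr diag_mx; apply/rowP => a; rewrite !mxE; apply: eq_bigr => i _.
rewrite !big_nat; apply: eq_bigr => j /andP[_ jk]; apply: tt'.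
by have := ltn_ord (sb a i); lia.
Qed.

End HookIndices.

(** * Regular functions on the chart *)

Section Chart.
Variables (C : numClosedFieldType) (n : nat).
Local Notation vecs := (forall k : 'I_n.-1, 'M[C]_(ext_dim n k.+1)).

Definition ext_deg_le (k : 'I_n.-1) : (k.+1 <= n)%N := ltnW (ltn_ext_deg k).

Definition lead (k : 'I_n.-1) (v : vecs) : C := v k (top (ext_deg_le k)) (top (ext_deg_le k)).

Definition in_chart (v : vecs) := forall k, lead k v != 0.

(* Quotients of a multihomogeneous polynomial by a product of leading entries of the
   same multidegree, i.e. the regular functions on the chart. *)
Definition chartreg (f : vecs -> C) := exists d g, polyfun d g /\
  forall v, in_chart v -> f v * \prod_k lead k v ^+ d k = g v.

Lemma eq_chartreg f g : (forall v, in_chart v -> f v = g v) -> chartreg f -> chartreg g.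
Proof. by move=> fg [d [h [ph E]]]; exists d, h; split=> // v cv; rewrite -fg ?E. Qed.

Lemma polyfun_leads (d : 'I_n.-1 -> nat) : polyfun d (fun v => \prod_k lead k v ^+ d k).
Proof.
have H (k : 'I_n.-1) : polyfun (fun i => ((k == i) * d k)%N) (fun v : vecs => lead k v ^+ d k).
  apply: polyfunX.
  exact: (@polyfun_coord C 'I_n.-1 (fun k => ext_dim n k.+1) k (top (ext_deg_le k)) (top (ext_deg_le k))).
apply: (eq_polyfun _ (frefl _) (polyfun_prod (index_enum _) H)).
move=> i; rewrite (bigD1 i) //= eqxx mul1n big1 ?addn0 // => j /negPf ji.
by rewrite ji mul0n.
Qed.

Lemma chartreg_const c : chartreg (fun=> c).
Proof.
exists (fun=> 0%N), (fun=> c); split; first exact: polyfun_const.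
by move=> v _; rewrite big1 ?mulr1.
Qed.

Lemma chartreg_coord (k : 'I_n.-1) a b : chartreg (fun v => v k a b / lead k v).
Proof.
exists (fun j => k == j : nat), (fun v => v k a b); split.
  exact: (@polyfun_coord C 'I_n.-1 (fun k => ext_dim n k.+1) k a b).
move=> v cv; rewrite (bigD1 k) //= eqxx big1 ?mulr1 ?divfK //.
by move=> j /negPf; rewrite eq_sym => ->.
Qed.

Lemma prod_leads_split (d e : 'I_n.-1 -> nat) v :
  \prod_k lead k v ^+ (d k + e k) = \prod_k lead k v ^+ d k * \prod_k lead k v ^+ e k.
Proof. by rewrite -big_split /=; apply: eq_bigr => k _; rewrite exprD. Qed.

Lemma chartregM f g : chartreg f -> chartreg g -> chartreg (fun v => f v * g v).
Proof.
move=> [d [f' [pf fE]]] [e [g' [pg gE]]].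
exists (fun k => d k + e k)%N, (fun v => f' v * g' v); split; first exact: polyfunM.
by move=> v cv; rewrite prod_leads_split -fE // -gE //; ring.
Qed.

Lemma chartregD f g : chartreg f -> chartreg g -> chartreg (fun v => f v + g v).
Proof.
move=> [d [f' [pf fE]]] [e [g' [pg gE]]].
exists (fun k => d k + e k)%N, (fun v => f' v * \prod_k lead k v ^+ e k + g' v * \prod_k lead k v ^+ d k); split.
  apply: polyfunD; first exact: polyfunM (polyfun_leads _).
  by apply: eq_polyfun (polyfunM pg (polyfun_leads d)) => // k; rewrite addnC.
by move=> v cv; rewrite prod_leads_split -fE // -gE //; ring.
Qed.

Lemma chartregZ c f : chartreg f -> chartreg (fun v => c * f v).
Proof. exact: chartregM (chartreg_const c). Qed.

Lemma chartreg_sum (T : Type) (r : seq T) (P : pred T) (f : T -> vecs -> C) :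
  (forall t, chartreg (f t)) -> chartreg (fun v => \sum_(t <- r | P t) f t v).
Proof.
move=> H; elim: r => [|t r IH].
  by apply: eq_chartreg (chartreg_const 0) => v _; rewrite big_nil.
case Pt : (P t); last by apply: eq_chartreg IH => v _; rewrite big_cons Pt.
by apply: eq_chartreg (chartregD (H t) IH) => v _; rewrite big_cons Pt.
Qed.

Lemma chartreg_prod (T : Type) (r : seq T) (P : pred T) (f : T -> vecs -> C) :
  (forall t, chartreg (f t)) -> chartreg (fun v => \prod_(t <- r | P t) f t v).
Proof.
move=> H; elim: r => [|t r IH].
  by apply: eq_chartreg (chartreg_const 1) => v _; rewrite big_nil.
case Pt : (P t); last by apply: eq_chartreg IH => v _; rewrite big_cons Pt.
by apply: eq_chartreg (chartregM (H t) IH) => v _; rewrite big_cons Pt.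
Qed.

Definition chartregmx p q (M : vecs -> 'M[C]_(p, q)) :=
  forall i j, chartreg (fun v => M v i j).

Lemma chartreg_det p (M : vecs -> 'M[C]_p) : chartregmx M -> chartreg (fun v => \det (M v)).
Proof.
move=> H; apply: chartreg_sum => s; apply: chartregZ; apply: chartreg_prod => i.
exact: H.
Qed.

Lemma chartreg_mul p q r (M : vecs -> 'M[C]_(p, q)) (N : vecs -> 'M[C]_(q, r)) :
  chartregmx M -> chartregmx N -> chartregmx (fun v => M v *m N v).
Proof.
move=> HM HN i j; apply: (eq_chartreg (f := fun v => \sum_k M v i k * N v k j)).
  by move=> v _; rewrite mxE.
by apply: chartreg_sum => k; exact: chartregM.
Qed.

Lemma chartreg_ext k (M : vecs -> 'M[C]_n) :
  chartregmx M -> chartregmx (fun v => ext_mx k (M v)).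
Proof.
move=> H a b; apply: (eq_chartreg (f := fun v => \det (mxsub (sb a) (sb b) (M v)))).
  by move=> v _; rewrite mxE.
apply: chartreg_det => i j; apply: (eq_chartreg _ (H (sb a i) (sb b j))).
by move=> v _; rewrite mxE.
Qed.

Lemma chartreg_adj (M : vecs -> 'M[C]_n) : chartregmx M -> chartregmx (fun v => \adj (M v)).
Proof.
move=> H i j; apply: (eq_chartreg (f := fun v => cofactor (M v) j i)).
  by move=> v _; rewrite mxE.
apply: chartregZ; apply: chartreg_det => a b.
by apply: (eq_chartreg _ (H (lift j a) (lift i b))) => v _; rewrite !mxE.
Qed.

(** The numerator is multiplied by the product of all leading entries, so that it vanishes also at
    the embedded matrices outside the chart and becomes an equation of the closure. *)
Lemma chart_vanish sym f x v : chartreg f ->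
  (forall A w, matset sym A -> is_rep (ext_lines A) w -> in_chart w -> f w = 0) ->
  zariski_closure (embset sym) x -> is_rep x v -> in_chart v -> f v = 0.
Proof.
move=> [d [g [pg E]]] H cx xv cv.
have L0 w : (\prod_k lead k w ^+ 1 != 0) = `[< in_chart w >].
  apply/prodf_neq0/asboolP => [h k|h k _]; last by rewrite expr1.
  by have := h k isT; rewrite expr1.
have pf := polyfunM pg (polyfun_leads (fun=> 1%N)).
have /eqP : g v * \prod_k lead k v ^+ 1 = 0.
  apply: (closure_polyfun cx pf _ xv) => y w [A mA <-] yw.
  have [cw|] := boolP `[< in_chart w >].
    by move/asboolP: cw => cw; rewrite -E // (H A w mA yw cw) !mul0r.
  by rewrite -L0 negbK => /eqP ->; rewrite mulr0.
rewrite mulf_eq0 => /orP[|/eqP z]; last first.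
  by have /asboolP := cv; rewrite -L0 z eqxx.
rewrite -E // mulf_eq0 => /orP[/eqP //|/eqP z].
suff : \prod_k lead k v ^+ d k != 0 by rewrite z eqxx.
by apply/prodf_neq0 => k _; rewrite expf_neq0.
Qed.

(** Indexed by a plain number so that row and column indices in ['I_n] can be used; the default 0
    concerns degrees outside 1, ..., n - 1. *)
Definition ratio (k : nat) (a b : forall k' : 'I_n.-1, 'I_(ext_dim n k'.+1)) (v : vecs) : C :=
  if (insub k : option 'I_n.-1) is Some k' then v k' (a k') (b k') / lead k' v else 0.

Lemma ratioE (k : 'I_n.-1) a b v : ratio k a b v = v k (a k) (b k) / lead k v.
Proof. by rewrite /ratio valK. Qed.

Lemma chartreg_ratio k a b : chartreg (ratio k a b).
Proof.
by rewrite /ratio; case: insub => [k'|]; [exact: chartreg_coord|exact: chartreg_const].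
Qed.

Definition ftop (k : 'I_n.-1) := top (ext_deg_le k).
Definition fside (i : 'I_n) (k : 'I_n.-1) := idx (ext_deg_le k) (fcol k i).

Definition Lmat (v : vecs) : 'M[C]_n :=
  \matrix_(i, j) if i == j then 1 else if (j < i)%N then ratio j (fside i) ftop v else 0.
Definition Umat (v : vecs) : 'M[C]_n :=
  \matrix_(i, j) if i == j then 1 else if (i < j)%N then ratio i ftop (fside j) v else 0.

(** The exterior power of the middle LDU factor, normalized. Adjugates replace inverses: they are
    polynomial in the entries, and both triangular factors have determinant 1. *)
Definition Nmat (k : 'I_n.-1) (v : vecs) : 'M[C]_(ext_dim n k.+1) :=
  ext_mx k.+1 (\adj (Lmat v)) *m \matrix_(a, b) (v k a b / lead k v) *m ext_mx k.+1 (\adj (Umat v)).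

Definition tpar (v : vecs) (j : nat) : C :=
  if (insub j : option 'I_n.-1) is Some k then
    Nmat k v (fside (Ordinal (ltn_ext_deg k)) k) (fside (Ordinal (ltn_ext_deg k)) k) else 0.

Lemma unitrig_Lmat v : unitrig (Lmat v).
Proof.
split=> [|i]; last by rewrite mxE eqxx.
apply/is_trig_mxP => i j ij; rewrite mxE ifN ?ifN //; first by rewrite -leqNgt ltnW.
by rewrite neq_ltn ij.
Qed.

Lemma unitrig_Umat v : unitrig (Umat v)^T.
Proof.
split=> [|i]; last by rewrite !mxE eqxx.
apply/is_trig_mxP => i j ij; rewrite !mxE ifN ?ifN //; first by rewrite -leqNgt ltnW.
by rewrite neq_ltn ij orbT.
Qed.

Lemma chartreg_Lmat : chartregmx Lmat.
Proof.
move=> i j; apply: (eq_chartreg (f := fun v => if i == j then 1 else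
  if (j < i)%N then ratio j (fside i) ftop v else 0)); first by move=> v _; rewrite mxE.
case: (i == j); first exact: chartreg_const.
by case: leq; [exact: chartreg_ratio|exact: chartreg_const].
Qed.

Lemma chartreg_Umat : chartregmx Umat.
Proof.
move=> i j; apply: (eq_chartreg (f := fun v => if i == j then 1 else
  if (i < j)%N then ratio i ftop (fside j) v else 0)); first by move=> v _; rewrite mxE.
case: (i == j); first exact: chartreg_const.
by case: leq; [exact: chartreg_ratio|exact: chartreg_const].
Qed.

Lemma chartreg_Nmat k : chartregmx (Nmat k).
Proof.
apply: chartreg_mul; first apply: chartreg_mul.
- exact/chartreg_ext/chartreg_adj/chartreg_Lmat.
- move=> a b; apply: (eq_chartreg _ (chartreg_coord a b)) => v _.
  by rewrite mxE.
exact/chartreg_ext/chartreg_adj/chartreg_Umat.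
Qed.

Lemma chartreg_tpar j : chartreg (tpar^~ j).
Proof.
by rewrite /tpar; case: insub => [k|]; [exact: chartreg_Nmat|exact: chartreg_const].
Qed.

Lemma chartreg_stdmx k : chartregmx (fun v => stdmx n k (tpar v)).
Proof.
move=> a b; have [ab|ab] := eqVneq a b; last first.
  by apply: (eq_chartreg _ (chartreg_const 0)) => v _; rewrite !mxE (negPf ab).
apply: (eq_chartreg (f := fun v => \prod_(i < k) \prod_(i <= j < sb a i) tpar v j)).
  by move=> v _; rewrite !mxE ab eqxx.
by apply: chartreg_prod => i; apply: chartreg_prod => j; exact: chartreg_tpar.
Qed.

(** * The chart functions at points of the open orbit *)

Section OnEmbedded.
Variables (L U : 'M[C]_n) (D : 'rV[C]_n) (v : vecs).
Hypotheses (uL : unitrig L) (uU : unitrig U^T) (D0 : forall i, D 0 i != 0).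
Hypothesis rv : is_rep (ext_lines (L *m diag_mx D *m U)) v.

Let Dtop (k : 'I_n.-1) := \prod_(i < k.+1) D 0 (widen_ord (ext_deg_le k) i).

Let Dtop0 (k : 'I_n.-1) : Dtop k != 0. Proof. by apply/prodf_neq0. Qed.

Let U_unit : U \in unitmx.
Proof. by rewrite -unitmx_tr unitmxE unitrig_det ?unitr1. Qed.
Let L_unit : L \in unitmx.
Proof. by rewrite unitmxE unitrig_det ?unitr1. Qed.

Lemma embedded_scale (k : 'I_n.-1) : exists2 a, a != 0 &
  v k = a *: (ext_mx k.+1 L *m ext_mx k.+1 (diag_mx D) *m ext_mx k.+1 U).
Proof.
have e := rv k; rewrite /ext_lines ext_powE !ext_mxM in e.
apply: vline_scale (esym e).
rewrite -!ext_mxM; apply/eqP => z.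
have D_unit := unitmx_diag D0.
have : ext_mx k.+1 (L *m diag_mx D *m U) *m ext_mx k.+1 (invmx (L *m diag_mx D *m U)) = 0.
  by rewrite z mul0mx.
rewrite -ext_mxM mulmxV ?unitmx_mul ?L_unit ?D_unit // ext_mx1 => /matrixP/(_ (ftop k) (ftop k)).
by rewrite !mxE eqxx => /eqP; rewrite oner_eq0.
Qed.

Lemma embedded_col (k : 'I_n.-1) a c :
  v k = a *: (ext_mx k.+1 L *m ext_mx k.+1 (diag_mx D) *m ext_mx k.+1 U) ->
  v k c (ftop k) = a * (ext_mx k.+1 L c (ftop k) * Dtop k).
Proof.
move=> ->; rewrite mxE; congr (_ * _); rewrite mxE (bigD1 (ftop k)) //= big1 ?addr0; last first.
  by move=> b /negPf bt; rewrite ext_trig_topT ?bt ?mulr0n ?mulr0 //; case: uU.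
rewrite ext_trig_topT ?eqxx ?mulr1n; last by case: uU.
rewrite [X in _ * X]big1 ?mulr1; last by move=> i _; case: uU => _ /(_ (widen_ord (ext_deg_le k) i)); rewrite mxE.
rewrite mxE (bigD1 (ftop k)) //= big1 ?addr0 => [|b /negPf bt]; last first.
  by rewrite ext_diag_mx bt mulr0n mulr0.
by rewrite ext_diag_mx eqxx mulr1n; congr (_ * _); apply: eq_bigr => i _; rewrite sb_top.
Qed.

Lemma embedded_row (k : 'I_n.-1) a c :
  v k = a *: (ext_mx k.+1 L *m ext_mx k.+1 (diag_mx D) *m ext_mx k.+1 U) ->
  v k (ftop k) c = a * (ext_mx k.+1 U (ftop k) c * Dtop k).
Proof.
move=> ->; rewrite mxE -mulmxA; congr (_ * _); rewrite mxE (bigD1 (ftop k)) //= big1 ?addr0; last first.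
  by move=> b /negPf bt; rewrite ext_trig_top ?bt ?mulr0n ?mul0r //; case: uL.
rewrite ext_trig_top ?eqxx ?mulr1n; last by case: uL.
rewrite [X in X * _]big1 ?mul1r; last by move=> i _; case: uL.
rewrite mxE (bigD1 (ftop k)) //= big1 ?addr0 => [|b bt]; last first.
  by rewrite ext_diag_mx eq_sym (negPf bt) mulr0n mul0r.
by rewrite ext_diag_mx eqxx mulr1n mulrC; congr (_ * _); apply: eq_bigr => i _; rewrite sb_top.
Qed.

Lemma embedded_lead (k : 'I_n.-1) a :
  v k = a *: (ext_mx k.+1 L *m ext_mx k.+1 (diag_mx D) *m ext_mx k.+1 U) ->
  lead k v = a * Dtop k.
Proof.
move=> /embedded_col E; rewrite /lead -/(ftop k) E ext_trig_top; last by case: uL.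
by rewrite eqxx mulr1n big1 ?mul1r // => i _; case: uL.
Qed.

Let in_deg (i j : 'I_n) : (j < i)%N -> (j < n.-1)%N.
Proof. by have := ltn_ord i; lia. Qed.

Lemma embedded_Lmat : Lmat v = L.
Proof.
have [tL dL] := uL; apply/matrixP => i j; rewrite mxE; case: eqP => [->|/eqP ne]; first by rewrite dL.
case: ltnP => ji; last by rewrite (is_trig_mxP tL) // ltn_neqAle ne.
have [a a0 va] := embedded_scale (Ordinal (in_deg ji)).
rewrite -[j : nat]/(nat_of_ord (Ordinal (in_deg ji))) ratioE.
rewrite (embedded_col _ va) (embedded_lead va) /fside ext_trig_fcol //=; last exact: ltnW.
rewrite mulrCA mulfK ?mulf_neq0 //; congr (L _ _); exact: val_inj.
Qed.

Lemma embedded_Umat : Umat v = U.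
Proof.
have [tU dU] := uU; apply/matrixP => i j; rewrite mxE; case: eqP => [->|/eqP ne].
  by have := dU j; rewrite mxE.
case: ltnP => ij; last first.
  by have /is_trig_mxP/(_ j i) := tU; rewrite mxE => -> //; rewrite ltn_neqAle eq_sym ne.
have [a a0 va] := embedded_scale (Ordinal (in_deg ij)).
rewrite -[i : nat]/(nat_of_ord (Ordinal (in_deg ij))) ratioE.
rewrite (embedded_row _ va) (embedded_lead va) /fside.
have -> : ext_mx (Ordinal (in_deg ij)).+1 U (ftop (Ordinal (in_deg ij))) (idx (ext_deg_le (Ordinal (in_deg ij))) (fcol (Ordinal (in_deg ij)) j)) = U i j.
  rewrite -[U in LHS]trmxK ext_mxT mxE ext_trig_fcol //=; last exact: ltnW.
  by rewrite mxE; congr (U _ _); exact: val_inj.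
by rewrite mulrCA mulfK ?mulf_neq0.
Qed.

(** The successive quotients of the diagonal entries of [D], so that [diag_mx D] is its first entry
    times [stddiag n t]. *)
Let t j := if (insub j.+1 : option 'I_n) is Some i then
  D 0 i / D 0 (insubd i j) else 1.

Lemma embedded_D : (0 < n)%N -> exists2 c, c != 0 & diag_mx D = c *: stddiag n t.
Proof.
move=> n0; exists (D 0 (Ordinal n0)) => //.
apply/matrixP => i j; rewrite !mxE mulrnAr; congr (_ *+ _).
case: i => i; elim: i => [|i IH] lti.
  by rewrite /partprod big_geq // mulr1; congr (D 0 _); exact: val_inj.
rewrite /partprod big_nat_recr //= -/(partprod t i) mulrA -(IH (ltnW lti)) /t insubT.
by rewrite mulrCA (_ : insubd _ i = Ordinal (ltnW lti)) ?mulfV ?mulr1 //; apply: val_inj; rewrite val_insubd ltnW.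
Qed.

Lemma embedded_Nmat (k : 'I_n.-1) : Nmat k v = stdmx n k.+1 t.
Proof.
have n0 : (0 < n)%N by have := ltn_ord k; lia.
have [a a0 va] := embedded_scale k.
have [c c0 Dc] := embedded_D n0.
have adjV (M : 'M[C]_n) : \det M = 1 -> \adj M *m M = 1%:M /\ M *m \adj M = 1%:M.
  by move=> dM; rewrite mul_adj_mx mul_mx_adj dM.
rewrite /Nmat embedded_Lmat embedded_Umat.
have -> : \matrix_(a, b) (v k a b / lead k v) = (lead k v)^-1 *: v k.
  by apply/matrixP => x y; rewrite !mxE mulrC.
rewrite va -!scalemxAr -!scalemxAl scalerA -!ext_mxM.
have [dL dU] : \det L = 1 /\ \det U = 1.
  by split; [exact: unitrig_det|rewrite -det_tr; exact: unitrig_det].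
rewrite !mulmxA (adjV _ dL).1 mul1mx -mulmxA (adjV _ dU).2 mulmx1.
rewrite (embedded_lead va) Dc ext_mxZ ext_stddiag !scalerA.
have Ed : Dtop k = c ^+ k.+1 * \prod_(i < k.+1) partprod t i.
  rewrite /Dtop -[X in c ^+ X]card_ord -prodr_const -big_split /=; apply: eq_bigr => i _.
  have /matrixP/(_ (widen_ord (ext_deg_le k) i) (widen_ord (ext_deg_le k) i)) := Dc.
  by rewrite !mxE eqxx !mulr1n.
rewrite -[RHS]scale1r; congr (_ *: _).
by rewrite -[_ * _ * \prod_(i < _) _]mulrA -Ed -mulrA mulVf // mulf_neq0.
Qed.

Lemma embedded_tpar (k : 'I_n.-1) : tpar v k = t k.
Proof. by rewrite /tpar valK embedded_Nmat /fside stdmx_fcol. Qed.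

Lemma embedded_stdmx (k : 'I_n.-1) : Nmat k v = stdmx n k.+1 (tpar v).
Proof.
rewrite embedded_Nmat; apply: eq_stdmx => j jn.
by rewrite -[j]/(nat_of_ord (Ordinal jn)) embedded_tpar.
Qed.

End OnEmbedded.

(** The chart condition covers the leading minors of sizes 1 to n - 1; those of sizes 0 and n are 1
    and the determinant. *)
Lemma embedded_LDU sym A v : matset sym A -> is_rep (ext_lines A) v -> in_chart v ->
  exists (L : 'M[C]_n) (D : 'rV[C]_n) (U : 'M[C]_n),
  [/\ unitrig L, unitrig U^T, forall i, D 0 i != 0 & A = L *m diag_mx D *m U].
Proof.
move=> [uA _] rv cv; apply: LDU => k kn.
have [e|kn'] := eqVneq k n.
  subst k; rewrite mxE (_ : mxsub _ _ A = A) -?unitfE -?unitmxE //.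
  by apply/matrixP => i j; rewrite !mxE !sb_top; congr (A _ _); exact: val_inj.
case: k kn kn' => [|k] kn kn'; first by rewrite mxE det_mx00 oner_eq0.
have kn1 : (k < n.-1)%N by move: kn kn'; lia.
have := cv (Ordinal kn1); rewrite /lead => l0.
have [|a a0 E] := vline_scale _ (rv (Ordinal kn1)).
  by apply: contraNneq l0 => ->; rewrite mxE.
have /matrixP/(_ (top kn) (top kn)) := E; rewrite ext_powE /= => ->; rewrite mxE mulf_neq0 //.
by rewrite (bool_irrelevance kn (ext_deg_le (Ordinal kn1))).
Qed.

(** Both claims are equalities of regular functions. On embedded matrices they follow from the LDU
    decomposition and from the symmetry of minors, and [chart_vanish] carries them to the
    closure. *)
Lemma chart_point sym x v : zariski_closure (embset sym) x -> is_rep x v -> in_chart v ->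
  x = lr_act (Lmat v) (Umat v) (stdpt (tpar v)) /\ (sym -> Umat v = (Lmat v)^T).
Proof.
move=> cx xv cv; split; last first.
  move=> s; apply/matrixP => i j; rewrite !mxE eq_sym; case: eqP => // _; case: ifP => // _.
  rewrite /ratio; case: insub => // k; congr (_ / _).
  apply/eqP; rewrite -subr_eq0; apply/eqP.
  have lk := cv k; apply: (mulIf (invr_neq0 lk)); rewrite mul0r mulrBl.
  apply: (chart_vanish (f := fun v => v k (ftop k) (fside j k) / lead k v - v k (fside j k) (ftop k) / lead k v) _ _ cx xv cv).
    apply: chartregD; first exact: chartreg_coord.
    by apply: (eq_chartreg _ (chartregZ (-1) (chartreg_coord (fside j k) (ftop k)))) => w _; rewrite mulN1r.
  move=> A w [_ sA] Aw _; rewrite -mulrBl.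
  have [c c0 ->] : exists2 c, c != 0 & w k = c *: ext_mx k.+1 A.
    have [z|z] := eqVneq (ext_mx k.+1 A) 0; last exact: vline_scale (esym (Aw k)).
    exists 1; rewrite ?oner_eq0 // z scaler0; have := memv_line (w k).
    by rewrite -(Aw k) /ext_lines ext_powE z => /vlineP[c ->]; rewrite scaler0.
  have -> : ext_mx k.+1 A = (ext_mx k.+1 A)^T by rewrite -ext_mxT sA.
  by rewrite !mxE -{1}[mxsub _ _ A]trmxK trmx_mxsub det_tr sA // subrr mul0r.
apply: functional_extensionality_dep => k.
have NE : Nmat k v = stdmx n k.+1 (tpar v).
  apply/matrixP => a b; apply/eqP; rewrite -subr_eq0; apply/eqP.
  apply: (chart_vanish (f := fun v => Nmat k v a b - stdmx n k.+1 (tpar v) a b) _ _ cx xv cv).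
    apply: chartregD; first exact: chartreg_Nmat.
    by apply: (eq_chartreg _ (chartregZ (-1) (chartreg_stdmx a b))) => w _; rewrite mulN1r.
  move=> A w mA Aw cw; have [L [D [U [uL uU D0 AE]]]] := embedded_LDU mA Aw cw.
  by rewrite AE in Aw; rewrite (embedded_stdmx uL uU D0 Aw) subrr.
rewrite (lr_act_line _ _ (M := stdmx n k.+1 (tpar v))) // xv -NE /Nmat.
have [dL dU] : \det (Lmat v) = 1 /\ \det (Umat v) = 1.
  split; first exact: unitrig_det (unitrig_Lmat v).
  by rewrite -det_tr; exact: unitrig_det (unitrig_Umat v).
rewrite !mulmxA -ext_mxM mul_mx_adj dL ext_mx1 mul1mx -mulmxA -ext_mxM mul_adj_mx dU ext_mx1 mulmx1.
have -> : \matrix_(a, b) (v k a b / lead k v) = (lead k v)^-1 *: v k.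
  by apply/matrixP => a b; rewrite !mxE mulrC.
by rewrite vlineZ // invr_eq0.
Qed.

End Chart.

(** * Every point of the closure is a limit *)

Section MoveToChart.
Variables (C : numClosedFieldType) (n : nat).

(** For E = a + b pi, symmetric because pi is an involution, E E^T = (a^2 + b^2) + 2 a b pi. The
    choice a^2 = 1 / (2 i), b = i a makes the first coefficient 0 and the second 1. *)
Lemma perm_square_root (pi : 'S_n) : (forall k, pi (pi k) = k) ->
  exists E : 'M[C]_n, perm_mx pi = E *m E^T.
Proof.
move=> pi2; have pi1 : (pi * pi = 1)%g by apply/permP => k; rewrite permM perm1 pi2.
have piV : (pi^-1 = pi)%g by apply/eqP; rewrite eq_invg_mul pi1.
pose a : C := sqrtC (2 * 'i)^-1.
pose b := 'i * a.
have aa : a * a = (2 * 'i)^-1 by rewrite -expr2 sqrtCK.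
have i0 : 2 * 'i != 0 :> C by rewrite mulf_neq0 ?neq0Ci ?pnatr_eq0.
have h1 : a * a + b * b = 0.
  have -> : a * a + b * b = a ^+ 2 * (1 + 'i ^+ 2) by rewrite /b; ring.
  by rewrite sqrCi subrr mulr0.
have h2 : a * b + a * b = 1.
  have -> : a * b + a * b = a * a * (2 * 'i) by rewrite /b; ring.
  by rewrite aa mulVf.
exists (a%:M + b *: perm_mx pi).
rewrite linearD /= linearZ /= tr_scalar_mx tr_perm_mx piV.
rewrite mulmxDl !mulmxDr -!scalemxAl -!scalemxAr -perm_mxM pi1 perm_mx1.
rewrite !mul_scalar_mx mul_mx_scalar; apply/matrixP => i j.
move: (perm_mx pi) => M; rewrite !mxE; move: (M i j) => p.
transitivity ((a * b + a * b) * p + (a * a + b * b) *+ (i == j)); last first.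
  by case: (i == j); rewrite ?mulr1n ?mulr0n; ring.
by rewrite h1 h2 mul1r mul0rn addr0.
Qed.

(** Elimination is applied to the constant matrix. Invertibility at 0 forces all exponents to be
    zero, so [A] is congruent to S pi S with S diagonal, and pi is factored by
    [perm_square_root]. *)
Lemma sym_factor (A : 'M[C]_n) : A \in unitmx -> A^T = A -> exists E : 'M[C]_n, A = E *m E^T.
Proof.
move=> uA AT; have two : (2 : C) != 0 by rewrite pnatr_eq0.
have dA : \det (map_mx polyC A) != 0 by rewrite det_map_mx polyC_eq0 -unitfE -unitmxE.
have AT' : (map_mx polyC A)^T = map_mx polyC A.
  by rewrite -[in RHS]AT; apply/matrixP => i j; rewrite !mxE.
have [g [pi [v [Cm [tg gA CmT [pi2 _] Cm0]]]]] := elim_sym two dA AT'.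
have ug : ev 0 g \in unitmx by case/andP: tg.
have [s s0 CmE] := sym_monomial CmT pi2 Cm0.
have [E1 E1E] := perm_square_root pi2.
have gAE : ev 0 g *m A *m (ev 0 g)^T = ev 0 Cm.
  have := congr1 (@ev C 0 n n) gA; rewrite !evM ev_polyC.
  have -> : ev 0 g^T = (ev 0 g)^T by apply/matrixP => i j; rewrite !mxE.
  have -> : ev 0 (diag_mx (\row_k 'X^(v k))) = diag_mx (\row_k 0 ^+ v k) :> 'M[C]_n.
    by apply/matrixP => i j; rewrite !mxE /horner_eval hornerMn hornerXn.
  move=> e; have : diag_mx (\row_k 0 ^+ v k : 'rV[C]_n) \in unitmx.
    have : ev 0 g *m A *m (ev 0 g)^T \in unitmx by rewrite !unitmx_mul ug uA unitmx_tr.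
    by rewrite e unitmx_mul => /andP[].
  rewrite unitmxE unitfE det_diag => /prodf_neq0 v0; rewrite e.
  rewrite (_ : \row_k _ = const_mx 1) ?diag_const_mx ?mulmx1 //.
  apply/rowP => k; rewrite !mxE; have := v0 k isT; rewrite mxE !expr0n.
  by case: (v k == 0%N) => //; rewrite eqxx.
have XX : (diag_mx s *m E1) *m (diag_mx s *m E1)^T = ev 0 Cm.
  by rewrite trmx_mul tr_diag_mx CmE E1E !mulmxA.
exists (invmx (ev 0 g) *m (diag_mx s *m E1)).
rewrite [X in _ *m X]trmx_mul trmx_inv mulmxA -(mulmxA (invmx _)) XX -gAE.
by rewrite !mulmxA mulVmx // mul1mx mulmxK // unitmx_tr.
Qed.

(** Its first [k] rows are the unit vectors of the subset [s], so it moves the coordinate [s] to the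
    leading one. The other rows are zero and the matrix may be singular; invertibility is restored
    in [move_seq]. *)
Definition pickmx k (s : 'I_(ext_dim n k)) : 'M[C]_n :=
  \matrix_(i, j) (if insub (val i) is Some i' then sb s i' == j else false)%:R.

Lemma ext_pickmx k (kn : (k <= n)%N) (s c : 'I_(ext_dim n k)) :
  ext_mx k (pickmx s) (top kn) c = (c == s)%:R.
Proof.
have E i j : pickmx s (sb (top kn) i) j = (sb s i == j)%:R.
  by rewrite mxE sb_top /= valK.
have [->|ne] := eqVneq c s.
  rewrite mxE (_ : mxsub _ _ _ = 1%:M) ?det1 //; apply/matrixP => i j.
  by rewrite !mxE -[RHS]/((i == j)%:R) -(inj_eq (strict_incr_inj (sb_incr s))) -E mxE.
apply/eqP; apply: contraNT ne => /ext_mx_neq0[p Hp]; apply/eqP/esym/sb_inj.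
suff /(strict_incr_perm_eq (sb_incr s) (sb_incr c))[] : forall i, sb s i = sb c (p i) by [].
move=> i; apply/eqP; have := Hp i; rewrite E.
by case: (sb s i == sb c (p i)) => //; rewrite eqxx.
Qed.

Lemma pick_entry k (kn : (k <= n)%N) (s s' : 'I_(ext_dim n k)) (M : 'M[C]_(ext_dim n k)) :
  (ext_mx k (pickmx s) *m M *m ext_mx k (pickmx s')^T) (top kn) (top kn) = M s s'.
Proof.
rewrite ext_mxT mxE (bigD1 s') //= big1 ?addr0; last first.
  by move=> c /negPf cs; rewrite [X in _ * X]mxE ext_pickmx cs mulr0.
rewrite [X in _ * X]mxE ext_pickmx eqxx mulr1 mxE (bigD1 s) //= big1 ?addr0; last first.
  by move=> c /negPf cs; rewrite ext_pickmx cs mul0r.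
by rewrite ext_pickmx eqxx mul1r.
Qed.

Local Notation vecs := (forall k : 'I_n.-1, 'M[C]_(ext_dim n k.+1)).

Definition moved (P Q : 'M[C]_n) (v : vecs) : vecs :=
  fun k => ext_mx k.+1 P *m v k *m ext_mx k.+1 Q.

(* In the symmetric case, a linear form with coefficients the conjugates of the entries
   of [v k] is nonzero at [v k], hence at some [A = E E^T]; Cauchy-Binet then exhibits
   a nonzero value of [v k] on a decomposable vector. *)
Lemma move_one sym x v (k : 'I_n.-1) :
  zariski_closure (embset sym) x -> is_rep x v ->
  exists P Q, (sym -> Q = P^T) /\ lead k (moved P Q v) != 0.
Proof.
move=> cx xv; have v0 : v k != 0 by apply: rep_neq0 xv k; case: cx.
have [a [b vab]] : exists a b, v k a b != 0.
  apply: contra_notP (elimN eqP v0) => H; apply/matrixP => a b; rewrite mxE.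
  by apply/eqP; apply: contra_notT H => ?; exists a, b.
case: sym cx => cx; last first.
  exists (pickmx a), (pickmx b)^T; split=> //.
  by rewrite /lead /moved pick_entry.
pose l (w : vecs) := \sum_a \sum_b (v k a b)^* * w k a b.
have pl : polyfun (fun j => k == j : nat) l.
  apply: polyfun_sum => a' _; apply: polyfun_sum => b' _; apply: polyfunZ.
  exact: (@polyfun_coord C 'I_n.-1 (fun k => ext_dim n k.+1) k a' b').
have lv : l v != 0.
  rewrite gt_eqF // /l (bigD1 a) //= (bigD1 b) //= -addrA; apply: ltr_pwDl.
    by rewrite mulrC -normCK exprn_gt0 // normr_gt0.
  by rewrite addr_ge0 // sumr_ge0 // => *; rewrite ?sumr_ge0 // => *; rewrite mulrC -normCK exprn_ge0.
have [A [[uA sA] [w [Aw lw]]]] : exists A, matset true A /\ exists w, is_rep (ext_lines A) w /\ l w != 0.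
  apply: contra_notP (elimN eqP lv) => H; apply: (closure_polyfun cx pl _ xv).
  move=> y w [A mA <-] Aw; apply/eqP; apply: contra_notT H => lw.
  by exists A; split=> //; exists w.
have [E AE] := sym_factor uA (sA isT).
have [c wE] : exists c, w k = c *: ext_mx k.+1 A.
  have := memv_line (w k); rewrite -(Aw k) => /vlineP[c ->].
  by exists c.
(* The form at A = E E^T is a multiple of a trace, so one of the diagonal entries summed here is
   nonzero. *)
have lE : l w = c * \sum_s (ext_mx k.+1 E^T *m map_mx Num.conj (v k) *m ext_mx k.+1 E) s s.
  rewrite /l wE AE ext_mxM ext_mxT.
  transitivity (c * \tr ((map_mx Num.conj (v k))^T *m (ext_mx k.+1 E *m (ext_mx k.+1 E)^T))).
    rewrite /mxtrace exchange_big mulr_sumr /=; apply: eq_bigr => b' _.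
    rewrite [X in _ = _ * X]mxE mulr_sumr; apply: eq_bigr => a' _.
    by rewrite [X in _ * X = _]mxE [(map_mx _ _)^T _ _]mxE [map_mx _ _ _ _]mxE; ring.
  congr (_ * _); rewrite -[LHS]mxtrace_tr !trmx_mul !trmxK.
  by rewrite mxtrace_mulC !mulmxA mxtrace_mulC !mulmxA.
have [s Es] : exists s, (ext_mx k.+1 E^T *m map_mx Num.conj (v k) *m ext_mx k.+1 E) s s != 0.
  apply: contra_notP (elimN eqP lw) => H; rewrite lE big1 ?mulr0 // => s _.
  by apply/eqP; apply: contra_notT H => ?; exists s.
(* Conjugating the nonzero diagonal entry moves the conjugation from [v k] onto [E]. *)
pose E' := map_mx Num.conj E.
exists (pickmx s *m E'^T), (pickmx s *m E'^T)^T; split=> //.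
rewrite /lead /moved trmx_mul trmxK !ext_mxM -!mulmxA (mulmxA (v k)) (mulmxA (ext_mx _ E'^T)) mulmxA.
rewrite pick_entry; apply: contra_neq Es => z.
have := congr1 Num.conj z; rewrite rmorph0 => <-.
have cE (M : 'M[C]_(ext_dim n k.+1)) : Num.conj (M s s) = (map_mx Num.conj M) s s.
  by rewrite mxE.
have E'E : map_mx Num.conj E' = E by apply/matrixP => i j; rewrite !mxE conjCK.
have E'TE : map_mx Num.conj E'^T = E^T by apply/matrixP => i j; rewrite !mxE conjCK.
by rewrite cE !map_mxM !map_ext_mx E'E E'TE mulmxA.
Qed.

(** Join the matrices good for [r] to those good for [k] by a segment. Each condition is a
    polynomial in the parameter that is nonzero at one of the two ends, so some value satisfies all
    of them and keeps both matrices invertible. *)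
Lemma move_seq (sym : bool) (v : vecs) (r : seq 'I_n.-1) :
  (forall k, exists P Q, (sym -> Q = P^T) /\ lead k (moved P Q v) != 0) ->
  exists P Q, [/\ sym -> Q = P^T, P \in unitmx, Q \in unitmx &
    forall k, k \in r -> lead k (moved P Q v) != 0].
Proof.
move=> H; elim: r => [|k r [P1 [Q1 [s1 uP1 uQ1 H1]]]].
  by exists 1%:M, 1%:M; rewrite trmx1 unitmx1.
have [P2 [Q2 [s2 H2]]] := H k.
pose path (M N : 'M[C]_n) := map_mx polyC M + 'X *: map_mx polyC (N - M).
have ev_path c M N : ev c (path M N) = M + c *: (N - M).
  by apply/matrixP => i j; rewrite !mxE /horner_eval !hornerE.
have path0 M N : ev 0 (path M N) = M by rewrite ev_path scale0r addr0.
have path1 M N : ev 1 (path M N) = N by rewrite ev_path scale1r addrC subrK.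
pose phi (j : 'I_n.-1) := (ext_mx j.+1 (path P1 P2) *m map_mx polyC (v j) *m
   ext_mx j.+1 (path Q1 Q2)) (top (ext_deg_le j)) (top (ext_deg_le j)).
have phiE c j : (phi j).[c] = lead j (moved (ev c (path P1 P2)) (ev c (path Q1 Q2)) v).
  by rewrite /phi -[LHS]evE !evM !ev_ext ev_polyC.
have phi0 c j : (phi j).[c] != 0 -> phi j != 0.
  by apply: contra_neq => ->; rewrite horner0.
have det0 (M N : 'M[C]_n) : M \in unitmx -> \det (path M N) != 0.
  move=> uM; have : \det (ev 0 (path M N)) != 0 by rewrite path0 -unitfE -unitmxE.
  by rewrite det_ev; apply: contra_neq => ->; rewrite horner0.
have : phi k * \prod_(j <- r) phi j * \det (path P1 P2) * \det (path Q1 Q2) != 0.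
  rewrite !mulf_neq0 ?det0 //; first by apply: (@phi0 1); rewrite phiE !path1.
  rewrite prodf_seq_neq0; apply/allP => j jr; apply: (@phi0 0).
  by rewrite phiE !path0 H1.
move=> /closed_nonrootP[c]; rewrite /root !hornerM !mulf_eq0 !negb_or horner_prod.
move=> /andP[/andP[/andP[c1 c2] c3] c4].
exists (ev c (path P1 P2)), (ev c (path Q1 Q2)); split.
- by move=> s; rewrite !ev_path s1 // s2 //; apply/matrixP => i j; rewrite !mxE.
- by rewrite unitmxE unitfE det_ev.
- by rewrite unitmxE unitfE det_ev.
move=> j; rewrite inE -phiE => /orP[/eqP -> //|jr].
by move: c2; rewrite prodf_seq_neq0 => /allP/(_ j jr).
Qed.

Theorem closure_is_lim sym x : zariski_closure (embset sym) x ->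
  exists A : 'M[{poly C}]_n, [/\ sym -> A^T = A, \det A != 0 & is_lim A x].
Proof.
move=> cx; have [v xv _] := multiproj_rep (proj1 cx).
have [P [Q [s uP uQ H]]] := move_seq (enum 'I_n.-1) (fun k => move_one k cx xv).
have cx' := closure_lr_act uP uQ (fun y => embset_stable uP uQ s) cx.
have xv' : is_rep (lr_act P Q x) (moved P Q v) by move=> k; exact: lr_act_line.
have cv : in_chart (moved P Q v) by move=> k; apply: H; rewrite mem_enum.
have [] := chart_point cx' xv' cv; set L := Lmat _; set U := Umat _; set t := tpar _ => xE sU.
have uL : L \in unitmx by rewrite unitmxE unitrig_det ?unitr1 //; exact: unitrig_Lmat.
have uU : U \in unitmx.
  by rewrite -unitmx_tr unitmxE unitrig_det ?unitr1 //; exact: unitrig_Umat.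
(* A vanishing parameter is replaced by ['X] and the others stay constant: the determinant becomes
   nonzero and the value at 0 is still [t]. *)
pose c j := if t j == 0 then 1 else t j.
pose e j : nat := t j == 0.
have c0 j : c j != 0 by rewrite /c; case: (eqVneq (t j) 0) => // _; rewrite oner_eq0.
have := @is_lim_stddiag n C c e c0.
rewrite (_ : (fun j => c j * _) = t); last first.
  apply: funext => j; rewrite /c /e; case: (eqVneq (t j) 0) => [->|_]; last by rewrite mulr1.
  by rewrite mulr0.
have evC (M : 'M[C]_n) : ev 0 (map_mx polyC M) = M by exact: ev_polyC.
move=> /(is_lim_act (g := map_mx polyC (invmx P *m L)) (h := map_mx polyC (U *m invmx Q))).
rewrite !evC !unitmx_mul !unitmx_inv uP uQ uL uU => /(_ isT isT).
rewrite -lr_act_comp -xE lr_actK // => lx.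
eexists; split; last exact: lx.
  move=> sy; rewrite [LHS]trmx_mul [X in _ *m X]trmx_mul tr_diag_mx mulmxA.
  have trC (M : 'M[C]_n) : (map_mx polyC M)^T = map_mx polyC M^T.
    by apply/matrixP => i j; rewrite !mxE.
  have E : (invmx P *m L)^T = U *m invmx Q by rewrite s // sU // trmx_mul trmx_inv.
  by rewrite !trC E -E trmxK.
have dC (M : 'M[C]_n) : M \in unitmx -> \det (map_mx polyC M) != 0.
  by move=> uM; rewrite det_map_mx polyC_eq0 -unitfE -unitmxE.
rewrite !det_mulmx !mulf_neq0 ?dC ?unitmx_mul ?unitmx_inv ?uP ?uQ ?uL ?uU //.
rewrite det_diag; apply/prodf_neq0 => i _; rewrite mxE /partprod.
rewrite prodf_seq_neq0; apply/allP => j _ /=.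
by rewrite scaler_eq0 negb_or c0 -size_poly_eq0 size_polyXn.
Qed.

End MoveToChart.

(** * Borel orbits *)

Section Counting.
Local Open Scope classical_set_scope.
Local Open Scope card_scope.

Lemma card_finType (T : finType) : [set: T] #= `I_#|T|.
Proof.
rewrite (card_eqr card_II); rewrite card_eq_sym.
have -> : [set: T] = enum_val @` [set: 'I_#|T|].
  by rewrite eqEsubset; split=> // x _; exists (enum_rank x) => //; rewrite enum_rankK.
by rewrite card_eq_sym; apply: inj_card_eq => i j _ _; exact: enum_val_inj.
Qed.

Variables (G X : Type) (B : set G) (act : G -> X -> X) (Y : set X).

Lemma orbit_count_exists (T : finType) (rep : T -> X) :
  (forall x, Y x -> exists t, orbit_of B act x = orbit_of B act (rep t)) ->
  exists2 N, orbit_count B act Y N & (N <= #|T|)%N.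
Proof.
move=> H; pose O := [set orbit_of B act x | x in Y].
have OT : O #<= [set: T].
  apply: card_le_trans (card_image_le (fun t => orbit_of B act (rep t)) setT).
  by apply: subset_card_le => _ [x Yx <-]; have [t ->] := H x Yx; exists t.
have /finite_setP[N ON] : finite_set O by apply: card_le_finite OT finite_finset.
exists N => //; rewrite -card_le_II -(card_le_eql ON) -(card_le_eqr (card_finType T)).
exact: OT.
Qed.

Lemma orbit_count_ge (T : finType) (rep : T -> X) N : (forall t, Y (rep t)) ->
  (forall s t, orbit_of B act (rep s) = orbit_of B act (rep t) -> s = t) ->
  orbit_count B act Y N -> (#|T| <= N)%N.
Proof.
move=> Yr inj cN; rewrite -card_le_II -(card_le_eqr cN) -(card_le_eql (card_finType T)).
have h : [set: T] #= (fun t => orbit_of B act (rep t)) @` [set: T].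
  by rewrite card_eq_sym; apply: inj_card_eq => s t _ _; exact: inj.
rewrite (card_le_eql h); apply: subset_card_le => _ [t _ <-].
by exists (rep t).
Qed.

End Counting.

(** * Borel orbits as equivalence relations *)

Section Orbits.
Variables (C : numClosedFieldType) (n : nat).
Hypothesis n_gt0 : (0 < n)%N.
Local Open Scope classical_set_scope.
Implicit Types x y z : flines C n.

(** [P] plays the role of the inverse of [g^T]. No condition on its determinant is imposed: scalars
    act trivially on lines, and an n-th root brings [P] back to determinant 1. *)
Definition quadric_rel x y := exists2 P : 'M[C]_n, trigu P & y = lr_act P P^T x.

Definition group_rel x y := exists P Q : 'M[C]_n, [/\ trigu P^T, trigu Q^T & y = lr_act P Q x].

Lemma normalize_det (P : 'M[C]_n) : P \in unitmx ->
  exists2 c, c != 0 & \det (c *: P) = 1.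
Proof.
rewrite unitmxE unitfE => dP; have [c cE] := exists_root (\det P) n_gt0.
have c0 : c != 0 by apply: contra_neq dP => c0; rewrite -cE c0 expr0n gtn_eqF.
by exists c^-1; rewrite ?invr_eq0 // detZ exprVn cE mulVf.
Qed.

Lemma triguZ (c : C) (P : 'M[C]_n) : c != 0 -> trigu P -> trigu (c *: P).
Proof.
move=> c0 /triguP[/is_trig_mxP tP dP]; apply/triguP; split=> [|i].
  by apply/is_trig_mxP => i j ij; rewrite mxE tP ?mulr0.
by rewrite mxE mulf_neq0.
Qed.

Lemma quadric_orbitE x : orbit_of (@borel C n) (@quadric_act C n) x = [set y | quadric_rel x y].
Proof.
rewrite eqEsubset; split=> [_ [g [Sg tg] <-]|y [P tP ->]].
  have ug := SL_unit Sg; exists (invmx g^T); last by rewrite /quadric_act trmx_inv trmxK.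
  by apply: trigu_inv; rewrite /trigu tg unitmx_tr.
have [c c0 dP] := normalize_det (proj2 (andP tP)).
have tP' := triguZ c0 tP; have uP' : c *: P \in unitmx by case/andP: tP'.
exists (invmx (c *: P))^T.
  split; first by rewrite /SL /= det_tr det_inv dP invr1.
  by rewrite trmxK; case/andP: (trigu_inv tP').
rewrite /quadric_act trmxK -trmx_inv !invmxK.
have -> : (c *: P)^T = c *: P^T by apply/matrixP => i j; rewrite !mxE.
exact: lr_actZ.
Qed.

Lemma group_orbitE x :
  orbit_of (@borel C n `*` @borel C n) (@group_act C n) x = [set y | group_rel x y].
Proof.
rewrite eqEsubset; split=> [_ [[g h] [[Sg tg] [Sh th]] <-]|y [P [Q [tP tQ ->]]]].
  exists g, (invmx h); split=> //; first by rewrite /trigu tg unitmx_tr SL_unit.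
  by rewrite trmx_inv trigu_inv // /trigu th unitmx_tr SL_unit.
have uP : P \in unitmx by rewrite -unitmx_tr; case/andP: tP.
have uQ : Q \in unitmx by rewrite -unitmx_tr; case/andP: tQ.
have [c c0 dP] := normalize_det uP; have [d d0 dQ] := normalize_det uQ.
have trZ (a : C) (M : 'M[C]_n) : (a *: M)^T = a *: M^T by apply/matrixP => i j; rewrite !mxE.
exists (c *: P, invmx (d *: Q)); last by rewrite /group_act /= invmxK lr_actZ.
split; split=> /=.
- exact: dP.
- by rewrite trZ; case/andP: (triguZ c0 tP).
- by rewrite /SL /= det_inv dQ invr1.
- by rewrite trmx_inv trZ; case/andP: (trigu_inv (triguZ d0 tQ)).
Qed.

Lemma quadric_rel_refl x : quadric_rel x x.
Proof. by exists 1%:M; rewrite ?trigu1 // trmx1 lr_act1. Qed.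

Lemma quadric_rel_sym x y : quadric_rel x y -> quadric_rel y x.
Proof.
move=> [P tP ->]; exists (invmx P); first exact: trigu_inv.
by case/andP: tP => _ uP; rewrite trmx_inv lr_actK // unitmx_tr.
Qed.

Lemma quadric_rel_trans x y z : quadric_rel x y -> quadric_rel y z -> quadric_rel x z.
Proof.
move=> [P tP ->] [Q tQ ->]; exists (Q *m P); first exact: triguM.
by rewrite lr_act_comp trmx_mul.
Qed.

Lemma group_rel_refl x : group_rel x x.
Proof. by exists 1%:M, 1%:M; rewrite trmx1 trigu1 lr_act1. Qed.

Lemma group_rel_sym x y : group_rel x y -> group_rel y x.
Proof.
move=> [P [Q [tP tQ ->]]]; exists (invmx P), (invmx Q).
rewrite !trmx_inv !trigu_inv // lr_actK //; rewrite -unitmx_tr.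
  by case/andP: tP.
by case/andP: tQ.
Qed.

Lemma group_rel_trans x y z : group_rel x y -> group_rel y z -> group_rel x z.
Proof.
move=> [P [Q [tP tQ ->]]] [P' [Q' [tP' tQ' ->]]]; exists (P' *m P), (Q *m Q').
by rewrite !trmx_mul !triguM // lr_act_comp.
Qed.

Lemma quadric_orbit_eq x y :
  orbit_of (@borel C n) (@quadric_act C n) x = orbit_of (@borel C n) (@quadric_act C n) y <-> quadric_rel x y.
Proof.
rewrite !quadric_orbitE; split=> [e|xy].
  have : [set z | quadric_rel y z] y by exact: quadric_rel_refl.
  by rewrite -e.
rewrite eqEsubset; split=> z /= h; first exact: quadric_rel_trans (quadric_rel_sym xy) h.
exact: quadric_rel_trans xy h.
Qed.

Lemma group_orbit_eq x y :
  orbit_of (@borel C n `*` @borel C n) (@group_act C n) x =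
  orbit_of (@borel C n `*` @borel C n) (@group_act C n) y <-> group_rel x y.
Proof.
rewrite !group_orbitE; split=> [e|xy].
  have : [set z | group_rel y z] y by exact: group_rel_refl.
  by rewrite -e.
rewrite eqEsubset; split=> z /= h; first exact: group_rel_trans (group_rel_sym xy) h.
exact: group_rel_trans xy h.
Qed.

End Orbits.

(** * Exterior indices as sets *)

Section SubsetIndices.
Variable n : nat.

Definition sset k (a : 'I_(ext_dim n k)) : {set 'I_n} := [set sb a i | i in 'I_k]%SET.

Lemma card_sset k (a : 'I_(ext_dim n k)) : #|sset a| = k.
Proof. by rewrite card_imset ?card_ord //; exact: strict_incr_inj (sb_incr a). Qed.

Lemma sset_inj k : injective (@sset k).
Proof.
move=> a b e; have H i : exists j, sb a i = sb b j.
  have : sb a i \in sset b by rewrite -e imset_f.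
  by case/imsetP => j _ ->; exists j.
have [s Hs] := choice H.
by apply: sb_inj; case: (strict_incr_perm_eq (sb_incr a) (sb_incr b) Hs).
Qed.

Lemma sset_surj k (S : {set 'I_n}) : #|S| = k -> exists a, @sset k a = S.
Proof.
move=> e; pose g (i : 'I_k) := enum_val (cast_ord (esym e) i).
have gi : injective g by move=> i j /enum_val_inj/cast_ord_inj.
have [f [s gs]] := inj_strict_incr gi.
have sE : sb (enum_rank f) = val f by rewrite /sb /ksub_of_ord enum_rankK.
exists (enum_rank f); apply/eqP; rewrite eqEcard card_sset e leqnn andbT.
apply/fintype.subsetP => _ /imsetP[i _ ->]; rewrite sE.
have := gs (s^-1 i)%g; rewrite permKV => <-; exact: enum_valP.
Qed.

Lemma weight_sset k (a : 'I_(ext_dim n k)) : weight (sb a) = (\sum_(z in sset a) z)%N.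
Proof. by rewrite big_imset //= => i j _ _; exact: strict_incr_inj (sb_incr a) _ _. Qed.

Lemma sset_top k (kn : (k <= n)%N) : sset (top kn) = [set z : 'I_n | (z < k)%N]%SET.
Proof.
apply/setP => z; rewrite inE; apply/imsetP/idP => [[i _ ->]|zk]; first by rewrite sb_top /=.
by exists (Ordinal zk) => //; rewrite sb_top; exact: val_inj.
Qed.

Lemma sset_fcol k (kn : (k < n)%N) (i : 'I_n) : (k <= i)%N ->
  sset (idx kn (fcol k i)) = [set z : 'I_n | (z < k)%N || (z == i)]%SET.
Proof.
move=> ki; apply/setP => z; rewrite inE.
have E a : sb (idx kn (fcol k i)) a = fcol k i a by rewrite sb_idx ?fcol_incr.
apply/imsetP/idP => [[a _ ->]|/orP[zk|/eqP ->]].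
- rewrite E fcolE //; case: ifP => [-> //|ak]; apply/orP; right; apply/eqP/val_inj.
  by rewrite /= fcolE // ak.
- exists (Ordinal (leqW zk)) => //; apply: val_inj; rewrite /= E fcolE //=.
  by rewrite zk.
exists ord_max => //; apply: val_inj; rewrite /= E fcolE //=.
by rewrite ltnn.
Qed.

Lemma imset_permE (U : 'S_n) (A B : {set 'I_n}) :
  (U @: A == B) = (A == [set x | U x \in B]%SET).
Proof.
apply/eqP/eqP => [<-|->]; apply/setP => x.
  by rewrite inE mem_imset //; exact: perm_inj.
apply/imsetP/idP => [[y]|xB]; first by rewrite inE => yB ->.
by exists (U^-1 x)%g; rewrite ?inE permKV.
Qed.

Lemma sset_preim k (U : 'S_n) (c : 'I_(ext_dim n k)) : exists a : 'I_(ext_dim n k), U @: sset a = sset c.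
Proof.
have [|a ea] := @sset_surj k ((U^-1)%g @: sset c).
  by rewrite card_imset ?card_sset //; exact: perm_inj.
exists a; rewrite ea -imset_comp -[RHS]imset_id; apply: eq_imset => z /=.
by rewrite permKV.
Qed.

End SubsetIndices.

(** * Supports of the exterior powers of the representatives *)

Section Supports.
Variables (C : numClosedFieldType) (n : nat).

(** A nonzero entry forces the image of the row subset to be the column subset; conversely a row of
    an invertible matrix has some nonzero entry, which can only be this one. *)
Lemma ext_perm_neq0 k (U : 'S_n) (a c : 'I_(ext_dim n k)) :
  (ext_mx k (perm_mx U : 'M[C]_n) a c != 0) = (U @: sset a == sset c).
Proof.
have H d : ext_mx k (perm_mx U : 'M[C]_n) a d != 0 -> U @: sset a = sset d.
  move=> /ext_mx_neq0[s Hs]; apply/eqP; rewrite eqEcard !card_sset card_imset ?card_sset ?leqnn ?andbT; last exact: perm_inj.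
  apply/fintype.subsetP => _ /imsetP[_ /imsetP[i _ ->] ->]; have := Hs i.
  rewrite !mxE; case: (eqVneq (U (sb a i)) (sb d (s i))) => [-> _|_]; last by rewrite eqxx.
  exact: imset_f.
apply/idP/eqP => [/H //|e].
have uU : (perm_mx U : 'M[C]_n) \in unitmx by exact: unitmx_perm.
have [d Hd] : exists d, ext_mx k (perm_mx U : 'M[C]_n) a d != 0.
  have /matrixP/(_ a a) := ext_mx_unit k uU; rewrite mxE [RHS]mxE eqxx => s1.
  apply/not_existsP => Hn; have := oner_neq0 C; rewrite -[1]/(1%:R) -s1 big1 ?eqxx // => d _.
  by have /negP := Hn d; rewrite negbK => /eqP ->; rewrite mul0r.
by have := H d Hd; rewrite e => /sset_inj ->.
Qed.

Definition lineM (d : nat -> bool) (U W : 'S_n) k : 'M[C]_(ext_dim n k) :=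
  ext_mx k (perm_mx U) *m stdmx n k (fun j => (d j)%:R) *m ext_mx k (perm_mx W^-1%g).

Definition reppt d (U W : 'S_n) : flines C n :=
  lr_act (perm_mx U) (perm_mx W^-1%g) (@dpt C n d).

Lemma reppt_line d U W (k : 'I_n.-1) : reppt d U W k = <[lineM d U W k.+1]>%VS.
Proof. exact: lr_act_line. Qed.

(** A row subset has only one image under [U], so at most one [c] contributes and nothing
    cancels. *)
Lemma lineM_neq0 d U W k (a b : 'I_(ext_dim n k)) : (lineM d U W k a b != 0) <->
  exists c, [/\ stdmx n k (fun j => (d j)%:R : C) c c != 0, U @: sset a = sset c & W @: sset b = sset c].
Proof.
have E : lineM d U W k a b = \sum_c ext_mx k (perm_mx U : 'M[C]_n) a c *
    stdmx n k (fun j => (d j)%:R) c c * ext_mx k (perm_mx W : 'M[C]_n) b c.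
  rewrite /lineM mxE; apply: eq_bigr => c _; rewrite -tr_perm_mx ext_mxT [X in _ * X]mxE.
  congr (_ * _); rewrite mul_mx_diag mxE; congr (_ * _).
  by rewrite !mxE eqxx.
split=> [|[c [t0 Ua Wb]]].
  rewrite E => H; have [c Hc] : exists c, ext_mx k (perm_mx U : 'M[C]_n) a c *
    stdmx n k (fun j => (d j)%:R) c c * ext_mx k (perm_mx W : 'M[C]_n) b c != 0.
    apply: contra_notP (elimN eqP H) => Hn; rewrite big1 // => c _.
    by apply/eqP; apply: contra_notT Hn => ?; exists c.
  move: Hc; rewrite !mulf_eq0 !negb_or !ext_perm_neq0 => /andP[/andP[/eqP ? ?] /eqP ?].
  by exists c.
rewrite E (bigD1 c) //= big1 ?addr0; last first.
  move=> c' c'c; apply/eqP; rewrite !mulf_eq0; apply/orP; left; apply/orP; left.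
  apply: contraNT c'c; rewrite ext_perm_neq0 Ua => /eqP/sset_inj -> //.
by rewrite !mulf_neq0 ?ext_perm_neq0 ?Ua ?Wb.
Qed.

(** No two consecutive links, i.e. all blocks have size 1 or 2. *)
Definition sparse (d : nat -> bool) := forall j, d j -> ~~ d j.+1.

(** The entry at [c] is nonzero only if [d] holds on every interval from [i] to [sb c i]. Sparseness
    limits each shift to one step, and a shifted position before the last would push its successor
    across two consecutive links. *)
Lemma stdmx_support d (k : nat) (kn : (k.+1 < n)%N) (c : 'I_(ext_dim n k.+1)) : sparse d ->
  (stdmx n k.+1 (fun j => (d j)%:R : C) c c != 0) =
  (c == top (ltnW kn)) || d k && (c == idx (ltnW kn) (fcol k (Ordinal kn))).
Proof.
move=> sd; apply/idP/orP => [|[/eqP ->|/andP[dk /eqP ->]]]; last first.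
- by rewrite stdmx_fcol dk oner_eq0.
- by rewrite stdmx_top oner_eq0.
rewrite !mxE eqxx mulr1n => /prodf_neq0 H.
have D (i : 'I_k.+1) j : (i <= j < sb c i)%N -> d j.
  move=> ij; have := H i isT; rewrite prodf_seq_neq0 => /allP/(_ j).
  rewrite mem_index_iota ij => /(_ isT) /=.
  by case: (d j) => //; rewrite eqxx.
have ge (i : 'I_k.+1) : (i <= sb c i)%N by exact: strict_incr_ge (sb_incr c).
have le (i : 'I_k.+1) : (sb c i <= i.+1)%N.
  rewrite leqNgt; apply/negP => lt.
  have di : d i by apply: (D i); rewrite leqnn (ltn_trans _ lt).
  by have := sd i di; rewrite (D i i.+1) // leqnSn lt.
have eq (i : 'I_k.+1) : (i < k)%N -> sb c i = i :> nat.
  move=> ik; apply/eqP; rewrite eqn_leq ge andbT leqNgt; apply/negP => lt.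
  pose i' : 'I_k.+1 := Ordinal (ik : (i.+1 < k.+1)%N).
  have lt' : (i.+1 < sb c i')%N.
    by apply: leq_ltn_trans lt _; apply: (strict_incrP _ (sb_incr c)) => /=.
  have di : d i by apply: (D i); rewrite leqnn.
  by have := sd i di; rewrite (D i' i.+1) //= leqnn.
have [last0|last1] : sb c ord_max = k :> nat \/ sb c ord_max = k.+1 :> nat.
- by have := ge ord_max; have := le ord_max; rewrite /=; lia.
- left; apply/eqP/sb_inj/ffunP => i; apply: val_inj; rewrite sb_top /=.
  have := ltn_ord i; rewrite ltnS leq_eqVlt => /orP[/eqP ik|/eq //].
  by rewrite (_ : i = ord_max) ?last0 //; exact: val_inj.
right; rewrite (D ord_max) /= ?last1 ?leqnn //; apply/eqP/sb_inj.
rewrite sb_idx; last by apply: fcol_incr => /=.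
apply/ffunP => i; apply: val_inj; rewrite /= fcolE //=; case: ifP => [/eq //|ik].
by rewrite (_ : i = ord_max) ?last1 //; apply: val_inj => /=; have := ltn_ord i; lia.
Qed.

(** [loS] and [hiS] are the preimages of the two possible supporting subsets, {0, ..., k} and {0,
    ..., k - 1, k + 1}. *)
Definition loS (U : 'S_n) k : {set 'I_n} := [set x | (U x <= k)%N]%SET.
Definition hiS (U : 'S_n) k : {set 'I_n} := [set x | (U x < k)%N || (U x == k.+1 :> nat)]%SET.

Lemma lineM_support d U W (k : nat) (kn : (k.+1 < n)%N) (a b : 'I_(ext_dim n k.+1)) : sparse d ->
  (lineM d U W k.+1 a b != 0) <->
  (sset a = loS U k /\ sset b = loS W k) \/ [/\ d k, sset a = hiS U k & sset b = hiS W k].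
Proof.
move=> sd.
have lo (V : 'S_n) e : (V @: sset e == sset (top (ltnW kn))) = (sset e == loS V k).
  by rewrite imset_permE; congr (_ == _); apply/setP => x; rewrite sset_top !inE ltnS.
have hi (V : 'S_n) e : (V @: sset e == sset (idx (ltnW kn) (fcol k (Ordinal kn)))) = (sset e == hiS V k).
  rewrite imset_permE; congr (_ == _); apply/setP => x.
  by rewrite (@sset_fcol n k (ltnW kn)) ?inE //=.
rewrite lineM_neq0; split=> [[c]|].
  rewrite (stdmx_support kn) // => -[/orP[/eqP ->|/andP[dk /eqP ->]] /eqP Ua /eqP Wb].
    by left; move: Ua Wb; rewrite !lo => /eqP -> /eqP ->.
  by right; move: Ua Wb; rewrite !hi => /eqP -> /eqP ->.
move=> [[ea eb]|[dk ea eb]].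
  exists (top (ltnW kn)); rewrite (stdmx_support kn) // eqxx; split=> //; apply/eqP; rewrite lo ?ea ?eb //.
exists (idx (ltnW kn) (fcol k (Ordinal kn))); rewrite (stdmx_support kn) // dk eqxx orbT.
by split=> //; apply/eqP; rewrite hi ?ea ?eb.
Qed.

Lemma loS_ex U k : (k < n)%N -> exists a : 'I_(ext_dim n k.+1), sset a = loS U k.
Proof.
move=> kn; have [a /eqP e] := sset_preim U (top (kn : (k.+1 <= n)%N)); exists a.
move: e; rewrite imset_permE => /eqP ->; apply/setP => x.
by rewrite sset_top !inE ltnS.
Qed.

Lemma hiS_ex U k : (k.+1 < n)%N -> exists a : 'I_(ext_dim n k.+1), sset a = hiS U k.
Proof.
move=> kn; have [a /eqP e] := sset_preim U (idx (ltnW kn) (fcol k (Ordinal kn))); exists a.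
move: e; rewrite imset_permE => /eqP ->; apply/setP => x.
by rewrite (@sset_fcol n k (ltnW kn)) ?inE //=.
Qed.

Lemma lo_neq_hi U k : (k.+1 < n)%N -> loS U k <> hiS U k.
Proof.
move=> kn /setP/(_ ((U^-1)%g (Ordinal kn))); rewrite !inE permKV /= eqxx orbT.
by rewrite ltnn.
Qed.

End Supports.

(** * Separation of orbits by supports *)

Section Injectivity.
Variables (C : numClosedFieldType) (n : nat).
Implicit Types (d : nat -> bool) (U W : 'S_n) (x y : flines C n).

Lemma rel_entry (P Q : 'M[C]_n) x (k : 'I_n.-1) M M' a' b' :
  x k = <[M]>%VS -> lr_act P Q x k = <[M']>%VS -> M' a' b' != 0 ->
  exists a b, [/\ M a b != 0, ext_mx k.+1 P a' a != 0 & ext_mx k.+1 Q b b' != 0].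
Proof.
move=> xk yk M0; have := memv_line M'; rewrite -yk (lr_act_line _ _ xk) => /vlineP[c M'E].
move: M0; rewrite M'E mxE mulf_eq0 negb_or => /andP[_]; rewrite mxE => H.
have [b Hb] : exists b, (ext_mx k.+1 P *m M) a' b * ext_mx k.+1 Q b b' != 0.
  apply: contra_notP (elimN eqP H) => Hn; rewrite big1 // => b _.
  by apply/eqP; apply: contra_notT Hn => ?; exists b.
move: Hb; rewrite mulf_eq0 negb_or [_ a' b]mxE => /andP[H' Qb].
have [a Ha] : exists a, ext_mx k.+1 P a' a * M a b != 0.
  apply: contra_notP (elimN eqP H') => Hn; rewrite big1 // => a _.
  by apply/eqP; apply: contra_notT Hn => ?; exists a.
by move: Ha; rewrite mulf_eq0 negb_or => /andP[Pa Mab]; exists a, b.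
Qed.

Definition wle k (a b : 'I_(ext_dim n k)) := a = b \/ (weight (sb a) < weight (sb b))%N.

Lemma wle_anti k (a b : 'I_(ext_dim n k)) : wle a b -> wle b a -> a = b.
Proof. by move=> [//|ab] [//|ba]; move: (ltn_trans ab ba); rewrite ltnn. Qed.

(** Lower triangular congruences spread the support only towards larger weight, in rows and columns
    alike. *)
Lemma quadric_rel_entry x y (k : 'I_n.-1) M M' a' b' : quadric_rel x y ->
  x k = <[M]>%VS -> y k = <[M']>%VS -> M' a' b' != 0 ->
  exists a b, [/\ M a b != 0, wle a a' & wle b b'].
Proof.
move=> [P /andP[tP _] ->] xk yk /(rel_entry xk yk)[a [b [Mab Pa Pb]]]; exists a, b; split=> //.
  by case: (ext_mx_trig tP Pa) => [->|]; [left|right].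
by move: Pb; rewrite ext_mxT mxE => /(ext_mx_trig tP)[->|]; [left|right].
Qed.

Lemma group_rel_entry x y (k : 'I_n.-1) M M' a' b' : group_rel x y ->
  x k = <[M]>%VS -> y k = <[M']>%VS -> M' a' b' != 0 ->
  exists a b, [/\ M a b != 0, wle a' a & wle b b'].
Proof.
move=> [P [Q [/andP[tP _] /andP[tQ _] ->]]] xk yk /(rel_entry xk yk)[a [b [Mab Pa Qb]]].
exists a, b; split=> //.
  move: Pa; rewrite -[P]trmxK ext_mxT mxE => /(ext_mx_trig tP)[->|]; [by left|by right].
by move: Qb; rewrite -[Q]trmxK ext_mxT mxE => /(ext_mx_trig tQ)[->|]; [left|right].
Qed.

Lemma loS_all_inj U U' : (forall k, (k < n.-1)%N -> loS U k = loS U' k) -> U = U'.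
Proof.
move=> H; apply/permP => x; apply/val_inj => /=.
have E k : (k < n.-1)%N -> (U x <= k)%N = (U' x <= k)%N.
  by move=> kn; have /setP/(_ x) := H k kn; rewrite !inE.
have := E (U x); have := E (U' x); have := ltn_ord (U x); have := ltn_ord (U' x).
by rewrite !leqnn; lia.
Qed.

(** With singleton blocks every exterior power has a single support position. The relation and its
    inverse compare these positions in opposite directions, so they coincide in all degrees and
    determine both permutations. *)
Lemma group_rep_inj U U' W W' :
  group_rel (reppt C (fun=> false) U W) (reppt C (fun=> false) U' W') -> U = U' /\ W = W'.
Proof.
move=> r; have sp : sparse (fun=> false) by [].
have r' := group_rel_sym r.
have H k (kn : (k < n.-1)%N) : loS U k = loS U' k /\ loS W k = loS W' k.
  have kn1 := ltn_ext_deg (Ordinal kn); rewrite /= in kn1.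
  have kn2 := ltnW kn1.
  have lines V V' : reppt C (fun=> false) V V' (Ordinal kn) = <[lineM C (fun=> false) V V' k.+1]>%VS.
    exact: reppt_line.
  have [a1 e1] := loS_ex U kn2; have [a1' e1'] := loS_ex U' kn2.
  have [a2 e2] := loS_ex W kn2; have [a2' e2'] := loS_ex W' kn2.
  have Mn (V V' : 'S_n) a b : sset a = loS V k -> sset b = loS V' k ->
      lineM C (fun=> false) V V' k.+1 a b != 0.
    by move=> ea eb; apply/(lineM_support C V V' kn1 a b sp); left.
  have Mu (V V' : 'S_n) a b a0 b0 : lineM C (fun=> false) V V' k.+1 a b != 0 ->
      sset a0 = loS V k -> sset b0 = loS V' k -> a = a0 /\ b = b0.
    move=> h ea0 eb0; have [[ea eb]|[//]] := (lineM_support C V V' kn1 a b sp).1 h.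
    by split; apply: sset_inj; rewrite ?ea ?eb.
  have [a [b [/Mu/(_ e1 e2)[-> ->] w1 w2]]] := group_rel_entry r (lines _ _) (lines _ _) (Mn _ _ _ _ e1' e2').
  have [a' [b' [/Mu/(_ e1' e2')[-> ->] w1' w2']]] := group_rel_entry r' (lines _ _) (lines _ _) (Mn _ _ _ _ e1 e2).
  by rewrite -e1 -e2 -e1' -e2' (wle_anti w1 w1') (wle_anti w2 w2').
by split; apply: loS_all_inj => k /H[].
Qed.

Section Levels.
Variable d : nat -> bool.

Lemma levelS i : level d i.+1 = (level d i + ~~ d i)%N.
Proof. by rewrite /level big_nat_recr. Qed.

Lemma level_mono i j : (i <= j)%N -> (level d i <= level d j)%N.
Proof.
move=> ij; rewrite /level [leqRHS](big_cat_nat (n := i)) //=.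
exact: leq_addr.
Qed.

Lemma level_eq_d i j l : level d i = level d j -> (i <= l < j)%N -> d l.
Proof.
move=> e /andP[il lj]; have := level_mono il; have := level_mono lj; rewrite levelS e.
by case: (d l) => //=; lia.
Qed.

Hypothesis sd : sparse d.

Lemma level_eq_near i j : level d i = level d j -> (i <= j)%N -> (j <= i.+1)%N.
Proof.
move=> e ij; rewrite leqNgt; apply/negP => lt.
have di : d i by apply: (level_eq_d e); rewrite leqnn (ltn_trans _ lt).
by have := sd di; rewrite (level_eq_d e) // leqnSn.
Qed.

(** With [d k], sparseness excludes a link just before [k], so [k] starts its block. *)
Lemma level_ltE i k : d k -> (i < k)%N = (level d i < level d k)%N.
Proof.
move=> dk; case: (ltnP i k) => ik; last by rewrite ltnNge level_mono.
apply/esym; case: k ik dk => // k; rewrite ltnS => ik dk; rewrite levelS.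
have -> : d k = false by apply: contraTF dk => /sd.
by rewrite /= addn1 ltnS level_mono.
Qed.

Lemma level_class i k : d k -> level d i = level d k -> i = k \/ i = k.+1.
Proof.
move=> dk e; have : (k <= i)%N by rewrite leqNgt level_ltE // e ltnn.
by move=> ki; have := level_eq_near (esym e) ki; lia.
Qed.

(** Each block boundary [j] contributes the truth value of [j < x], which is what [loS] at [j]
    records. *)
Lemma levelE (x : 'I_n) : level d x = (\sum_(0 <= j < n.-1) (~~ d j && (j < x)))%N.
Proof.
have xn : (x <= n.-1)%N by have := ltn_ord x; lia.
rewrite (big_cat_nat (n := x)) //=.
have -> : (\sum_(x <= j < n.-1) (~~ d j && (j < x)) = 0)%N.
  rewrite big_nat_cond big1 // => j; rewrite andbT => /andP[xj _].
  by rewrite ltnNge xj andbF.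
by rewrite addn0; apply: eq_big_nat => j /andP[_ ->]; rewrite andbT.
Qed.

End Levels.

(** Say [a1] is the lighter subset. The entry of [M] at [(a1, a1)] must come from an entry of [M']
    with no heavier row or column, but each support position of [M'] involves [a2]. *)
Lemma no_swap x y (k : 'I_n.-1) M M' (a1 a2 : 'I_(ext_dim n k.+1)) : quadric_rel x y ->
  x k = <[M']>%VS -> y k = <[M]>%VS -> M a1 a1 != 0 -> M a2 a2 != 0 ->
  (forall a b, M' a b != 0 -> (a = a1 /\ b = a2) \/ (a = a2 /\ b = a1)) ->
  weight (sb a1) != weight (sb a2) -> False.
Proof.
move=> r xk yk M1 M2 H' w.
wlog lt : a1 a2 M1 M2 H' w / (weight (sb a1) < weight (sb a2))%N.
  move=> H; case: (ltngtP (weight (sb a1)) (weight (sb a2))) => [|lt|e]; first exact: H.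
    apply: (H a2 a1) => //; last by rewrite eq_sym.
    by move=> a b /H'[]; [right|left].
  by rewrite e eqxx in w.
have [a [b [/H' ab wa wb]]] := quadric_rel_entry r xk yk M1.
have n2 : ~ wle a2 a1 by case=> [e|]; [rewrite e ltnn in lt|rewrite ltnNge ltnW].
by case: ab => -[ea eb]; subst a b.
Qed.

(* At a block boundary the matrix has rank one, which is invariant; the 2 x 2 minor on
   the two support positions rules this out inside a block. *)
Lemma rep_d_le d d' U W U' W' k : sparse d -> sparse d' -> (k < n.-1)%N ->
  quadric_rel (reppt C d U W) (reppt C d' U' W') -> d' k -> d k.
Proof.
move=> sd sd' kn r dk'; apply: contraT => dk.
have kn1 := ltn_ext_deg (Ordinal kn); rewrite /= in kn1.
have [a1 e1] := loS_ex U' (ltnW kn1); have [a2 e2] := hiS_ex U' kn1.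
have [b1 f1] := loS_ex W' (ltnW kn1); have [b2 f2] := hiS_ex W' kn1.
have M11 : lineM C d' U' W' k.+1 a1 b1 != 0 by apply/(lineM_support C U' W' kn1 _ _ sd'); left.
have M22 : lineM C d' U' W' k.+1 a2 b2 != 0 by apply/(lineM_support C U' W' kn1 _ _ sd'); right.
have M12 : lineM C d' U' W' k.+1 a1 b2 = 0.
  apply/eqP; apply: contraT => /(lineM_support C U' W' kn1 _ _ sd')[[_]|[_]].
    by rewrite f2 => e; case: (lo_neq_hi kn1 (esym e)).
  by rewrite e1 => e; case: (lo_neq_hi kn1 e).
have [P tP yE] := r.
have yk := reppt_line C d' U' W' (Ordinal kn).
have : reppt C d' U' W' = lr_act (P *m perm_mx U) (perm_mx W^-1%g *m P^T) (@dpt C n d).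
  by rewrite yE lr_act_comp.
move=> /(congr1 (fun z : flines C n => z (Ordinal kn))).
rewrite yk (lr_act_line _ _ (k := Ordinal kn) (M := stdmx n (Ordinal kn).+1 (fun j => (d j)%:R))) // => e.
have := memv_line (lineM C d' U' W' k.+1); rewrite /= in e; rewrite e => /vlineP[c].
have stdE : stdmx n k.+1 (fun j => (d j)%:R : C) = delta_mx (top (ltnW kn1)) (top (ltnW kn1)).
  apply/matrixP => a b; rewrite [RHS]mxE.
  have [<-|ab] := eqVneq a b; last first.
    rewrite (_ : _ && _ = false); first by rewrite !mxE (negPf ab).
    by apply: contraNF ab => /andP[/eqP -> /eqP ->].
  have := stdmx_support C kn1 a sd; rewrite (negPf dk) /= orbF => sup.
  rewrite andbb; case: (eqVneq a (top (ltnW kn1))) sup => [->|_] h; first by rewrite stdmx_top.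
  by move/negbFE/eqP: h.
set A := ext_mx k.+1 (P *m perm_mx U); set B := ext_mx k.+1 (_ *m P^T).
move=> ME; have ME' a b : lineM C d' U' W' k.+1 a b = c * (A a (top (ltnW kn1)) * B (top (ltnW kn1)) b).
  rewrite ME stdE mxE; congr (_ * _); rewrite mxE (bigD1 (top (ltnW kn1))) //= big1 ?addr0.
    congr (_ * _); rewrite mxE (bigD1 (top (ltnW kn1))) //= big1 ?addr0.
      by rewrite [delta_mx _ _ _ _]mxE !eqxx mulr1.
    by move=> s /negPf st; rewrite [delta_mx _ _ _ _]mxE st mulr0.
  move=> s /negPf st; rewrite mxE big1 ?mul0r // => s' _.
  by rewrite [delta_mx _ _ _ _]mxE st andbF mulr0.
have : lineM C d' U' W' k.+1 a1 b1 * lineM C d' U' W' k.+1 a2 b2 =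
       lineM C d' U' W' k.+1 a1 b2 * lineM C d' U' W' k.+1 a2 b1.
  by rewrite !ME'; ring.
by rewrite M12 mul0r => /eqP; rewrite mulf_eq0 (negPf M11) (negPf M22).
Qed.

(** At a block boundary the support has a single row index, and comparing weights in both directions
    makes it invariant. *)
Lemma rep_loS d d' U W U' W' k : sparse d -> sparse d' -> (k < n.-1)%N ->
  quadric_rel (reppt C d U W) (reppt C d' U' W') -> ~~ d k -> ~~ d' k -> loS U k = loS U' k.
Proof.
move=> sd sd' kn r dk dk'; have r' := quadric_rel_sym r.
have kn1 := ltn_ext_deg (Ordinal kn); rewrite /= in kn1.
have kn2 := ltnW kn1.
have lines e V V' : reppt C e V V' (Ordinal kn) = <[lineM C e V V' k.+1]>%VS.
  exact: reppt_line.
have [a1 e1] := loS_ex U kn2; have [a1' e1'] := loS_ex U' kn2.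
have [a2 e2] := loS_ex W kn2; have [a2' e2'] := loS_ex W' kn2.
have Mn e (V V' : 'S_n) a b : sparse e -> sset a = loS V k -> sset b = loS V' k ->
    lineM C e V V' k.+1 a b != 0.
  by move=> se ea eb; apply/(lineM_support C V V' kn1 a b se); left.
have Mu e (V V' : 'S_n) a b a0 : sparse e -> ~~ e k -> lineM C e V V' k.+1 a b != 0 ->
    sset a0 = loS V k -> a = a0.
  move=> se /negPf ek /(lineM_support C V V' kn1 a b se)[[ea eb]|[]]; last by rewrite ek.
  by move=> ea0; apply: sset_inj; rewrite ea.
have [a [b [/(Mu _ _ _ _ _ _ sd dk)/(_ e1) -> w1 _]]] := quadric_rel_entry r (lines _ _ _) (lines _ _ _) (Mn _ _ _ _ _ sd' e1' e2').
have [a' [b' [/(Mu _ _ _ _ _ _ sd' dk')/(_ e1') -> w1' _]]] := quadric_rel_entry r' (lines _ _ _) (lines _ _ _) (Mn _ _ _ _ _ sd e1 e2).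
by rewrite -e1 -e1' (wle_anti w1 w1').
Qed.

(* Two distinct permutations with the same levels differ by a swap within a block
   of size two, which exchanges diagonal and off-diagonal support. *)
Lemma rep_perm_eq d U U' W : sparse d ->
  (forall x : 'I_n, level d (U x) = level d (W x)) -> (forall x : 'I_n, level d (U' x) = level d (W x)) ->
  quadric_rel (reppt C d U W) (reppt C d U' W) -> U = U'.
Proof.
move=> sd LU LU' r; apply/permP => x; apply/eqP; apply: contraT => ne.
wlog lt : U U' LU LU' r ne / (U x < U' x)%N.
  move=> H; case: (ltngtP (U x) (U' x)) => [|lt|/val_inj e]; first exact: (H U U').
    by apply: (H U' U) => //; [exact: quadric_rel_sym|rewrite eq_sym].
  by rewrite e eqxx in ne.
(* The block is {k, k + 1}: [U] sends [x], [y] to k, k + 1 and [U'] sends them to k + 1, k. *)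
have [k kE] : exists k, k = U x :> nat by exists (U x).
have eqk : level d (U x) = level d (U' x) by rewrite LU LU'.
have dk : d k by rewrite kE; apply: (level_eq_d eqk); rewrite leqnn.
have U'x : U' x = k.+1 :> nat.
  by have := level_eq_near sd eqk (ltnW lt); rewrite kE; lia.
have kn1 : (k.+1 < n)%N by rewrite -U'x.
have kn : (k < n.-1)%N by lia.
pose y := (U^-1)%g (Ordinal kn1).
have Uy : U y = k.+1 :> nat by rewrite permKV.
have xy : x != y by apply: contra_eq_neq Uy => <-; rewrite -kE; lia.
have lev1 : level d k.+1 = level d k by rewrite levelS dk addn0.
have inj2 (V : 'S_n) : V x = V y :> nat -> False.
  by move=> /val_inj/perm_inj e; rewrite e eqxx in xy.
have U'y : U' y = k :> nat.
  have [//|e] : U' y = k :> nat \/ U' y = k.+1 :> nat.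
    by apply: (level_class sd dk); rewrite LU' -LU Uy lev1.
  by case: (inj2 U'); rewrite e U'x.
(* [Z] collects the indices of the earlier blocks, the same for [U], [U'] and [W]; each [loS] and
   [hiS] is [Z] with [x] or [y] added. *)
pose Z := [set z | (level d (W z) < level d k)%N]%SET.
have ltZ (V : 'S_n) z : (forall x : 'I_n, level d (V x) = level d (W x)) -> (V z < k)%N = (z \in Z).
  by move=> LV; rewrite inE (level_ltE sd _ dk) LV.
have loE (V : 'S_n) u : (forall x : 'I_n, level d (V x) = level d (W x)) -> V u = k :> nat -> loS V k = (u |: Z)%SET.
  move=> LV Vu; apply/setP => z; rewrite in_setU1 [LHS]inE leq_eqVlt (ltZ V) //; congr (_ || _).
  by rewrite -Vu (inj_eq val_inj) (inj_eq perm_inj).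
have hiE (V : 'S_n) u : (forall x : 'I_n, level d (V x) = level d (W x)) -> V u = k.+1 :> nat -> hiS V k = (u |: Z)%SET.
  move=> LV Vu; apply/setP => z; rewrite in_setU1 [LHS]inE orbC (ltZ V) //; congr (_ || _).
  by rewrite -Vu (inj_eq val_inj) (inj_eq perm_inj).
have [a1 e1] := loS_ex U (ltnW kn1); have [a2 e2] := hiS_ex U kn1.
rewrite (loE U x) // in e1; rewrite (hiE U y) // in e2.
have xZ : x \notin Z by rewrite -(ltZ U) // -kE ltnn.
have yZ : y \notin Z by rewrite -(ltZ U) // Uy; lia.
have w : weight (sb a1) != weight (sb a2).
  rewrite !weight_sset e1 e2 !big_setU1 //= eqn_add2r; apply: contra_neq xy; exact: val_inj.
have lines V V' : reppt C d V V' (Ordinal kn) = <[lineM C d V V' k.+1]>%VS by exact: reppt_line.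
have LW : forall x : 'I_n, level d (W x) = level d (W x) by [].
(* [W] agrees on [x] and [y] with exactly one of [U] and [U']; that one has diagonal support, the
   other off-diagonal. *)
have [Wx|Wx] : W x = k :> nat \/ W x = k.+1 :> nat.
- by apply: (level_class sd dk); rewrite -LU -kE.
- have Wy : W y = k.+1 :> nat.
    have [e|//] : W y = k :> nat \/ W y = k.+1 :> nat.
      by apply: (level_class sd dk); rewrite -LU Uy lev1.
    by case: (inj2 W); rewrite e Wx.
  case: (@no_swap _ _ (Ordinal kn) _ _ a1 a2 (quadric_rel_sym r) (lines _ _) (lines _ _)) => //.
  + apply/(lineM_support C U W kn1 _ _ sd); left.
    by rewrite e1 (loE U x) // (loE W x).
  + apply/(lineM_support C U W kn1 _ _ sd); right.
    by rewrite e2 (hiE U y) // (hiE W y).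
  move=> a b /(lineM_support C U' W kn1 _ _ sd)[[]|[_]].
    rewrite (loE U' y) // (loE W x) // -e1 -e2 => ea eb; right.
    by split; apply: sset_inj.
  rewrite (hiE U' x) // (hiE W y) // -e1 -e2 => ea eb; left.
  by split; apply: sset_inj.
have Wy : W y = k :> nat.
  have [//|e] : W y = k :> nat \/ W y = k.+1 :> nat.
    by apply: (level_class sd dk); rewrite -LU Uy lev1.
  by case: (inj2 W); rewrite e Wx.
case: (@no_swap _ _ (Ordinal kn) _ _ a1 a2 r (lines _ _) (lines _ _)) => //.
+ apply/(lineM_support C U' W kn1 _ _ sd); right.
  by rewrite e1 (hiE U' x) // (hiE W x).
+ apply/(lineM_support C U' W kn1 _ _ sd); left.
  by rewrite e2 (loE U' y) // (loE W y).
move=> a b /(lineM_support C U W kn1 _ _ sd)[[]|[_]].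
  rewrite (loE U x) // (loE W y) // -e1 -e2 => ea eb; left.
  by split; apply: sset_inj.
rewrite (hiE U y) // (hiE W x) // -e1 -e2 => ea eb; right.
by split; apply: sset_inj.
Qed.

Lemma rep_levels d d' U W U' W' : sparse d -> sparse d' ->
  quadric_rel (reppt C d U W) (reppt C d' U' W') ->
  (forall k, (k < n.-1)%N -> d k = d' k) /\ forall x : 'I_n, level d (U x) = level d (U' x).
Proof.
move=> sd sd' r.
have dd k : (k < n.-1)%N -> d k = d' k.
  by move=> kn; apply/idP/idP; [exact: rep_d_le sd' sd kn (quadric_rel_sym r)|exact: rep_d_le sd sd' kn r].
split=> // x; rewrite !levelE; apply: eq_big_nat => j /andP[_ jn].
have [//|dj] := boolP (d j); rewrite /= !ltnNge.
have /setP/(_ x) := rep_loS sd sd' jn r dj (etrans (congr1 negb (esym (dd j jn))) dj).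
by rewrite !inE => ->.
Qed.

End Injectivity.

(** * Sparse block patterns and Fibonacci numbers *)

Fixpoint sparse_lists (m : nat) : seq (seq bool) :=
  if m is m1.+1 then
    if m1 is m2.+1 then
      map (cons false) (sparse_lists m1) ++
      map (fun l => true :: false :: l) (sparse_lists m2)
    else [:: [:: false]; [:: true]]
  else [:: [::]].

Lemma sparse_listsSS m : sparse_lists m.+2 =
  map (cons false) (sparse_lists m.+1) ++ map (fun l => true :: false :: l) (sparse_lists m).
Proof. by []. Qed.

Lemma nat_ind2 (P : nat -> Prop) : P 0%N -> P 1%N ->
  (forall m, P m -> P m.+1 -> P m.+2) -> forall m, P m.
Proof.
move=> P0 P1 PS m; suff [] : P m /\ P m.+1 by [].
by elim: m => [|m [IH1 IH2]]; split=> //; exact: PS.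
Qed.

(** A list of length [m] encodes a composition of [m + 1] into parts 1 and 2; splitting off the
    first part gives the recursion. *)
Lemma size_sparse_lists m : size (sparse_lists m) = fib m.+2.
Proof.
elim/nat_ind2: m => // m IH1 IH2.
by rewrite sparse_listsSS size_cat !size_map IH1 IH2.
Qed.

Lemma sparse_lists_uniq m : uniq (sparse_lists m).
Proof.
elim/nat_ind2: m => // m IH1 IH2; rewrite sparse_listsSS cat_uniq !map_inj_uniq ?IH1 ?IH2.
- rewrite andbT /=; apply/hasPn => _ /mapP[l _ ->]; apply/negP => /mapP[l' _].
  by [].
- by move=> l l' [].
- by move=> l l' [].
Qed.

Lemma sparse_listsP m l : l \in sparse_lists m -> size l = m /\ sparse (nth false l).
Proof.
elim/nat_ind2: m l => [l|l|m IH1 IH2 l].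
- by rewrite inE => /eqP ->; split=> // -[].
- by rewrite !inE => /orP[] /eqP ->; split=> // -[|[]].
rewrite sparse_listsSS mem_cat => /orP[] /mapP[l' /[swap] ->].
  by move=> /IH2[<- sl]; split=> // -[|j] //=; exact: sl.
move=> /IH1[<- sl]; split=> // -[|[|j]] //=; exact: sl.
Qed.

(** * Counting the orbits *)

Section OrbitCounts.
Variables (C : numClosedFieldType) (n : nat).
Implicit Types (d : nat -> bool) (U W pi : 'S_n) (x : flines C n).

(* An arbitrary but fixed representative, depending only on [d] and [f]. *)
Definition canon d (f : 'I_n -> nat) : 'S_n :=
  odflt 1%g [pick W : 'S_n | [forall k, level d (W k) == f k]].

Lemma canonP d (f : 'I_n -> nat) : (exists W : 'S_n, forall k, level d (W k) = f k) ->
  forall k, level d (canon d f k) = f k.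
Proof.
move=> [W HW] k; rewrite /canon; case: pickP => [V /forallP/(_ k)/eqP //|/(_ W)/negP[]].
by apply/forallP => j; rewrite HW.
Qed.

Lemma eq_canon d d' f f' : (forall i : 'I_n, level d i = level d' i) -> f =1 f' ->
  canon d f = canon d' f'.
Proof.
move=> dd ff; rewrite /canon; congr (odflt _ _); apply: eq_pick => W.
by apply: eq_forallb => k; rewrite dd ff.
Qed.

Lemma eq_level d d' : (forall j, (j < n.-1)%N -> d j = d' j) ->
  forall i : 'I_n, level d i = level d' i.
Proof.
by move=> dd i; rewrite !levelE; apply: eq_big_nat => j /andP[_ jn]; rewrite dd.
Qed.

Lemma eq_reppt d d' U W : (forall j, (j < n.-1)%N -> d j = d' j) ->
  reppt C d U W = reppt C d' U W.
Proof.
move=> dd; rewrite /reppt; congr lr_act; apply: functional_extensionality_dep => k.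
by rewrite /dpt /stdpt; congr <[_]>%VS; apply: eq_stdmx => j jn; rewrite dd.
Qed.

(** A normal form given by pi and [W] is stored as the single permutation U = pi W. As pi preserves
    blocks, the levels of [U] are those of [W], so a canonical [W] is recovered from [U], and then
    pi as [invo]. *)
Definition Wof d U := canon d (fun k => level d (U k)).
Definition invo d U := (U * (Wof d U)^-1)%g.
Definition good d U := [forall k, invo d U (invo d U k) == k].
Definition qrep d U := reppt C d U (Wof d U).

Lemma level_Wof d U k : level d (Wof d U k) = level d (U k).
Proof. by apply: (@canonP d (fun k => level d (U k))); exists U. Qed.

Lemma repptE d pi W : reppt C d (pi * W)%g W = lr_act (perm_mx pi) 1%:M (permpt C d W).
Proof. by rewrite /reppt /permpt lr_act_comp perm_mxM mulmx1. Qed.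

Lemma qrepE d U : qrep d U = lr_act (perm_mx (invo d U)) 1%:M (permpt C d (Wof d U)).
Proof. by rewrite -repptE /invo -mulgA mulVg mulg1. Qed.

Lemma level_invo d U k : level d (Wof d U (invo d U k)) = level d (Wof d U k).
Proof. by rewrite /invo permM permKV level_Wof. Qed.

(** An involution preserving the levels makes the permuted diagonal matrix symmetric, and the point
    is its limit. *)
Lemma qrep_closure d U : good d U -> complete_quadrics (qrep d U).
Proof.
move=> /forallP gU; rewrite complete_quadricsE qrepE.
set pi := invo d U; set W := Wof d U.
have pi2 k : pi (pi k) = k by exact/eqP/gU.
pose A : 'M[{poly C}]_n := perm_mx pi *m diag_mx (\row_k 'X^(level d (W k))) *m perm_mx 1%g.
have AE : A = perm_mx pi *m diag_mx (\row_k 'X^(level d (W k))) by rewrite /A perm_mx1 mulmx1.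
apply: (@lim_closure _ _ true A).
- move=> _; apply/matrixP => i j; rewrite AE mxE !mul_mx_diag !mxE.
  have -> : (pi j == i) = (pi i == j) by apply/eqP/eqP => <-; rewrite pi2.
  by case: eqP => [<-|_]; rewrite ?mul0r // level_invo.
- rewrite AE det_mulmx det_perm det_diag mulf_neq0 ?signr_eq0 //.
  by apply/prodf_neq0 => k _; rewrite mxE -size_poly_eq0 size_polyXn.
have := is_lim_perm pi 1%g (is_lim_levels C d W).
by rewrite -/A !perm_mx1.
Qed.

Lemma quadric_surj x : complete_quadrics x ->
  exists (l : n.-1.-tuple bool) U, good (nth false l) U /\ quadric_rel x (qrep (nth false l) U).
Proof.
rewrite complete_quadricsE => /closure_is_lim[A [sA dA lx]].
have [P [d [W [pi [tP pi2 lev ->]]]]] := sym_normal_form (sA isT) dA lx.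
pose l := [tuple d i | i < n.-1]; exists l.
have ld j : (j < n.-1)%N -> d j = nth false l j.
  by move=> jn; rewrite -[j]/(nat_of_ord (Ordinal jn)) nth_mktuple.
set d' := nth false l in ld *.
have lev' k : level d' (W (pi k)) = level d' (W k) by rewrite -!(eq_level ld).
pose W0 := canon d' (fun k => level d' (W k)).
have W0E k : level d' (W0 k) = level d' (W k).
  by apply: (@canonP d' (fun k => level d' (W k))); exists W.
exists (pi * W0)%g.
have WofE : Wof d' (pi * W0)%g = W0.
  by apply: eq_canon => // k; rewrite permM W0E lev'.
have invoE : invo d' (pi * W0)%g = pi by rewrite /invo WofE mulgK.
split; first by apply/forallP => k; rewrite invoE pi2.
have ptE : permpt C d W = permpt C d' W0.
  rewrite -[LHS]/(reppt C d W W) (eq_reppt _ _ ld).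
  (* [W] and [W0] give the same exponents, so both points are limits of one diagonal matrix. *)
  apply: is_lim_uniq (is_lim_levels C d' W) _.
  rewrite (_ : \row_k _ = \row_k 'X^(level d' (W0 k))); first exact: is_lim_levels.
  by apply/rowP => k; rewrite !mxE W0E.
rewrite qrepE invoE WofE -ptE; apply: quadric_rel_sym.
by exists P.
Qed.

Lemma sparse_good d U : sparse d -> good d U.
Proof.
move=> sd; apply/forallP => k; apply: contraT => ne.
set p := invo d U in ne; set W := Wof d U.
have L j : level d (W (p j)) = level d (W j) by exact: level_invo.
have ne1 : p k != k by apply: contra_neq ne => e; rewrite !e.
have ne2 : p (p k) != p k by rewrite (inj_eq perm_inj).
have near (i j : 'I_n) : level d (W i) = level d (W j) -> (W i <= W j)%N -> (W j <= (W i).+1)%N.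
  exact: level_eq_near.
have dist (i j : 'I_n) : i != j -> (W i : nat) <> W j.
  by move=> ij /val_inj/perm_inj e; rewrite e eqxx in ij.
have := near _ _ (L k); have := near _ _ (esym (L k)).
have := near _ _ (L (p k)); have := near _ _ (esym (L (p k))).
have e3 : level d (W (p (p k))) = level d (W k) by rewrite !L.
have := near _ _ e3; have := near _ _ (esym e3).
by have := dist _ _ ne; have := dist _ _ ne1; have := dist _ _ ne2; lia.
Qed.

Lemma quadric_inj (l l' : seq bool) U U' :
  size l = n.-1 -> size l' = n.-1 -> sparse (nth false l) -> sparse (nth false l') ->
  quadric_rel (qrep (nth false l) U) (qrep (nth false l') U') -> l = l' /\ U = U'.
Proof.
move=> sl sl' sp sp' r; have [dd LU] := rep_levels sp sp' r.
have e : l = l' by apply: (@eq_from_nth _ false) => [|i il]; rewrite ?sl // dd // -sl.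
split=> //; subst l'; move: r; rewrite /qrep.
have -> : Wof (nth false l) U' = Wof (nth false l) U by apply: eq_canon => // k; rewrite LU.
apply: rep_perm_eq => // k; first by rewrite level_Wof.
by rewrite level_Wof LU.
Qed.

Local Open Scope classical_set_scope.

Lemma quadric_count : (2 < n)%N -> exists2 N,
  orbit_count (@borel C n) (@quadric_act C n) (@complete_quadrics C n) N &
  (fib n * n`! < N < 2 ^ n.-1 * n`!)%N.
Proof.
move=> n2; have n0 : (0 < n)%N by lia.
pose T := {p : n.-1.-tuple bool * 'S_n | good (nth false p.1) p.2}.
have [x /quadric_surj[l [U [g r]]]|N cN NT] := @orbit_count_exists _ _ (@borel C n) (@quadric_act C n)
    (@complete_quadrics C n) T (fun t => qrep (nth false (val t).1) (val t).2).
  by exists (exist (fun p : n.-1.-tuple bool * 'S_n => is_true (good (nth false p.1) p.2)) (l, U) g); apply/(quadric_orbit_eq n0).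
exists N => //; apply/andP; split.
  pose T' : finType := (seq_sub (sparse_lists n.-1) * 'S_n)%type.
  have : (#|T'| <= N)%N.
    apply: (orbit_count_ge (rep := fun t : T' => qrep (nth false (val t.1)) t.2) _ _ cN).
      by move=> [s V]; apply: qrep_closure; apply: sparse_good; case: (sparse_listsP (valP s)).
    move=> [s V] [s' V'] /(quadric_orbit_eq n0) /= r.
    have [sz sp] := sparse_listsP (valP s); have [sz' sp'] := sparse_listsP (valP s').
    by have [/val_inj -> ->] := quadric_inj sz sz' sp sp' r.
  apply: leq_trans; rewrite card_prod card_seq_sub ?sparse_lists_uniq // size_sparse_lists card_Sn.
  (* The patterns of length n - 1 number F_(n+1), which is strictly larger than F_n for the present
     [n]. *)
  rewrite ltn_pmul2r ?fact_gt0 //; case: n n2 => [|[|m]] // _.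
  by rewrite -[X in (_ < X)%N]/(fib m.+2 + fib m.+1)%N -addn1 leq_add2l; elim: m => // m IH; rewrite addn_gt0 IH.
apply: leq_ltn_trans NT _.
have -> : (2 ^ n.-1 * n`!)%N = #|{: n.-1.-tuple bool * 'S_n}|.
  by rewrite card_prod card_tuple card_bool card_Sn.
rewrite card_sig; apply: proper_card; apply/properP; split; first by apply/fintype.subsetP => p.
(* A single block: all levels are 0, so [Wof] is the same for every permutation and any permutation,
   here a 3-cycle, occurs as [invo]. *)
pose l : n.-1.-tuple bool := [tuple of nseq n.-1 true].
have lev0 (i : 'I_n) : level (nth false l) i = 0%N.
  rewrite /level big_nat_cond big1 // => j /andP[/andP[_ ji] _].
  by rewrite nth_nseq ifT //; have := ltn_ord i; lia.
pose V := canon (nth false l) (fun=> 0%N).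
pose i0 : 'I_n := Ordinal n0; pose i1 : 'I_n := Ordinal (ltnW n2); pose i2 : 'I_n := Ordinal n2.
pose c := (tperm i0 i1 * tperm i1 i2)%g.
exists (l, (c * V)%g) => //; rewrite inE /=; apply/forallP => /(_ i0).
have -> : invo (nth false l) (c * V)%g = c.
  rewrite /invo (_ : Wof _ _ = V) ?mulgK //; apply: eq_canon => // k; exact: lev0.
by rewrite /c !permM tpermL tpermL (tpermD (x := i0)) // tpermR.
Qed.

(** Supplies the finiteness of the number of orbits that [orbit_count] asserts. *)
Lemma group_surj x : (0 < n)%N -> wonderful_group x ->
  exists (l : n.-1.-tuple bool) W pi,
    group_rel x (lr_act 1%:M (perm_mx pi) (permpt C (nth false l) W)).
Proof.
move=> n0; rewrite wonderful_groupE // => /closure_is_lim[A [_ dA lx]].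
have [P [Q [d [W [pi [tP tQ ->]]]]]] := gen_normal_form dA lx.
pose l := [tuple d i | i < n.-1]; exists l, W, pi.
have ld j : (j < n.-1)%N -> d j = nth false l j.
  by move=> jn; rewrite -[j]/(nat_of_ord (Ordinal jn)) nth_mktuple.
rewrite -[permpt C d W]/(reppt C d W W) (eq_reppt _ _ ld).
by apply: group_rel_sym; exists P, Q.
Qed.

(** Limit of a permutation matrix times a diagonal matrix with pairwise distinct exponents. *)
Lemma group_rep_closure U W : (0 < n)%N -> wonderful_group (reppt C (fun=> false) U W).
Proof.
move=> n0; rewrite wonderful_groupE //.
have := is_lim_perm (U * W^-1)%g 1%g (is_lim_levels C (fun=> false) W).
rewrite !perm_mx1 -repptE mulgKV mulmx1; apply: lim_closure => //.
rewrite det_mulmx det_perm det_diag mulf_neq0 ?signr_eq0 //.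
by apply/prodf_neq0 => k _; rewrite mxE -size_poly_eq0 size_polyXn.
Qed.

Lemma group_count : (2 < n)%N -> exists2 N,
  orbit_count (@borel C n `*` @borel C n) (@group_act C n) (@wonderful_group C n) N &
  (2 ^ n.-1 * n`! < N)%N.
Proof.
move=> n2; have n0 : (0 < n)%N by lia.
have [x Yx|N cN _] := @orbit_count_exists _ _ (@borel C n `*` @borel C n) (@group_act C n)
    (@wonderful_group C n) (n.-1.-tuple bool * ('S_n * 'S_n))%type
    (fun t => lr_act 1%:M (perm_mx t.2.2) (permpt C (nth false t.1) t.2.1)).
  have [l [W [pi r]]] := group_surj n0 Yx.
  by exists (l, (W, pi)); apply/(group_orbit_eq n0).
exists N => //.
have : (#|{: 'S_n * 'S_n}| <= N)%N.
  apply: (orbit_count_ge (rep := fun t : 'S_n * 'S_n => reppt C (fun=> false) t.1 t.2) _ _ cN).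
    by move=> t; exact: group_rep_closure.
  by move=> [U W] [U' W'] /(group_orbit_eq n0)/group_rep_inj[/= -> ->].
(* After cancelling one factorial, 2^(n-1) < n! remains, by induction from n = 3. *)
apply: leq_trans; rewrite card_prod card_Sn ltn_pmul2r ?fact_gt0 //.
move: n2; case: n => // m; elim: m => // -[//|[//|m] IH] _.
rewrite /= expnS factS; have := IH isT; rewrite /= => h.
by apply: leq_ltn_trans (_ : m.+4 * 2 ^ m.+2 < _)%N; rewrite ?ltn_pmul2l // leq_mul2r orbT.
Qed.

End OrbitCounts.

(* Taking the equality of field structures as a hypothesis keeps unification from
   unfolding the two canonical field structures of [R[i]] inside the varieties. *)
Lemma orbit_counts (C : numClosedFieldType) (F : fieldType) n :
  F = C :> fieldType -> (2 < n)%N -> exists bX bE : nat,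
    [/\ orbit_count (@borel F n) (@quadric_act F n) (@complete_quadrics F n) bX,
        orbit_count (@borel F n `*` @borel F n)%classic (@group_act F n)
          (@wonderful_group F n) bE,
        (fib n * n`! < bX)%N, (bX < 2 ^ n.-1 * n`!)%N & (2 ^ n.-1 * n`! < bE)%N].
Proof.
move=> -> n2; have [bX cX /andP[lo hi]] := quadric_count C n2.
by have [bE cE up] := group_count C n2; exists bX, bE.
Qed.

Local Open Scope classical_set_scope.

Theorem theorem1p6 (R : realType) :
  exists N : nat, forall n : nat, (N <= n)%N ->
  exists bX bE : nat,
    [/\ orbit_count (@borel R[i] n) (@quadric_act R[i] n)
          (@complete_quadrics R[i] n) bX,
        orbit_count (@borel R[i] n `*` @borel R[i] n) (@group_act R[i] n)
          (@wonderful_group R[i] n) bE,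
        (fib n * n`! < bX)%N,
        (bX < 2 ^ n.-1 * n`!)%N
      & (2 ^ n.-1 * n`! < bE)%N].
Proof.
(* From 3 on there is a 3-cycle and 2^(n-1) < n!. *)
exists 3%N => n n3.
exact: (@orbit_counts R[i] _ n erefl n3).
Qed.
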